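(* The functions $I^4(\tau)+J^{-4}(\tau)$ and $J^4(\tau)+I^{-4}(\tau)$ are modular functions on $\Gamma_0(10)$ and satisfy, with $U(\tau)=I(\tau)/J(\tau)$, \[ I^4(\tau)+\frac{1}{J^4(\tau)}=\frac{1}{U^2(\tau)}-2+3U^2(\tau),\qquad J^4(\tau)+\frac{1}{I^4(\tau)}=\frac{1}{U^6(\tau)}-\frac{2}{U^4(\tau)}+\frac{3}{U^2(\tau)}. \]
   Context: Throughout, $\tau\in\mathbb{H}$, $q=e^{2\pi i\tau}$, $q^r=e^{2\pi i r\tau}$ for rational $r$, $(a;q)_\infty=\prod_{n\ge0}(1-aq^n)$. Define $I(\tau)=q^{3/4}\dfrac{(q;q^{10})_\infty(q^9;q^{10})_\infty}{(q^4;q^{10})_\infty(q^6;q^{10})_\infty}$ and $J(\tau)=q^{1/4}\dfrac{(q^2;q^{10})_\infty(q^8;q^{10})_\infty}{(q^3;q^{10})_\infty(q^7;q^{10})_\infty}$. A modular function on a congruence subgroup $\Gamma$ is a function meromorphic on $\mathbb{H}$, invariant under $\Gamma$, and meromorphic at all cusps. $\Gamma_0(10)$ is the group of matrices in $\mathrm{SL}_2(\mathbb{Z})$ with lower-left entry divisible by $10$. *)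

(* Defs.v *)
From HB Require Import structures.
From mathcomp Require Import all_boot all_order all_algebra.
From mathcomp Require Import all_classical all_reals all_analysis.
From mathcomp Require Import complex.
Set Implicit Arguments. Unset Strict Implicit. Unset Printing Implicit Defensive.
Import Order.TTheory GRing.Theory Num.Theory.
Import numFieldNormedType.Exports.
Local Open Scope classical_set_scope.
Local Open Scope ring_scope.

Section Defs.
Variable R : realType.

(* The complex numbers C = R[i], seen as a numFieldType; via
   numFieldNormedType it is a normed module over itself (norm = modulus),
   so [derivable f z 1] is complex differentiability. *)
Definition CC : numFieldType := R[i].

Definition reC (z : CC) : R := complex.Re (z : R[i]).
Definition imC (z : CC) : R := complex.Im (z : R[i]).

Definition inH (tau : CC) : Prop := 0 < imC tau.

Definition e2pi (t : CC) : CC :=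
  (((expR (- (2 * pi * imC t)))%:C)%C : R[i]) *
  (((cos (2 * pi * reC t)) +i* (sin (2 * pi * reC t)))%C : R[i]).

Definition qpow (r : rat) (tau : CC) : CC := e2pi (ratr r * tau).

Definition qq (tau : CC) : CC := e2pi tau.

Definition pochinf (a b : CC) : CC :=
  limn (fun N : nat => \prod_(n < N) (1 - a * b ^+ n)).

Definition Ifun (tau : CC) : CC :=
  let q := qq tau in
  qpow (3%:Q / 4%:Q) tau *
  (pochinf q (q ^+ 10) * pochinf (q ^+ 9) (q ^+ 10)) /
  (pochinf (q ^+ 4) (q ^+ 10) * pochinf (q ^+ 6) (q ^+ 10)).

Definition Jfun (tau : CC) : CC :=
  let q := qq tau in
  qpow (1%:Q / 4%:Q) tau *
  (pochinf (q ^+ 2) (q ^+ 10) * pochinf (q ^+ 8) (q ^+ 10)) /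
  (pochinf (q ^+ 3) (q ^+ 10) * pochinf (q ^+ 7) (q ^+ 10)).

Definition mobius (a b c d : int) (tau : CC) : CC :=
  (a%:~R * tau + b%:~R) / (c%:~R * tau + d%:~R).

Definition meromorphic_on_H (f : CC -> CC) : Prop :=
  forall z0 : CC, inH z0 ->
    exists (m : nat) (eps : R) (g : CC -> CC), 0 < eps /\
      (forall z : CC, `|z - z0| < (eps%:C)%C -> derivable g z 1) /\
      (forall z : CC, 0 < `|z - z0| < (eps%:C)%C -> (z - z0) ^+ m * f z = g z).

Definition Gamma0_invariant (N : int) (f : CC -> CC) : Prop :=
  forall a b c d : int, a * d - b * c = 1 -> (N %| c)%Z ->
    forall tau : CC, inH tau -> f (mobius a b c d tau) = f tau.

(* meromorphic at all cusps: for every gamma in SL_2(Z), f(gamma tau) has,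
   for Im tau large, a Laurent expansion in q_h = e(tau/h) with finitely many
   negative powers:  f(gamma tau) = sum_{n >= 0} c_n q_h^(n - M). *)
Definition meromorphic_at_cusps (f : CC -> CC) : Prop :=
  forall a b c d : int, a * d - b * c = 1 ->
    exists (h : nat) (M : nat) (coef : nat -> CC) (y0 : R), (0 < h)%N /\
      forall tau : CC, y0 < imC tau ->
        (fun K : nat => \sum_(n < K) coef n * e2pi (tau / h%:R) ^+ n) @ \oo -->
          e2pi (tau / h%:R) ^+ M * f (mobius a b c d tau).

Definition modular_function_Gamma0 (N : int) (f : CC -> CC) : Prop :=
  [/\ meromorphic_on_H f, Gamma0_invariant N f & meromorphic_at_cusps f].

End Defs.

(* Main.v *)
Require Import Defs.
From HB Require Import structures.
From mathcomp Require Import all_boot all_order all_algebra.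
From mathcomp Require Import all_classical all_reals all_analysis.
From mathcomp Require Import complex ring lra zify.
Import Order.TTheory GRing.Theory Num.Theory.
Import numFieldNormedType.Exports.
Local Open Scope ring_scope.
Set Implicit Arguments. Unset Strict Implicit. Unset Printing Implicit Defensive.

(** Put p = q^10 and [a] = theta(q^a; p), where theta(x; p) = (x; p)(p/x; p).
With W = I J = q [1][2] / ([3][4]) and V = U^2 = q [1]^2 [3]^2 / ([2]^2 [4]^2),
both identities amount to 1/W - W = 1/V - 1.  This follows from two instances
of Weierstrass' three-term theta relation, which is the Pluecker relation for
f(x,y) = theta(xy) theta(x/y) / x: by the Jacobi triple product f(x,y) is
b1(x) b0(y) - b0(x) b1(y) up to a constant factor.

Letting z tend to 1 in the same relation expresses V as a quotient
(S(q^2) - S(q^4)) / (S(q) - S(q^3)) with S(x) = sum_{m in Z} w(p^m x) and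
w(x) = x/(1-x)^2.  By Lipschitz' formula such a difference is (2 pi i)^-2 times
a difference of Weierstrass p-function values at 10-torsion points, that is an
absolutely convergent sum over the lattice Z + 10 tau Z, on which the action of
SL2(Z) is a change of basis.  This yields the invariance of V under Gamma0(10),
and, through the Lambert expansion of S, its q-expansions at all the cusps. *)

(** * Unconditional sums of complex numbers *)

(** Since I^4 = W^2 V and J^4 = W^2 / V, the two functions are W^2 + W^-2 times V and divided by V,
    and W^2 + W^-2 = (1/W - W)^2 + 2 is a polynomial in 1/V. So both are Laurent polynomials in V,
    and only V has to be understood. Its product form hides the action of SL2(Z). The sum S shows
    it, but the lattice sum of inverse squares behind S converges only conditionally; rearranging it
    would bring in the correction term of the Eisenstein series of weight 2. A difference of two
    values decays like an inverse cube, may be rearranged at will, and acquires a weight factor (c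
    tau + d)^2 that cancels in the quotient. A matrix of Gamma0(10) then acts on the torsion points
    k tau by k -> a k modulo 10, up to sign; a unit a either fixes 1, 2, 3, 4 or exchanges 1 with 3
    and 2 with 4, and in the second case the two sign changes cancel. At a general cusp the lattice
    is put in Hermite form, which makes e(t/10) a local parameter for all cusps at once. *)

Section Modulus.
Variable R : realType.
Local Notation C := R[i].
Implicit Types (x y z : C).

(** The norm of [R[i]] takes its values in [R[i]]; [nm] is the modulus as a real number, so that
    order lemmas and [lra], [nra] apply. [nmE] links the two. *)
Definition nm (x : C) : R := Normc.normc x.

Lemma nmE x : `|x| = ((nm x)%:C)%C. Proof. by []. Qed.
Lemma nm0 : nm 0 = 0. Proof. exact: Normc.normc0. Qed.
Lemma nm1 : nm 1 = 1. Proof. exact: Normc.normc1. Qed.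
Lemma nmM x y : nm (x * y) = nm x * nm y. Proof. exact: Normc.normcM. Qed.
Lemma nmV x : nm x^-1 = (nm x)^-1. Proof. exact: Normc.normcV. Qed.
Lemma nmN x : nm (- x) = nm x. Proof. exact: normcN. Qed.
Lemma nmD x y : nm (x + y) <= nm x + nm y. Proof. exact: le_normcD. Qed.
Lemma nm_ge0 x : 0 <= nm x. Proof. by case: x => a b; exact: sqrtr_ge0. Qed.
Lemma nm_eq0 x : (nm x == 0) = (x == 0).
Proof.
by apply/eqP/eqP => [/Normc.eq0_normc//|->]; rewrite nm0.
Qed.
Lemma nm_gt0 x : (0 < nm x) = (x != 0).
Proof. by rewrite lt_def nm_ge0 andbT nm_eq0. Qed.
Lemma nmB x y : nm (x - y) = nm (y - x).
Proof. by rewrite -nmN opprB. Qed.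
Lemma nm_leD x y : nm (x - y) <= nm x + nm y.
Proof. by rewrite -[in leRHS](nmN y) nmD. Qed.
Lemma nmXn x n : nm (x ^+ n) = nm x ^+ n.
Proof. by elim: n => [|n IH]; rewrite ?expr0 ?nm1// !exprS nmM IH. Qed.
Lemma nmXz x (n : int) : nm (x ^ n) = nm x ^ n.
Proof. by case: n => n /=; rewrite ?nmV nmXn. Qed.
Lemma nm_real (r : R) : nm (r%:C)%C = `|r|.
Proof. by rewrite /nm /= expr0n/= addr0 sqrtr_sqr. Qed.
Lemma nm_nat n : nm n%:R = n%:R.
Proof. by rewrite -(rmorph_nat (real_complex R)) nm_real ger0_norm// ler0n. Qed.
Lemma nm_int (n : int) : nm n%:~R = `|n|%:~R.
Proof. by rewrite -(rmorph_int (real_complex R)) nm_real intr_norm. Qed.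
Lemma nm_dist_tri x y z : nm (x - z) <= nm (x - y) + nm (y - z).
Proof. by rewrite (_ : x - z = (x - y) + (y - z)) ?nmD//; ring. Qed.
Lemma nm_revtri x y : nm x - nm y <= nm (x - y).
Proof. by have := nmD (x - y) y; rewrite subrK lerBlDr. Qed.

Lemma nm_sum (I : Type) (s : seq I) (P : pred I) (f : I -> C) :
  nm (\sum_(i <- s | P i) f i) <= \sum_(i <- s | P i) nm (f i).
Proof.
apply: (big_ind2 (fun a b => nm a <= b)); rewrite ?nm0// => a b c d ab cd.
by rewrite (le_trans (nmD _ _))// lerD.
Qed.

Lemma nm_prod (I : Type) (s : seq I) (P : pred I) (f : I -> C) :
  nm (\prod_(i <- s | P i) f i) = \prod_(i <- s | P i) nm (f i).
Proof.
apply: (big_ind2 (fun a b => nm a = b)); rewrite ?nm1// => a b c d ab cd.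
by rewrite nmM ab cd.
Qed.

Lemma nm_Re x : `|complex.Re x| <= nm x.
Proof.
case: x => a b; rewrite /nm /= -sqrtr_sqr ler_wsqrtr// lerDl sqr_ge0//.
Qed.
Lemma nm_Im x : `|complex.Im x| <= nm x.
Proof.
case: x => a b; rewrite /nm /= -sqrtr_sqr ler_wsqrtr// lerDr sqr_ge0//.
Qed.

Lemma nm_le_eps x : (forall e, 0 < e -> nm x <= e) -> x = 0.
Proof.
move=> h; apply/eqP; rewrite -nm_eq0 eq_le nm_ge0 andbT.
by apply/ler_addgt0Pr => e e0; rewrite add0r h.
Qed.
End Modulus.

(** * Convergence of complex sequences *)

Section Sequences.
Variable R : realType.
Local Notation C := R[i].
Implicit Types (u v : nat -> C).

(** Large inequalities between real numbers keep the estimates elementary; [cvs_cvg] converts to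
    filter convergence where the notions of the statement ask for it. *)
Definition cvs u (l : C) := forall e : R, 0 < e ->
  exists N : nat, forall n, (N <= n)%N -> nm (u n - l) <= e.

Lemma cvs_uniq u l l' : cvs u l -> cvs u l' -> l = l'.
Proof.
move=> h h'; apply/eqP; rewrite -subr_eq0; apply/eqP/nm_le_eps => e e0.
have [N hN] := h (e / 2) ltac:(lra).
have [N' hN'] := h' (e / 2) ltac:(lra).
have A := hN (maxn N N') (leq_maxl _ _).
have B := hN' (maxn N N') (leq_maxr _ _).
have := nm_dist_tri l (u (maxn N N')) l'; rewrite (nmB l (u _)); lra.
Qed.

Lemma cvs_ext u v l : (forall n, u n = v n) -> cvs u l -> cvs v l.
Proof. by move=> h hu e e0; have [N hN] := hu e e0; exists N => n; rewrite -h; exact: hN. Qed.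

Lemma cvs_cst l : cvs (fun=> l) l.
Proof. by move=> e e0; exists 0 => n _; rewrite subrr nm0 ltW. Qed.

Lemma cvs_shift u l k : cvs (fun n => u (n + k)%N) l <-> cvs u l.
Proof.
split=> h e /h[N hN]; last by exists N => n Nn; apply: hN; lia.
exists (N + k)%N => n Nn; rewrite (_ : n = (n - k) + k)%N; last lia.
by apply: hN; lia.
Qed.

Lemma cvsD u v l k : cvs u l -> cvs v k -> cvs (fun n => u n + v n) (l + k).
Proof.
move=> hu hv e e0.
have [N hN] := hu (e / 2) ltac:(lra).
have [N' hN'] := hv (e / 2) ltac:(lra).
exists (maxn N N') => n; rewrite geq_max => /andP[/hN a /hN' b].
rewrite (_ : _ - _ = (u n - l) + (v n - k)); last ring.
have := nmD (u n - l) (v n - k); lra.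
Qed.

Lemma cvs_bounded u l : cvs u l -> exists M, 0 < M /\ forall n, nm (u n) <= M.
Proof.
move=> /(_ 1 ltr01)[N hN].
exists (\sum_(i < N) nm (u i) + nm l + 1); split.
  by rewrite ltr_wpDl// addr_ge0 ?nm_ge0 ?sumr_ge0// => *; rewrite nm_ge0.
move=> n; have s0 : 0 <= \sum_(i < N) nm (u i) by rewrite sumr_ge0// => *; rewrite nm_ge0.
have [nN|Nn] := ltnP n N.
  have : nm (u n) <= \sum_(i < N) nm (u i).
    by rewrite (bigD1 (Ordinal nN))//= lerDl sumr_ge0// => *; rewrite nm_ge0.
  have := nm_ge0 l; lra.
have := hN n Nn; have := nm_dist_tri (u n) l 0; rewrite !subr0; lra.
Qed.

Lemma cvsM u v l k : cvs u l -> cvs v k -> cvs (fun n => u n * v n) (l * k).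
Proof.
move=> hu hv e e0; have [M [M0 hM]] := cvs_bounded hu.
have k0 := nm_ge0 k.
have d0 : 0 < e / (2 * (nm k + 1)) by rewrite divr_gt0// mulr_gt0//; lra.
have d'0 : 0 < e / (2 * M) by rewrite divr_gt0// mulr_gt0//; lra.
have [N hN] := hu _ d0.
have [N' hN'] := hv _ d'0.
exists (maxn N N') => n; rewrite geq_max => /andP[/hN a /hN' b].
rewrite (_ : _ - _ = u n * (v n - k) + (u n - l) * k); last ring.
rewrite (le_trans (nmD _ _))// !nmM.
have A : nm (u n) * nm (v n - k) <= M * (e / (2 * M)).
  by rewrite ler_pM ?nm_ge0.
have B : nm (u n - l) * nm k <= e / (2 * (nm k + 1)) * (nm k + 1).
  by rewrite ler_pM ?nm_ge0//; lra.
have -> : e = M * (e / (2 * M)) + e / (2 * (nm k + 1)) * (nm k + 1).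
  by field; rewrite !gt_eqF//; lra.
lra.
Qed.

Lemma cvsZ (a : C) u l : cvs u l -> cvs (fun n => a * u n) (a * l).
Proof. exact/cvsM/cvs_cst. Qed.

Lemma cvsN u l : cvs u l -> cvs (fun n => - u n) (- l).
Proof. by move=> h e /h[N hN]; exists N => n /hN; rewrite -opprD nmN. Qed.

Lemma cvsB u v l k : cvs u l -> cvs v k -> cvs (fun n => u n - v n) (l - k).
Proof. by move=> hu hv; apply: cvsD => //; exact: cvsN. Qed.

Lemma cvsV u l : l != 0 -> cvs u l -> cvs (fun n => (u n)^-1) l^-1.
Proof.
move=> l0 hu e e0; have L0 : 0 < nm l by rewrite nm_gt0.
have [N hN] := hu (nm l / 2) ltac:(lra).
have d0 : 0 < e * (nm l * nm l / 2) by rewrite mulr_gt0// divr_gt0// mulr_gt0.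
have [N' hN'] := hu _ d0.
exists (maxn N N') => n; rewrite geq_max => /andP[/hN a /hN' b].
have U0 : nm l / 2 <= nm (u n).
  by have := nm_revtri l (u n); rewrite nmB; lra.
have un0 : u n != 0 by rewrite -nm_gt0; lra.
rewrite (_ : _ - _ = (l - u n) * (l^-1 * (u n)^-1)); last first.
  by field; rewrite un0 l0.
rewrite !nmM nmB !nmV.
rewrite (le_trans (ler_wpM2r _ b))//.
  by rewrite mulr_ge0// invr_ge0// nm_ge0.
have -> : e * (nm l * nm l / 2) * ((nm l)^-1 / nm (u n)) = e * ((nm l / 2) / nm (u n)).
  by field; rewrite !gt_eqF//; lra.
by apply: ler_piMr; [exact: ltW|rewrite ler_pdivrMr ?mul1r//; lra].
Qed.

Lemma cvs_sum (I : Type) (s : seq I) (F : nat -> I -> C) (G : I -> C) :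
  (forall i, cvs (F^~ i) (G i)) ->
  cvs (fun n => \sum_(i <- s) F n i) (\sum_(i <- s) G i).
Proof.
move=> h; elim: s => [|a s IH].
  by rewrite big_nil; apply: cvs_ext (cvs_cst _) => n; rewrite big_nil.
by rewrite big_cons; apply: cvs_ext (cvsD (h a) IH) => n; rewrite big_cons.
Qed.

Lemma cvs_nm_ge u l (d : R) : (forall n, d <= nm (u n)) -> cvs u l -> d <= nm l.
Proof.
move=> h hu; apply/ler_addgt0Pr => e e0; have [N hN] := hu e e0.
have := hN N (leqnn _); have := h N; have := nm_revtri (u N) l; lra.
Qed.

Lemma cvs_nm_le u l (d : R) : (forall n, nm (u n) <= d) -> cvs u l -> nm l <= d.
Proof.
move=> h hu; apply/ler_addgt0Pr => e e0; have [N hN] := hu e e0.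
have := hN N (leqnn _); have := h N; have := nm_revtri l (u N); rewrite nmB; lra.
Qed.

Lemma cvs0_squeeze u (b : nat -> R) :
  (forall e, 0 < e -> exists N, forall n, (N <= n)%N -> b n <= e) ->
  (forall n, nm (u n) <= b n) -> cvs u 0.
Proof.
move=> hb hu e /hb[N hN]; exists N => n /hN; rewrite subr0; exact: le_trans.
Qed.

Lemma geom_small (r e : R) : 0 <= r < 1 -> 0 < e ->
  exists N, forall n, (N <= n)%N -> r ^+ n <= e.
Proof.
move=> /andP[r0 r1] e0.
have [->|rn0] := eqVneq r 0.
  by exists 1%N => -[//|n] _; rewrite expr0n ltW.
have rp : 0 < r by rewrite lt_def rn0.
pose a := r^-1 - 1.
have a0 : 0 < a by rewrite subr_gt0 invf_gt1.
(* Bernoulli's inequality for 1/r = 1 + a. *)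
have B n : 1 + n%:R * a <= (r^-1) ^+ n.
  elim: n => [|n IH]; first by rewrite mul0r addr0 expr0.
  have -> : r^-1 = 1 + a by rewrite /a; ring.
  rewrite exprS -[in leLHS]natr1.
  have -> : 1 + a = r^-1 by rewrite /a; ring.
  apply: le_trans (_ : r^-1 * (1 + n%:R * a) <= _); last first.
    by rewrite ler_pM2l// invr_gt0.
  have -> : r^-1 = 1 + a by rewrite /a; ring.
  have : 0 <= n%:R * a * a by rewrite !mulr_ge0// ltW.
  lra.
exists (Num.bound (e^-1 / a)) => n hn.
have ea : e^-1 / a < n%:R.
  apply: lt_le_trans (_ : (Num.bound (e^-1 / a))%:R <= _); last by rewrite ler_nat.
  by rewrite archi_boundP// ltW// divr_gt0// invr_gt0.
rewrite -[r]invrK exprVn -[leRHS]invrK lef_pV2 ?posrE ?invr_gt0//; last first.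
  by rewrite exprn_gt0// invr_gt0.
apply: le_trans (B n); move: ea; rewrite ltr_pdivrMr//; lra.
Qed.

Lemma inv_nat_small (e : R) : 0 < e ->
  exists N : nat, forall n, (N <= n)%N -> n.+1%:R^-1 <= e.
Proof.
move=> e0; exists (Num.bound e^-1) => n hn.
have h : e^-1 < n.+1%:R.
  apply: (@lt_le_trans _ _ (Num.bound e^-1)%:R); last by rewrite ler_nat; lia.
  by rewrite archi_boundP// ltW// invr_gt0.
by rewrite -[leRHS]invrK lef_pV2 ?posrE ?invr_gt0 ?ltr0n// ltW.
Qed.

Lemma cvs_geom (a : C) : nm a < 1 -> cvs (fun n => a ^+ n) 0.
Proof.
move=> a1; apply: (@cvs0_squeeze _ (fun n => nm a ^+ n)); last by move=> n; rewrite nmXn.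
by move=> e e0; apply: geom_small => //; rewrite nm_ge0.
Qed.
End Sequences.

Section Sums.
Variable R : realType.
Local Notation C := R[i].

(* Unconditional summation: the net of sums over finite subsets of [I],
   represented by duplicate-free lists. *)
Definition has_sum (I : eqType) (f : I -> C) (l : C) := forall e : R, 0 < e ->
  exists A : seq I, forall B, uniq B -> {subset A <= B} ->
    nm (\sum_(i <- B) f i - l) <= e.

Definition summ (I : eqType) (b : I -> R) :=
  exists M, forall B : seq I, uniq B -> \sum_(i <- B) b i <= M.

Section Basic.
Variable I : eqType.
Implicit Types (f g : I -> C) (b : I -> R).

Lemma has_sum_uniq f l l' : has_sum f l -> has_sum f l' -> l = l'.
Proof.
move=> h h'; apply/eqP; rewrite -subr_eq0; apply/eqP/nm_le_eps => e e0.
have [A hA] := h (e / 2) ltac:(lra).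
have [A' hA'] := h' (e / 2) ltac:(lra).
pose B := undup (A ++ A').
have a := hA B (undup_uniq _) ltac:(by move=> x xA; rewrite mem_undup mem_cat xA).
have a' := hA' B (undup_uniq _) ltac:(by move=> x xA; rewrite mem_undup mem_cat xA orbT).
have := nm_dist_tri l (\sum_(i <- B) f i) l'; rewrite (nmB l (\sum_(_ <- _) _)); lra.
Qed.

Lemma has_sum_ext f g l : (forall i, f i = g i) -> has_sum f l -> has_sum g l.
Proof. by move=> /funext ->. Qed.

Lemma has_sumD f g l k : has_sum f l -> has_sum g k -> has_sum (fun i => f i + g i) (l + k).
Proof.
move=> h h' e e0.
have [A hA] := h (e / 2) ltac:(lra).
have [A' hA'] := h' (e / 2) ltac:(lra).
exists (A ++ A') => B uB sB.
have a := hA B uB ltac:(by move=> x xA; rewrite sB// mem_cat xA).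
have a' := hA' B uB ltac:(by move=> x xA; rewrite sB// mem_cat xA orbT).
rewrite big_split/= [X in nm X](_ : _ = (\sum_(i <- B) f i - l) + (\sum_(i <- B) g i - k)).
  by rewrite (le_trans (nmD _ _))//; lra.
by ring.
Qed.

Lemma has_sumZ (a : C) f l : has_sum f l -> has_sum (fun i => a * f i) (a * l).
Proof.
move=> h e e0.
have d0 : 0 < e / (nm a + 1) by rewrite divr_gt0//; have := nm_ge0 a; lra.
have [A hA] := h _ d0; exists A => B uB sB.
rewrite -mulr_sumr -mulrBr nmM.
rewrite (le_trans (ler_wpM2l (nm_ge0 _) (hA B uB sB)))//.
have := nm_ge0 a => a0.
rewrite mulrCA ler_piMr ?ltW// ltr_pdivrMr; lra.
Qed.

Lemma has_sumN f l : has_sum f l -> has_sum (fun i => - f i) (- l).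
Proof. by move=> /(has_sumZ (-1)); rewrite mulN1r; apply: has_sum_ext => i; rewrite mulN1r. Qed.

Lemma has_sumB f g l k : has_sum f l -> has_sum g k -> has_sum (fun i => f i - g i) (l - k).
Proof. by move=> h /has_sumN; exact: has_sumD. Qed.

Lemma sum_sub_seq (V : nmodType) (F : I -> V) (A B : seq I) : uniq A -> uniq B ->
  {subset A <= B} -> \sum_(i <- B | i \in A) F i = \sum_(i <- A) F i.
Proof.
move=> uA uB sAB; rewrite -big_filter; apply: perm_big.
apply: uniq_perm; rewrite ?filter_uniq// => i.
by rewrite mem_filter; case: (boolP (i \in A)) => //= /sAB.
Qed.

Lemma has_sum_finite f (A : seq I) : uniq A -> (forall i, i \notin A -> f i = 0) ->
  has_sum f (\sum_(i <- A) f i).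
Proof.
move=> uA h e e0; exists A => B uB sB.
rewrite (bigID (mem A)) /= sum_sub_seq// [X in _ + X - _]big1// addr0 subrr nm0 ltW//.
Qed.

Lemma has_sum0 : has_sum (fun _ : I => 0) 0.
Proof. by have := @has_sum_finite (fun=> 0) [::] erefl; rewrite big_nil; apply. Qed.

Lemma summ_le b b' : (forall i, b i <= b' i) -> summ b' -> summ b.
Proof.
by move=> h [M hM]; exists M => B /hM; apply: le_trans; apply: ler_sum.
Qed.

Lemma summD b b' : summ b -> summ b' -> summ (fun i => b i + b' i).
Proof.
by move=> [M h] [M' h']; exists (M + M') => B uB; rewrite big_split lerD ?h ?h'.
Qed.

Lemma summZ (a : R) b : 0 <= a -> summ b -> summ (fun i => a * b i).
Proof.
by move=> a0 [M h]; exists (a * M) => B uB; rewrite -mulr_sumr ler_wpM2l ?h.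
Qed.

(** A finite sum within e of the supremum of all finite sums leaves at most e to any disjoint finite
    set. *)
Lemma summ_tail b : (forall i, 0 <= b i) -> summ b -> forall e, 0 < e ->
  exists A : seq I, uniq A /\ forall B, uniq B -> (forall i, i \in B -> i \notin A) ->
   \sum_(i <- B) b i <= e.
Proof.
move=> b0 [M hM] e e0.
pose E : set R := [set \sum_(i <- B) b i | B in [set B : seq I | uniq B]]%classic.
have hE : has_sup E.
  split; first by exists 0; exists [::] => //; rewrite big_nil.
  by exists M => _ [B uB <-]; exact: hM.
have [_ [A /= uA <-] hA] := sup_adherent e0 hE.
exists A; split=> // B uB dB.
have uAB : uniq (A ++ B).
  rewrite cat_uniq uA uB andbT; apply/hasPn => i iB; exact: dB.
have : \sum_(i <- A ++ B) b i <= sup E by apply: (sup_upper_bound hE); exists (A ++ B).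
rewrite big_cat/=; lra.
Qed.

Lemma has_sum_tail f b l (A : seq I) e : (forall i, nm (f i) <= b i) -> has_sum f l ->
  uniq A -> (forall B, uniq B -> (forall i, i \in B -> i \notin A) ->
   \sum_(i <- B) b i <= e) -> nm (\sum_(i <- A) f i - l) <= e.
Proof.
move=> hb hf uA hA; apply/ler_addgt0Pr => d d0; have [A' hA'] := hf d d0.
pose D := [seq i <- undup A' | i \notin A].
have uD : uniq D by rewrite filter_uniq// undup_uniq.
have dD i : i \in D -> i \notin A by rewrite mem_filter => /andP[].
have uAD : uniq (A ++ D).
  by rewrite cat_uniq uA uD andbT; apply/hasPn => i iB; exact: dD.
have /(hA' _ uAD) : {subset A' <= A ++ D}.
  by move=> i iA; rewrite mem_cat mem_filter mem_undup iA andbT orbN.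
rewrite big_cat/= => h1.
have h2 : nm (\sum_(i <- D) f i) <= e.
  rewrite (le_trans (nm_sum _ _ _))// (le_trans _ (hA D uD dD))//.
  by apply: ler_sum.
rewrite (_ : _ - _ = (\sum_(i <- A) f i + \sum_(i <- D) f i - l) - \sum_(i <- D) f i); last ring.
by rewrite (le_trans (nm_leD _ _))//; lra.
Qed.

Lemma has_sum_nm_le f l M : (forall B, uniq B -> \sum_(i <- B) nm (f i) <= M) ->
  has_sum f l -> nm l <= M.
Proof.
move=> hM hf; have := @has_sum_tail f (fun i => nm (f i)) l [::] M (fun=> lexx _) hf erefl.
by rewrite big_nil sub0r nmN; apply => B uB _; exact: hM.
Qed.

Lemma summ_has_sum_nonneg b : (forall i, 0 <= b i) -> summ b ->
  exists l : R, has_sum (fun i => (b i)%:C%C) (l%:C)%C.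
Proof.
move=> b0 [M hM].
pose E : set R := [set \sum_(i <- B) b i | B in [set B : seq I | uniq B]]%classic.
have hE : has_sup E.
  split; first by exists 0; exists [::] => //; rewrite big_nil.
  by exists M => _ [B uB <-]; exact: hM.
exists (sup E) => e e0.
have [_ [A /= uA <-] hA] := sup_adherent e0 hE.
exists A => B uB sB; rewrite -rmorph_sum -rmorphB nm_real.
have h1 : \sum_(i <- B) b i <= sup E by apply: (sup_upper_bound hE); exists B.
have h2 : \sum_(i <- A) b i <= \sum_(i <- B) b i.
  rewrite [leRHS](bigID (mem A)) /= sum_sub_seq// lerDl sumr_ge0//.
rewrite ler_norml; apply/andP; split; lra.
Qed.

Lemma summ_has_sum f : summ (fun i => nm (f i)) -> exists l, has_sum f l.
Proof.
move=> hf.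
have key (g : C -> R) : (forall z, `|g z| <= nm z) ->
    exists l, has_sum (fun i => (g (f i))%:C%C) l.
  move=> hg.
  have p1 (h : I -> R) : (forall i, h i <= nm (f i)) ->
      exists l : R, has_sum (fun i => (Num.max 0 (h i))%:C%C) (l%:C)%C.
    move=> hh; apply: summ_has_sum_nonneg; first by move=> i; rewrite le_max lexx.
    by apply: summ_le hf => i; rewrite ge_max nm_ge0 hh.
  have [|l1 h1] := p1 (fun i => g (f i)).
    by move=> i; rewrite (le_trans _ (hg _))// ler_norm.
  have [|l2 h2] := p1 (fun i => - g (f i)).
    by move=> i; rewrite (le_trans _ (hg _))// -normrN ler_norm.
  eexists; apply: has_sum_ext (has_sumB h1 h2) => i; rewrite -rmorphB; congr (_%:C)%C.
  by case: (leP 0 (g (f i))) => a; case: (leP 0 (- g (f i))) => b; lra.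
have [l1 h1] := key _ (@nm_Re R).
have [l2 h2] := key _ (@nm_Im R).
eexists; apply: has_sum_ext (has_sumD h1 (has_sumZ 'i%C h2)) => i.
by rewrite [RHS]complexE.
Qed.

(** Dominated convergence for series: outside a finite set the majorant bounds every sum by e/3
    uniformly in n, and on that set termwise convergence suffices. Both interchanges of limit and
    series, in the triple product and in Lipschitz' formula, go through it. *)
Lemma tannery (F : nat -> I -> C) G (s : nat -> C) b l :
  (forall i, 0 <= b i) -> summ b -> (forall n i, nm (F n i) <= b i) ->
  (forall i, cvs (F^~ i) (G i)) -> (forall n, has_sum (F n) (s n)) -> has_sum G l -> cvs s l.
Proof.
move=> b0 hb hF hG hs hl e e0.
have [A [uA hA]] := summ_tail b0 hb (e := e / 3) ltac:(lra).
have hGb i : nm (G i) <= b i by apply: cvs_nm_le (hG i) => n; exact: hF.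
have [N hN] := cvs_sum A hG (e := e / 3) ltac:(lra).
exists N => n /hN h1.
have h2 := has_sum_tail (hF n) (hs n) uA hA.
have h3 := has_sum_tail hGb hl uA hA.
have h4 := nm_dist_tri (s n) (\sum_(i <- A) F n i) l.
have h5 := nm_dist_tri (\sum_(i <- A) F n i) (\sum_(i <- A) G i) l.
move: h4; rewrite (nmB (s n) (\sum_(_ <- _) _)); lra.
Qed.
End Basic.

Section Reindex.
Variables I J : eqType.

Lemma has_sum_bij (h : J -> I) (g : I -> J) (f : I -> C) l :
  cancel h g -> cancel g h -> has_sum f l -> has_sum (f \o h) l.
Proof.
move=> hg gh hf e /hf[A hA]; exists (map g A) => B uB sB.
have := hA (map h B); rewrite big_map; apply.
  by rewrite map_inj_uniq//; exact: can_inj hg.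
by move=> i iA; apply/mapP; exists (g i); rewrite ?gh// sB// map_f.
Qed.

Lemma summ_inj (h : J -> I) (b : I -> R) : injective h -> summ b -> summ (b \o h).
Proof.
move=> hi [M hM]; exists M => B uB; have := hM (map h B).
by rewrite big_map; apply; rewrite map_inj_uniq.
Qed.

Lemma has_sum_zero_ext (h : J -> I) (f : I -> C) l : injective h ->
  (forall i, (forall j, i <> h j) -> f i = 0) -> has_sum (f \o h) l -> has_sum f l.
Proof.
move=> hi h0 hf e /hf[A hA]; exists (map h A) => B uB sB.
(* A partial inverse of [h], chosen classically; where it is undefined, [f] vanishes. *)
have /choice[p hp] : forall i, exists o, if o is Some j then i = h j else f i = 0.
  move=> i; have [[j ij]|n] := pselect (exists j, i = h j); first by exists (Some j).
  by exists None; apply: h0 => j ij; apply: n; exists j.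
pose D := [seq j <- undup (pmap p B) | h j \in B].
have uD : uniq D by rewrite filter_uniq// undup_uniq.
have ph j : h j \in B -> f (h j) <> 0 -> j \in D.
  move=> hjB fj; rewrite mem_filter hjB mem_undup mem_pmap /=; apply/mapP.
  by exists (h j) => //; have := hp (h j); case: (p (h j)) => [k /hi ->|].
have E : \sum_(i <- B) f i = \sum_(i <- map h (undup (A ++ D))) f i.
  rewrite (bigID (mem (map h (undup (A ++ D))))) /= sum_sub_seq//.
  - rewrite [X in _ + X]big1_seq ?addr0// => i /andP[iD iB].
    apply/eqP; apply: contraNT iD => /eqP fi.
    have := hp i; case: (p i) => // j ij; rewrite ij map_f// mem_undup mem_cat.
    by rewrite ph ?orbT// -ij.
  - by rewrite map_inj_uniq// undup_uniq.
  - move=> _ /mapP[j jD ->]; move: jD; rewrite mem_undup mem_cat => /orP[jA|].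
      by rewrite sB// map_f.
    by rewrite mem_filter => /andP[].
rewrite E big_map; apply: hA; first exact: undup_uniq.
by move=> j jA; rewrite mem_undup mem_cat jA.
Qed.

(** Summation by blocks: for finitely many blocks, one finite index set is taken so large that it
    approximates the total and each block sum at once. *)
Lemma has_sum_fiber (pi : I -> J) (f : I -> C) (g : J -> C) l :
  has_sum f l -> (forall k, has_sum (fun i => if pi i == k then f i else 0) (g k)) -> has_sum g l.
Proof.
move=> hf hg e e0; have [A hA] := hf (e / 2) ltac:(lra).
exists (map pi A) => B uB sB.
(* The tolerance is shared among the blocks in [B]; the successor covers an empty [B]. *)
pose d := e / 2 / (size B).+1%:R.
have d0 : 0 < d by rewrite !divr_gt0.
have [c hc] := choice (fun k => hg k d d0).
pose B0 := undup (A ++ flatten (map c B)).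
have cB k : k \in B -> nm (\sum_(i <- B0) (if pi i == k then f i else 0) - g k) <= d.
  move=> kB; apply: hc; first exact: undup_uniq.
  move=> i ic; rewrite mem_undup mem_cat; apply/orP; right.
  by apply/flattenP; exists (c k) => //; rewrite map_f.
have E : \sum_(i <- [seq i <- B0 | pi i \in B]) f i =
    \sum_(k <- B) \sum_(i <- B0) (if pi i == k then f i else 0).
  rewrite exchange_big big_filter big_mkcond; apply: eq_bigr => i _.
  case: ifPn => [piB|npiB].
    rewrite (bigD1_seq (pi i))//= eqxx big1 ?addr0// => k.
    by rewrite eq_sym => /negPf ->.
  by rewrite big1_seq// => k /= kB; case: eqP => // ik; rewrite ik kB in npiB.
have h1 := hA [seq i <- B0 | pi i \in B] ltac:(by rewrite filter_uniq// undup_uniq).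
have {}h1 : nm (\sum_(i <- [seq i <- B0 | pi i \in B]) f i - l) <= e / 2.
  apply: h1 => i iA; rewrite mem_filter mem_undup mem_cat iA andbT.
  by rewrite sB// map_f.
apply: le_trans (nm_dist_tri _ (\sum_(i <- [seq i <- B0 | pi i \in B]) f i) _) _.
have -> : e = e / 2 + e / 2 by lra.
apply: lerD => //; rewrite E -sumrB.
apply: le_trans (nm_sum _ _ _) _.
apply: (@le_trans _ _ (\sum_(k <- B) d)).
  by rewrite big_seq [leRHS]big_seq; apply: ler_sum => k kB; rewrite nmB cB.
rewrite big_const_seq count_predT iter_addr_0 -[d *+ _]mulr_natr /d -mulrA ler_piMr//.
  by lra.
by rewrite mulrC ler_pdivrMr// mul1r ler_nat.
Qed.

Lemma summ_prod (a : I -> R) (b : J -> R) : (forall i, 0 <= a i) ->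
  (forall j, 0 <= b j) -> summ a -> summ b -> summ (fun x : I * J => a x.1 * b x.2).
Proof.
move=> a0 b0 [M hM] [K hK]; exists (M * K) => B uB.
pose X := undup (map fst B); pose Y := undup (map snd B).
apply: (@le_trans _ _ (\sum_(x <- [seq (i, j) | i <- X, j <- Y]) a x.1 * b x.2)).
  rewrite [leRHS](bigID (mem B)) /= sum_sub_seq//.
  - by rewrite lerDl sumr_ge0// => x _; rewrite mulr_ge0.
  - by rewrite allpairs_uniq ?undup_uniq// => -[? ?] [? ?].
  - move=> [i j] ijB; apply/allpairsP; exists (i, j); rewrite !mem_undup /=; split=> //.
    - by apply/mapP; exists (i, j).
    - by apply/mapP; exists (i, j).
rewrite big_allpairs_dep /=.
rewrite (eq_bigr (fun i => a i * \sum_(j <- Y) b j)); last first.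
  by move=> i _; rewrite mulr_sumr.
rewrite -mulr_suml ler_pM ?sumr_ge0// ?hM ?hK ?undup_uniq//.
Qed.

Lemma has_sum_rows (f : I * J -> C) (g : I -> C) l : has_sum f l ->
  (forall i, has_sum (fun j => f (i, j)) (g i)) -> has_sum g l.
Proof.
move=> hf hg e e0; have [A hA] := hf (e / 2) ltac:(lra).
exists (map fst A) => B uB sB.
pose d := e / 2 / (size B).+1%:R.
have d0 : 0 < d by rewrite !divr_gt0.
have [c hc] := choice (fun k => hg k d d0).
pose Y := undup (map snd A ++ flatten (map c B)).
have cB k : k \in B -> nm (\sum_(j <- Y) f (k, j) - g k) <= d.
  move=> kB; apply: hc; first exact: undup_uniq.
  move=> i ic; rewrite mem_undup mem_cat; apply/orP; right.
  by apply/flattenP; exists (c k) => //; rewrite map_f.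
have h1 : nm (\sum_(x <- [seq (i, j) | i <- B, j <- Y]) f x - l) <= e / 2.
  apply: hA.
    by rewrite allpairs_uniq ?undup_uniq// => -[? ?] [? ?].
  move=> [i j] ijA; apply/allpairsP; exists (i, j); split=> //=.
    by apply: sB; apply/mapP; exists (i, j).
  by rewrite mem_undup mem_cat; apply/orP; left; apply/mapP; exists (i, j).
apply: le_trans (nm_dist_tri _ (\sum_(x <- [seq (i, j) | i <- B, j <- Y]) f x) _) _.
have -> : e = e / 2 + e / 2 by lra.
apply: lerD => //; rewrite big_allpairs_dep -sumrB.
apply: le_trans (nm_sum _ _ _) _.
apply: (@le_trans _ _ (\sum_(k <- B) d)).
  by rewrite big_seq [leRHS]big_seq; apply: ler_sum => k kB; rewrite nmB cB.
rewrite big_const_seq count_predT iter_addr_0 -[d *+ _]mulr_natr /d -mulrA ler_piMr//.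
  by lra.
by rewrite mulrC ler_pdivrMr// mul1r ler_nat.
Qed.

(** Absolute summability provides some sum t of the product family, and summing by rows identifies
    t. *)
Lemma has_sum_mul (f : I -> C) (g : J -> C) l k :
  summ (fun i => nm (f i)) -> summ (fun j => nm (g j)) ->
  has_sum f l -> has_sum g k -> has_sum (fun x : I * J => f x.1 * g x.2) (l * k).
Proof.
move=> sf sg hf hg.
have [|t ht] := @summ_has_sum _ (fun x : I * J => f x.1 * g x.2).
  apply: summ_le (summ_prod _ _ sf sg) => [x| |]; rewrite ?nmM// => *; exact: nm_ge0.
suff -> : l * k = t by [].
have := has_sum_rows ht (fun i => has_sumZ (f i) hg).
rewrite mulrC; apply: has_sum_uniq; apply: has_sum_ext (has_sumZ k hf) => i; exact: mulrC.
Qed.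
End Reindex.
End Sums.

(** * Geometric and power majorants over N and Z *)

Section ConcreteSums.
Variable R : realType.
Local Notation C := R[i].

Lemma summ_nat (b : nat -> R) M : (forall n, 0 <= b n) ->
  (forall N, \sum_(i < N) b i <= M) -> summ b.
Proof.
move=> b0 hM; exists M => B uB; pose N := (\max_(i <- B) i).+1.
apply: le_trans (hM N); rewrite -(big_mkord predT).
rewrite [leRHS](bigID (mem B)) /= sum_sub_seq ?iota_uniq//.
  by rewrite lerDl sumr_ge0.
by move=> i iB; rewrite mem_index_iota /= ltnS leq_bigmax_seq.
Qed.

Lemma summ_nat_telescope (b c : nat -> R) : (forall n, 0 <= b n) ->
  (forall n, 0 <= c n) -> (forall n, b n <= c n - c n.+1) -> summ b.
Proof.
move=> b0 c0 h; apply: (@summ_nat _ (c 0)) => // N.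
suff : \sum_(i < N) b i <= c 0 - c N by have := c0 N; lra.
elim: N => [|N IH]; first by rewrite big_ord0 subrr.
by rewrite big_ord_recr/=; have := h N; lra.
Qed.

Lemma has_sum_nat_cvs (f : nat -> C) l : has_sum f l -> cvs (fun N => \sum_(i < N) f i) l.
Proof.
move=> hf e /hf[A hA]; exists (\max_(i <- A) i).+1 => n hn.
rewrite -(big_mkord predT); apply: hA; first exact: iota_uniq.
move=> i iA; rewrite mem_index_iota /=; apply: leq_trans hn.
by rewrite ltnS leq_bigmax_seq.
Qed.

Lemma has_sum_nat_behead (f : nat -> C) l : has_sum f l -> has_sum (f \o S) (l - f 0%N).
Proof.
move=> hf e /hf[A hA]; exists (map predn A) => B uB sB.
have := hA (0%N :: map S B); rewrite big_cons big_map opprB addrA [X in nm (X - l)]addrC.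
rewrite -addrA (addrC (f 0%N)) addrA; apply.
  rewrite /= map_inj_uniq ?uB ?andbT; last exact: succn_inj.
  by apply/mapP => -[].
move=> [|i] iA; rewrite inE //=; apply/mapP; exists i => //; apply: sB.
by apply/mapP; exists i.+1.
Qed.

Lemma summ_geom (r : R) : 0 <= r < 1 -> summ (fun n => r ^+ n).
Proof.
move=> /andP[r0 r1].
apply: (@summ_nat_telescope _ (fun n => r ^+ n / (1 - r))) => n; first exact: exprn_ge0.
  by rewrite divr_ge0 ?exprn_ge0//; lra.
rewrite exprS -mulrBl -[X in X - _]mul1r -mulrBl mulrAC divff ?mul1r//.
by rewrite gt_eqF//; lra.
Qed.

Lemma summ_ngeom (r : R) : 0 <= r < 1 -> summ (fun n => n.+1%:R * r ^+ n).
Proof.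
move=> /andP[r0 r1].
have rn0 n := exprn_ge0 n r0.
apply: (@summ_nat _ ((1 - r) ^- 2)) => [n|N]; first by rewrite mulr_ge0.
rewrite -[leRHS]mul1r ler_pdivlMr ?exprn_gt0//; last lra.
(* Closed form of the partial sums; its last two terms add up to at most 0, which leaves the bound
   1. *)
suff -> : (\sum_(i < N) i.+1%:R * r ^+ i) * (1 - r) ^+ 2 =
    1 - N.+1%:R * r ^+ N + N%:R * r ^+ N.+1.
  have : r ^+ N.+1 <= r ^+ N by rewrite exprS ler_piMl// ltW.
  move=> h; have : N%:R * r ^+ N.+1 <= N.+1%:R * r ^+ N by rewrite ler_pM// ler_nat.
  lra.
elim: N => [|N IH]; first by rewrite big_ord0; ring.
by rewrite big_ord_recr/= mulrDl IH !exprS -[N.+2%:R]natr1 -[N.+1%:R]natr1; ring.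
Qed.

Lemma has_sum_geom (a : C) : nm a < 1 -> has_sum (fun n => a ^+ n) (1 - a)^-1.
Proof.
move=> a1.
have a0 : 1 - a != 0.
  by apply/eqP => /subr0_eq a1'; rewrite -a1' nm1 ltxx in a1.
have [|l hl] := @summ_has_sum _ _ (fun n => a ^+ n).
  by apply: summ_le (@summ_geom (nm a) _) => [n|]; rewrite ?nmXn// nm_ge0.
have h : l - a ^+ 0 = a * l.
  apply: has_sum_uniq (has_sum_nat_behead hl) _.
  by apply: has_sum_ext (has_sumZ a hl) => n; rewrite /= exprS.
suff <- : l = (1 - a)^-1 by [].
apply: (mulIf a0); rewrite mulVf// mulrBr mulr1 (mulrC l) -h expr0; ring.
Qed.

Lemma summ_ngeomC (a : C) : nm a < 1 -> summ (fun n => nm (n.+1%:R * a ^+ n)).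
Proof.
move=> a1; apply: summ_le (@summ_ngeom (nm a) _); rewrite ?nm_ge0// => n.
by rewrite nmM nm_nat nmXn.
Qed.

Lemma has_sum_ngeom (a : C) : nm a < 1 -> has_sum (fun n => n.+1%:R * a ^+ n) ((1 - a) ^- 2).
Proof.
move=> a1.
have a0 : 1 - a != 0.
  by apply/eqP => /subr0_eq a1'; rewrite -a1' nm1 ltxx in a1.
have [l hl] := summ_has_sum (summ_ngeomC a1).
(* Dropping the first term shifts the series, and (n+2) a^(n+1) is a times (n+1) a^n plus a
   geometric term; the resulting linear equation determines [l]. *)
have h : l - 1%:R * a ^+ 0 = a * l + ((1 - a)^-1 - a ^+ 0).
  apply: has_sum_uniq (has_sum_nat_behead hl) _.
  apply: has_sum_ext (has_sumD (has_sumZ a hl) (has_sum_nat_behead (has_sum_geom a1))) => n /=.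
  by rewrite exprS -[n.+2%:R]natr1; ring.
suff <- : l = (1 - a) ^- 2 by [].
have -> : l = (l - a * l) / (1 - a) by field.
have -> : l - a * l = (1 - a)^-1.
  have -> : l - a * l = (l - 1%:R * a ^+ 0) - a * l + 1 by rewrite expr0; ring.
  by rewrite h expr0; ring.
by field.
Qed.

Lemma summ_int (b : int -> R) : (forall n, 0 <= b n) ->
  summ (fun n : nat => b n) -> summ (fun n => b (Negz n)) -> summ b.
Proof.
move=> b0 [M hM] [K hK]; exists (M + K) => B uB.
rewrite (bigID (fun i : int => 0 <= i)) /=; apply: lerD.
  pose D := [seq absz i | i <- B & 0 <= i].
  have -> : \sum_(i <- B | 0 <= i) b i = \sum_(n <- D) b n%:Z.
    rewrite big_map big_filter [RHS]big_mkcond /= big_mkcond /=.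
    by apply: eq_bigr => i _; case: ifP => // i0; congr (b _); lia.
  apply: hM; rewrite map_inj_in_uniq ?filter_uniq// => i j.
  by rewrite !mem_filter => /andP[i0 _] /andP[j0 _]; lia.
pose D := [seq (absz i).-1 | i <- B & ~~ (0 <= i)].
have -> : \sum_(i <- B | ~~ (0 <= i)) b i = \sum_(n <- D) b (Negz n).
  rewrite big_map big_filter [RHS]big_mkcond /= big_mkcond /=.
  apply: eq_bigr => i _; case: ifP => // i0; congr (b _); lia.
apply: hK; rewrite map_inj_in_uniq ?filter_uniq// => i j.
by rewrite !mem_filter => /andP[i0 _] /andP[j0 _]; lia.
Qed.

Lemma has_sum_int_nat (f : int -> C) l : has_sum f l -> has_sum (fun n : nat => f n + f (Negz n)) l.
Proof.
pose pi (i : int) := match i with Posz n => n | Negz n => n end.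
move=> hf; apply: (has_sum_fiber (pi := pi) hf) => k.
have := @has_sum_finite R int (fun i => if pi i == k then f i else 0) [:: Posz k; Negz k] erefl.
rewrite !big_cons big_nil /= !eqxx addr0; apply => -[] n /=.
  by rewrite !inE => h; case: (n =P k) => // nk; rewrite nk eqxx in h.
by rewrite !inE => h; case: (n =P k) => // nk; rewrite nk eqxx orbT in h.
Qed.

(* A summable majorant [(n+1)^(-3/2)] for which cubic decay over a rank-2 lattice
   splits as a product, see [inv_cube_le_pow32V]. *)
Definition pow32V (n : nat) : R := (n.+1%:R * Num.sqrt n.+1%:R)^-1.

Lemma pow32V_ge0 n : 0 <= pow32V n.
Proof. by rewrite invr_ge0 mulr_ge0 ?sqrtr_ge0. Qed.

Lemma summ_pow32V : summ pow32V.
Proof.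
(* With s and t the square roots of n+1 and n+2, the increment is 6 / (s t (s + t)); as t <= 2 s,
   its denominator is at most 6 s^3, whence the constant 6. *)
apply: (@summ_nat_telescope _ (fun n => 6 / Num.sqrt n.+1%:R)) => n.
- exact: pow32V_ge0.
- by rewrite divr_ge0 ?sqrtr_ge0.
rewrite /pow32V -[n.+2%:R]natr1 -{1}(@sqr_sqrtr _ n.+1%:R)//.
set s := Num.sqrt n.+1%:R; set t := Num.sqrt (n.+1%:R + 1).
have s1 : 1 <= s by rewrite -sqrtr1 ler_wsqrtr// ler1n.
have t0 : 0 <= t := sqrtr_ge0 _.
have ts : t ^+ 2 = s ^+ 2 + 1 by rewrite !sqr_sqrtr ?addr_ge0.
have st : s <= t by apply: ler_wsqrtr; lra.
have t2 : t <= 2 * s by nra.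
have -> : 6 / s - 6 / t = 6 / (s * t * (s + t)).
  have -> : 6 / s - 6 / t = 6 * (t ^+ 2 - s ^+ 2) / (s * t * (s + t)).
    by field; rewrite !gt_eqF//; nra.
  by rewrite ts (addrC (s ^+ 2)) addrK mulr1.
have sp : 0 < s by lra.
have tp : 0 < t by lra.
rewrite -[leLHS]mul1r ler_pdivrMr; last by rewrite mulr_gt0// exprn_gt0.
rewrite mulrAC ler_pdivlMr ?mul1r; last by rewrite !mulr_gt0// addr_gt0.
have h1 : s * t <= s * (2 * s) by rewrite ler_pM2l//; lra.
have h2 : s + t <= 3 * s by lra.
apply: le_trans (_ : s * (2 * s) * (3 * s) <= _).
  by rewrite ler_pM// ?mulr_ge0// ?addr_ge0// ltW.
by rewrite le_eqVlt; apply/orP; left; apply/eqP; ring.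
Qed.

Lemma summ_pow32V_int : summ (fun n : int => pow32V `|n|).
Proof.
apply: summ_int => [n|//|]; [exact: pow32V_ge0|exact: summ_pow32V|].
apply: summ_le summ_pow32V => n; rewrite /pow32V lef_pV2 ?posrE ?mulr_gt0 ?sqrtr_gt0 ?ltr0n//.
by rewrite ler_pM ?sqrtr_ge0 ?ler_nat ?ler_wsqrtr ?ler_nat//; lia.
Qed.

Lemma inv_sqr_le_pow32V n : ((n.+1)%:R ^+ 2)^-1 <= pow32V n.
Proof.
rewrite /pow32V lef_pV2 ?posrE ?mulr_gt0 ?sqrtr_gt0 ?exprn_gt0 ?ltr0n// expr2.
rewrite ler_pM2l ?ltr0n//.
have : 1 <= Num.sqrt n.+1%:R :> R by rewrite -[leLHS]sqrtr1 ler_wsqrtr// ler1n.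
have := @sqr_sqrtr R n.+1%:R (ler0n _ _); nra.
Qed.

(** With a^2 = m+1 and b^2 = n+1, both a and b at least 1, one has m+1+n = a^2 + b^2 - 1 >= a b;
    cubing separates the variables. *)
Lemma inv_cube_le_pow32V m n : ((m.+1 + n)%:R ^+ 3)^-1 <= pow32V m * pow32V n.
Proof.
rewrite /pow32V -invfM lef_pV2 ?posrE ?mulr_gt0 ?sqrtr_gt0 ?exprn_gt0 ?ltr0n//.
set a := Num.sqrt m.+1%:R; set b := Num.sqrt n.+1%:R.
have a1 : 1 <= a by rewrite -sqrtr1 ler_wsqrtr// ler1n.
have b1 : 1 <= b by rewrite -sqrtr1 ler_wsqrtr// ler1n.
have ae : m.+1%:R = a ^+ 2 by rewrite sqr_sqrtr.
have be : n.+1%:R = b ^+ 2 by rewrite sqr_sqrtr.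
have -> : (m.+1 + n)%:R = a ^+ 2 + b ^+ 2 - 1 :> R.
  by rewrite -ae -be -[n.+1%:R]natr1 natrD; ring.
rewrite ae be.
have h : a * b <= a ^+ 2 + b ^+ 2 - 1 by nra.
have -> : a ^+ 2 * a * (b ^+ 2 * b) = (a * b) ^+ 3 by ring.
by rewrite lerXn2r ?nnegrE//; nra.
Qed.
End ConcreteSums.

(** * Infinite products and theta functions *)

Section InfiniteProducts.
Variable R : realType.
Local Notation C := R[i].

(** A stand-in for exp(S) <= 1 + S + S^2 on [0, 1]; adding a factor 1 + x leaves the slack x^2 + x S
    (1 - S). *)
Lemma prod1D_le (I : Type) (s : seq I) (a : I -> R) : (forall i, 0 <= a i) ->
  \sum_(i <- s) a i <= 1 ->
  \prod_(i <- s) (1 + a i) <= 1 + \sum_(i <- s) a i + (\sum_(i <- s) a i) ^+ 2.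
Proof.
move=> a0; elim: s => [|i s IH]; first by rewrite !big_nil; lra.
rewrite !big_cons; have := a0 i; move: (a i) => x x0.
have : 0 <= \sum_(j <- s) a j by rewrite sumr_ge0.
move: (\sum_(j <- s) a j) (\prod_(j <- s) _) IH => S P IH S0 h.
have /(ler_wpM2l (addr_ge0 ler01 x0)) := IH ltac:(lra).
have : 0 <= x * S * (1 - S) by rewrite !mulr_ge0//; lra.
have := sqr_ge0 x; lra.
Qed.

Lemma nm_prod1D (I : Type) (s : seq I) (u : I -> C) :
  nm (\prod_(i <- s) (1 + u i)) <= \prod_(i <- s) (1 + nm (u i)).
Proof.
rewrite nm_prod; apply: ler_prod => i _; rewrite nm_ge0/=.
by have := nmD 1 (u i); rewrite nm1.
Qed.

Lemma nm_prod1D_sub1 (I : Type) (s : seq I) (u : I -> C) :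
  nm (\prod_(i <- s) (1 + u i) - 1) <= \prod_(i <- s) (1 + nm (u i)) - 1.
Proof.
elim: s => [|i s IH]; first by rewrite !big_nil !subrr nm0.
have := nm_prod1D s u; rewrite !big_cons.
move: (\prod_(j <- s) (1 + u j)) (\prod_(j <- s) (1 + nm (u j))) IH => P Q IH PQ.
rewrite (_ : _ - 1 = (P - 1) + u i * P); last ring.
have := nmD (P - 1) (u i * P); rewrite nmM.
have := ler_wpM2l (nm_ge0 (u i)) PQ; lra.
Qed.

(** Expanded, the left side is the modulus of a polynomial in the [u i] with nonnegative
    coefficients and no term of degree below 2; the right side is its value at the moduli. *)
Lemma nm_prod1D_sub (I : Type) (s : seq I) (u : I -> C) :
  nm (\prod_(i <- s) (1 + u i) - 1 - \sum_(i <- s) u i) <=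
  \prod_(i <- s) (1 + nm (u i)) - 1 - \sum_(i <- s) nm (u i).
Proof.
elim: s => [|i s IH]; first by rewrite !big_nil !subrr nm0.
have := nm_prod1D_sub1 s u; rewrite !big_cons.
move: (\prod_(j <- s) (1 + u j)) (\prod_(j <- s) (1 + nm (u j))) (\sum_(j <- s) u j)
  (\sum_(j <- s) nm (u j)) IH => P Q S T IH PQ.
rewrite (_ : _ - _ = (P - 1 - S) + u i * (P - 1)); last ring.
have := nmD (P - 1 - S) (u i * (P - 1)); rewrite nmM.
have := ler_wpM2l (nm_ge0 (u i)) PQ; lra.
Qed.

Lemma prod1D_second_order (I : Type) (s : seq I) (u : I -> C) :
  \sum_(i <- s) nm (u i) <= 1 ->
  nm (\prod_(i <- s) (1 + u i) - 1 - \sum_(i <- s) u i) <= (\sum_(i <- s) nm (u i)) ^+ 2.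
Proof.
move=> h; have := prod1D_le (fun i => nm_ge0 (u i)) h; have := nm_prod1D_sub s u; lra.
Qed.

Lemma prod1D_first_order (I : Type) (s : seq I) (u : I -> C) :
  \sum_(i <- s) nm (u i) <= 1 ->
  nm (\prod_(i <- s) (1 + u i) - 1) <= 2 * \sum_(i <- s) nm (u i).
Proof.
move=> h; have := prod1D_le (fun i => nm_ge0 (u i)) h; have := nm_prod1D_sub1 s u.
have : 0 <= \sum_(i <- s) nm (u i) by rewrite sumr_ge0// => i _; exact: nm_ge0.
nra.
Qed.

Lemma cvs_telescope (P : nat -> C) :
  summ (fun n => nm (P n.+1 - P n)) -> exists L, cvs P L.
Proof.
move=> /summ_has_sum[l /has_sum_nat_cvs hl]; exists (P 0%N + l).
apply: cvs_ext (cvsD (cvs_cst (P 0%N)) hl) => n.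
elim: n => [|n IH]; first by rewrite big_ord0 addr0.
by rewrite big_ord_recr/= addrA IH; ring.
Qed.

(** A total mass of 1/4 keeps all partial products within 1/2 of 1, so the limit cannot vanish.
    [cvs_inf_prod] reduces to this case by splitting off finitely many factors. *)
Lemma cvs_prod_small (u : nat -> C) :
  (forall B : seq nat, uniq B -> \sum_(i <- B) nm (u i) <= 1 / 4) ->
  exists L, cvs (fun N => \prod_(n < N) (1 + u n)) L /\ L != 0.
Proof.
move=> h; pose P N := \prod_(n < N) (1 + u n).
have hP N : nm (P N - 1) <= 1 / 2.
  rewrite /P -(big_mkord predT (fun n => 1 + u n)).
  have := h (index_iota 0 N) (iota_uniq _ _) => h1.
  have := @prod1D_first_order _ (index_iota 0 N) u ltac:(lra).
  by lra.
have [|L hL] := @cvs_telescope P.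
  apply: summ_le (summZ (a := 2) _ (ex_intro _ _ h)) => // n.
  rewrite /P big_ord_recr/= -/(P n) (_ : _ - _ = P n * u n); last ring.
  rewrite nmM ler_wpM2r ?nm_ge0//.
  have := hP n; have := nm_dist_tri (P n) 1 0; rewrite !subr0 nm1; lra.
exists L; split=> //; rewrite -nm_gt0.
suff : 1 / 2 <= nm L by lra.
apply: cvs_nm_ge hL => n; have := hP n; have := nm_revtri 1 (P n); rewrite nm1 nmB; lra.
Qed.

Lemma summ_nat_shift_small (b : nat -> R) e : (forall n, 0 <= b n) -> summ b -> 0 < e ->
  exists N, forall B : seq nat, uniq B -> \sum_(i <- B) b (N + i)%N <= e.
Proof.
move=> b0 sb e0; have [A [uA hA]] := summ_tail b0 sb e0.
exists (\max_(i <- A) i).+1 => B uB.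
have := hA (map (addn (\max_(i <- A) i).+1) B); rewrite big_map; apply.
  by rewrite map_inj_uniq//; exact: addnI.
move=> i /mapP[j jB ->]; apply/negP => jA.
have := @leq_bigmax_seq _ A predT id _ jA erefl.
by rewrite /= addSn ltnNge leq_addr.
Qed.

Lemma cvs_inf_prod (u : nat -> C) : summ (fun n => nm (u n)) ->
  exists L, cvs (fun N => \prod_(n < N) (1 + u n)) L /\
    ((forall n, 1 + u n != 0) -> L != 0).
Proof.
move=> su.
have [N hN] := summ_nat_shift_small (fun n => nm_ge0 (u n)) su (e := 1 / 4) ltac:(lra).
have [L [hL L0]] := @cvs_prod_small (fun n => u (N + n)%N) hN.
exists ((\prod_(n < N) (1 + u n)) * L); split.
  apply/(cvs_shift _ _ N); apply: cvs_ext (cvsZ _ hL) => n.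
  by rewrite addnC big_split_ord.
move=> h; rewrite mulf_neq0//.
by apply/prodf_neq0 => i _; exact: h.
Qed.

Lemma cvs_inv_bounded (u : nat -> C) L : L != 0 -> cvs u L ->
  exists M, 0 < M /\ forall n, nm (u n)^-1 <= M.
Proof. by move=> L0 /(cvsV L0)/cvs_bounded. Qed.

(** The q-Pochhammer symbol (a; b)_oo, selected by its [cvs] property and 0 by default. It agrees
    with [pochinf] for |b| < 1, see [pochinf_pol]. *)
Definition pol (a b : C) : C :=
  xget 0 [set L | cvs (fun N => \prod_(n < N) (1 - a * b ^+ n)) L]%classic.

Lemma polP_neq0 a b : nm b < 1 ->
  cvs (fun N => \prod_(n < N) (1 - a * b ^+ n)) (pol a b) /\
  ((forall n, 1 - a * b ^+ n != 0) -> pol a b != 0).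
Proof.
move=> b1; have [|L [hL L0]] := @cvs_inf_prod (fun n => - (a * b ^+ n)).
  apply: summ_le (summZ (nm_ge0 a) (@summ_geom _ (nm b) _)).
    by move=> n; rewrite nmN nmM nmXn.
  by rewrite nm_ge0.
have hp : cvs (fun N => \prod_(n < N) (1 - a * b ^+ n)) (pol a b).
  by rewrite /pol; case: xgetP => [x _ //|/(_ L)]; case.
by rewrite (cvs_uniq hp hL).
Qed.

Lemma polP a b : nm b < 1 -> cvs (fun N => \prod_(n < N) (1 - a * b ^+ n)) (pol a b).
Proof. by move=> /(polP_neq0 a)[]. Qed.

Lemma pol_neq0 a b : nm b < 1 -> (forall n, 1 - a * b ^+ n != 0) -> pol a b != 0.
Proof. by move=> /(polP_neq0 a)[]. Qed.

Definition tsum (I : eqType) (f : I -> C) : C := xget 0 [set l | has_sum f l]%classic.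

Lemma tsumP (I : eqType) (f : I -> C) : summ (fun i => nm (f i)) -> has_sum f (tsum f).
Proof.
by move=> /summ_has_sum[l hl]; rewrite /tsum; case: xgetP => [x _ //|/(_ l)]; case.
Qed.

Lemma tsumE (I : eqType) (f : I -> C) l : has_sum f l -> tsum f = l.
Proof.
move=> hl; rewrite /tsum; case: xgetP => [x _ /= /has_sum_uniq|/(_ l)]; first exact.
by case.
Qed.
End InfiniteProducts.

(** * Gaussian binomials and triangular exponents *)

Section Theta.
Variable R : realType.
Local Notation C := R[i].
Variable p : C.

(** The Gaussian binomial coefficient in the variable p, by its division-free Pascal rule. The
    truncated subtraction is harmless: for m' < j' the factor [qbin m' j'] is 0. *)
Fixpoint qbin (m j : nat) : C :=
  match m, j with
  | _, 0 => 1
  | 0, _.+1 => 0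
  | m'.+1, j'.+1 => qbin m' j + p ^+ (m' - j') * qbin m' j'
  end.

Lemma qbin_small m j : (m < j)%N -> qbin m j = 0.
Proof.
elim: m j => [|m IH] [|j]//= mj.
by rewrite (IH j.+1) ?(IH j) ?mulr0 ?addr0//; lia.
Qed.

(** Induction along the Pascal rule: the new factor brings p^m = p^i p^(m-i), where p^i turns the
    exponent C(i,2) into C(i+1,2) and p^(m-i) is the weight in [qbin]. *)
Lemma q_binomial_theorem m z : \prod_(k < m) (1 - z * p ^+ k) =
  \sum_(j < m.+1) (-1) ^+ j * p ^+ 'C(j, 2) * qbin m j * z ^+ j.
Proof.
elim: m => [|m IH].
  by rewrite big_ord0 big_ord_recl big_ord0 /= !expr0 !mulr1 addr0.
rewrite big_ord_recr/= IH mulrBr mulr1.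
rewrite [in X in X - _]big_ord_recl [in RHS]big_ord_recl /= -addrA; congr (_ + _); first by case: (m).
have -> : \sum_(i < m) (-1) ^+ (bump 0 i) * p ^+ 'C(bump 0 i, 2) * qbin m (bump 0 i) * z ^+ (bump 0 i)
  = \sum_(i < m.+1) (-1) ^+ i.+1 * p ^+ 'C(i.+1, 2) * qbin m i.+1 * z ^+ i.+1.
  by rewrite [RHS]big_ord_recr /= (qbin_small (leqnn m.+1)) mulr0 mul0r addr0.
rewrite mulr_suml -sumrB; apply: eq_bigr => -[i /= im] _.
rewrite /bump /= add1n mulrDr mulrDl; congr (_ + _).
rewrite binS bin1 exprD !exprS (_ : p ^+ m = p ^+ i * p ^+ (m - i)).
  by ring.
by rewrite -exprD subnKC.
Qed.

Definition qfact (n : nat) : C := \prod_(k < n) (1 - p * p ^+ k).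

Lemma qbinE m j : (j <= m)%N -> qbin m j * (qfact j * qfact (m - j)) = qfact m.
Proof.
elim: m j => [|m IH] [|j] jm //=.
- by rewrite /qfact big_ord0 !mulr1.
- by rewrite subn0 {1}/qfact big_ord0 !mul1r.
have jm' : (j <= m)%N by [].
rewrite subSS [qfact m.+1]/qfact big_ord_recr/= -/(qfact m).
have e2 := IH j jm'.
have -> : qfact j.+1 = qfact j * (1 - p * p ^+ j) by rewrite /qfact big_ord_recr.
rewrite (_ : p ^+ m = p ^+ j * p ^+ (m - j)); last by rewrite -exprD subnKC.
have [jltm|mj] := ltnP j m.
  have e1 := IH j.+1 jltm; move: e1 e2.
  rewrite (_ : m - j = (m - j.+1).+1)%N; last lia.
  have -> : qfact (m - j.+1).+1 = qfact (m - j.+1) * (1 - p * p ^+ (m - j.+1)).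
    by rewrite /qfact big_ord_recr.
  have -> : qfact j.+1 = qfact j * (1 - p * p ^+ j) by rewrite /qfact big_ord_recr.
  rewrite exprS => e1 e2.
  transitivity (qfact m * (1 - p * p ^+ (m - j.+1)) +
        qfact m * (p * p ^+ (m - j.+1)) * (1 - p * p ^+ j)); last ring.
  by rewrite -{1}e1 -e2; ring.
have jm2 : m = j by lia.
move: e2; rewrite jm2 subnn (qbin_small (leqnn _)) add0r expr0 mulr1 mul1r => e2.
by rewrite -{2}e2; ring.
Qed.

(** The exponent n(n-1)/2 of the theta series; it is a natural number for negative n too, because
    [Negz n] is -(n+1), so p never occurs with a negative exponent. *)
Definition tri (n : int) : nat :=
  match n with Posz n => 'C(n, 2) | Negz n => 'C(n.+2, 2) end.

Lemma triE (n : int) : (tri n)%:Z * 2 = n * (n - 1).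
Proof.
have h (m : nat) : ('C(m.+1, 2) * 2 = m.+1 * m)%N.
  by rewrite bin2 -[RHS](odd_double_half (m.+1 * m)) oddM /= -muln2 andNb add0n.
case: n => [[|n]|n] //=; first by have := h n; lia.
have := h n.+1; rewrite NegzE; lia.
Qed.

Lemma tri_succ (n : int) : (tri (n + 1))%:Z = (tri n)%:Z + n.
Proof. by have := triE n; have := triE (n + 1); nia. Qed.
End Theta.

(** * Bilateral theta series and the finite triple product *)

Section JacobiTriple.
Variable R : realType.
Local Notation C := R[i].

Lemma cvs_ext_near (u v : nat -> C) l N : (forall n, (N <= n)%N -> u n = v n) ->
  cvs u l -> cvs v l.
Proof.
move=> h hu e /hu[M hM]; exists (maxn N M) => n; rewrite geq_max => /andP[Nn Mn].
by rewrite -h//; exact: hM.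
Qed.

Lemma cvs_reindex (u : nat -> C) l (k : nat -> nat) :
  (forall M, exists N, forall n, (N <= n)%N -> (M <= k n)%N) -> cvs u l -> cvs (u \o k) l.
Proof. by move=> hk hu e /hu[M hM]; have [N hN] := hk M; exists N => n /hN; exact: hM. Qed.

Lemma summ_ratio (b : nat -> R) (r : nat -> R) : (forall n, 0 <= b n) ->
  (forall n, b n.+1 = b n * r n) ->
  (forall e, 0 < e -> exists N, forall n, (N <= n)%N -> r n <= e) -> summ b.
Proof.
move=> b0 hb hr; have [N hN] := hr (1 / 2) ltac:(lra).
apply: (@summ_nat _ _ (\sum_(i < N) b i + 2 * b N)) => // K.
suff h k : \sum_(i < N + k) b i <= \sum_(i < N) b i + 2 * b N - 2 * b (N + k)%N.
  apply: (@le_trans _ _ (\sum_(i < N + K) b i)).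
    by rewrite addnC big_split_ord/= lerDl sumr_ge0.
  by have := h K; have := b0 (N + K)%N; lra.
elim: k => [|k IH]; first by rewrite addn0; lra.
rewrite addnS big_ord_recr/= hb.
have := ler_wpM2l (b0 (N + k)%N) (hN (N + k)%N (leq_addr _ _)); lra.
Qed.

Definition gterm (P X : C) (n : int) : C := P ^+ tri n * X ^ n.

Lemma summ_gterm P X : nm P < 1 -> X != 0 -> summ (fun n => nm (gterm P X n)).
Proof.
move=> P1 X0; have P0 := nm_ge0 P; have XX : 0 < nm X by rewrite nm_gt0.
have small (c : R) k : 0 < c -> forall e, 0 < e ->
    exists N, forall n, (N <= n)%N -> nm P ^+ (n + k) * c <= e.
  move=> c0 e e0; have [|N hN] := @geom_small R (nm P) (e / c) _ (divr_gt0 e0 c0).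
    by rewrite P0.
  by exists N => n Nn; rewrite -ler_pdivlMr// hN// (leq_trans Nn)// leq_addr.
apply: summ_int => [n|/=|]; first exact: nm_ge0.
  apply: (@summ_ratio _ (fun n => nm P ^+ (n + 0) * nm X)) => [n|n|]; first exact: nm_ge0.
    rewrite /gterm /= -!nmXn -!nmM addn0 binS bin1 exprD exprSz; congr nm; ring.
  exact: small.
apply: (@summ_ratio _ (fun n => nm P ^+ (n + 2) * (nm X)^-1)) => [n|n|]; first exact: nm_ge0.
  rewrite /gterm /= -nmV -!nmXn -!nmM (binS n.+2) bin1 addn2 exprD; congr nm.
  rewrite -[X ^ Negz n.+1]/(X ^- n.+2) -[X ^ Negz n]/(X ^- n.+1) !exprS.
  by field; rewrite X0 expf_neq0.
by apply: small; rewrite invr_gt0.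
Qed.

Definition gsum P X : C := tsum (gterm P X).

Lemma gsumP P X : nm P < 1 -> X != 0 -> has_sum (gterm P X) (gsum P X).
Proof. by move=> P1 X0; apply: tsumP; exact: summ_gterm. Qed.

Lemma gsum_shift P X : nm P < 1 -> P != 0 -> X != 0 -> gsum P X = X * gsum P (P * X).
Proof.
move=> P1 P0 X0; apply: has_sum_uniq (gsumP P1 X0) _.
have h : has_sum (gterm P X \o (fun n => n + 1)) (X * gsum P (P * X)).
  apply: has_sum_ext (has_sumZ X (gsumP P1 (mulf_neq0 P0 X0))) => n /=; rewrite /gterm.
  rewrite -[P ^+ tri (n + 1)]/(P ^ (tri (n + 1))%:Z) tri_succ !expfzDr// exprzMl ?unitfE//.
  by rewrite -exprnP; ring.
apply: has_sum_ext (has_sum_bij (h := fun n => n - 1) (g := fun n => n + 1) _ _ h) => [n|n|n].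
- by rewrite /= subrK.
- by rewrite subrK.
- by rewrite addrK.
Qed.

Section FixedNome.
Variable p : C.
Hypotheses (p0 : p != 0) (p1 : nm p < 1).

Definition thetaN (x : C) (N : nat) := \prod_(k < N) ((1 - x * p ^+ k) * (1 - p / x * p ^+ k)).

Definition theta (x : C) := pol x p * pol (p / x) p.

Lemma thetaP x : cvs (thetaN x) (theta x).
Proof.
by apply: cvs_ext (cvsM (polP x p1) (polP (p / x) p1)) => N; rewrite -big_split.
Qed.

Lemma theta_neq0 x : x != 0 -> (forall k : int, x != p ^ k) -> theta x != 0.
Proof.
move=> x0 h; apply: mulf_neq0; apply: pol_neq0 => // n; apply/eqP => /subr0_eq e.
  have /eqP[] := h (- n%:Z); rewrite -exprnN; apply: (mulIf (expf_neq0 n p0)).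
  by rewrite -e mulVf ?expf_neq0.
have /eqP[] := h n.+1; rewrite -exprnP exprS; apply: (mulIf (invr_neq0 x0)).
by rewrite mulfV// e mulrAC.
Qed.

(** The q-binomial theorem with 2N factors at x p^-N. The first N factors contain negative powers of
    p; taking -x p^-(i+1) out of each turns them into 1 - (p/x) p^i and leaves the monomial [K]. *)
Lemma thetaN_sum x N : x != 0 ->
  thetaN x N = \sum_(j < (N + N).+1) qbin p (N + N) j * gterm p (- x) (j%:Z - N%:Z).
Proof.
move=> x0; have xN0 : - x != 0 by rewrite oppr_eq0.
pose K := (- x) ^+ N * p ^ (- (tri (- N%:Z))%:Z).
have K0 : K != 0 by rewrite mulf_neq0 ?expf_neq0 ?expfz_neq0.
have h := q_binomial_theorem p (N + N) (x * p ^ (- N%:Z)).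
have h1 : \prod_(k < N + N) (1 - x * p ^ (- N%:Z) * p ^+ k) = K * thetaN x N.
  rewrite big_split_ord /= /thetaN big_split /=.
  have -> : \prod_(i < N) (1 - x * p ^ (- N%:Z) * p ^+ (N + i)) = \prod_(i < N) (1 - x * p ^+ i).
    apply: eq_bigr => i _; rewrite -mulrA !exprnP -expfzDr// PoszD addKr//.
  rewrite mulrA [RHS]mulrAC; congr (_ * _).
  rewrite (reindex_inj rev_ord_inj) /=.
  rewrite (eq_bigr (fun i : 'I_N => (- x * p ^ (- (i.+1)%:Z)) * (1 - p / x * p ^+ i))).
    rewrite big_split /=; congr (_ * _).
    rewrite big_split /= prodr_const card_ord; congr (_ * _).
    elim: N {K K0 h} => [|N IH]; first by rewrite big_ord0.
    rewrite big_ord_recr /= IH -expfzDr//; congr (_ ^ _).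
    have := tri_succ (- N.+1%:Z); rewrite (_ : - N.+1%:Z + 1 = - N%:Z); last lia.
    rewrite -[('C(N.+2, 2))%:Z]/((tri (- N.+1%:Z))%:Z); lia.
  move=> i _; rewrite -mulrA.
  have -> : p ^ (- N%:Z) * p ^+ (N - i.+1) = p ^ (- (i.+1)%:Z) :> C.
    by rewrite exprnP -expfzDr//; congr (_ ^ _); have := ltn_ord i; lia.
  by rewrite -exprnN exprS; field; rewrite x0 p0 expf_neq0.
apply: (mulfI K0); rewrite -h1 h mulr_sumr; apply: eq_bigr => -[j /= _] _.
rewrite /gterm.
have e1 : p ^+ tri (j%:Z - N%:Z) = p ^+ 'C(j, 2) * p ^ (tri (- N%:Z))%:Z * p ^ (- N%:Z * j%:Z).
  rewrite !exprnP -!expfzDr//; congr (_ ^ _).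
  have := triE (j%:Z - N%:Z); have := triE j; have := triE (- N%:Z).
  rewrite -[tri j]/('C(j, 2)); nia.
have e2 : (- x) ^ (j%:Z - N%:Z) = (-1) ^+ j * x ^+ j * (- x) ^ (- N%:Z).
  by rewrite expfzDr// -exprnP (exprNn x).
have e3 : (x * p ^ (- N%:Z)) ^+ j = x ^+ j * p ^ (- N%:Z * j%:Z).
  by rewrite exprMn [X in _ * X]exprnP exprz_exp.
have e4 : (- x) ^+ N * (- x) ^ (- N%:Z) = 1 by rewrite -exprnN mulfV ?expf_neq0.
have e5 : p ^ (- (tri (- N%:Z))%:Z) * p ^ (tri (- N%:Z))%:Z = 1.
  by rewrite -expfzDr// addNr expr0z.
transitivity ((-1) ^+ j * p ^+ 'C(j, 2) * qbin p (N + N) j * (x * p ^ (- N%:Z)) ^+ j *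
    ((- x) ^+ N * (- x) ^ (- N%:Z)) * (p ^ (- (tri (- N%:Z))%:Z) * p ^ (tri (- N%:Z))%:Z)).
  by rewrite e4 e5 !mulr1.
by rewrite e1 e2 e3 /K; ring.
Qed.
End FixedNome.
End JacobiTriple.

(** The exponent of p after the substitution m = i + j, n = i - j: no mixed term i j survives, so
    the double series factors. *)
Lemma tri_parity_even (i j : int) :
  (tri (i + j))%:Z + (tri (i - j))%:Z = 2 * (tri i)%:Z + 2 * (tri j)%:Z + j.
Proof.
by have := triE (i + j); have := triE (i - j); have := triE i; have := triE j; nia.
Qed.

Lemma tri_parity_odd (i j : int) :
  (tri (i + j + 1))%:Z + (tri (i - j))%:Z = 2 * (tri i)%:Z + i + 2 * (tri j)%:Z + 2 * j.
Proof. by rewrite tri_succ; have := tri_parity_even i j; lia. Qed.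

(** * Jacobi's triple product and the three-term relation *)

Section ThetaRelation.
Variable R : realType.
Local Notation C := R[i].
Variable p : C.
Hypotheses (p0 : p != 0) (p1 : nm p < 1).

Lemma one_sub_neq0 (a : C) : nm a < 1 -> 1 - a != 0.
Proof. by move=> a1; apply/eqP => /subr0_eq e; rewrite -e nm1 ltxx in a1. Qed.

Lemma nm_expr_lt1 (a : C) n : nm a < 1 -> nm (a * a ^+ n) < 1.
Proof.
move=> a1; rewrite nmM nmXn (le_lt_trans _ a1)// ler_piMr ?nm_ge0//.
by rewrite exprn_ile1 ?nm_ge0// ltW.
Qed.

Lemma pol_pp_neq0 : pol p p != 0.
Proof. by apply: pol_neq0 => // n; rewrite one_sub_neq0// nm_expr_lt1. Qed.

Lemma qfactP : cvs (qfact p) (pol p p). Proof. exact: polP. Qed.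

Lemma qfact_neq0 n : qfact p n != 0.
Proof. by apply/prodf_neq0 => i _; rewrite one_sub_neq0// nm_expr_lt1. Qed.

Lemma qbin_div m j : (j <= m)%N -> qbin p m j = qfact p m * ((qfact p j)^-1 * (qfact p (m - j))^-1).
Proof.
by move=> jm; rewrite -(qbinE p jm); field; rewrite !qfact_neq0.
Qed.

(** For fixed n the Gaussian binomial in the finite identity tends to 1/(p; p)_oo. As the partial
    products of (p; p)_oo and their inverses are bounded, a multiple of the theta series dominates
    all terms. *)
Lemma jacobi_triple x : x != 0 -> theta p x * pol p p = gsum p (- x).
Proof.
move=> x0; have xN0 : - x != 0 by rewrite oppr_eq0.
have [M [M0 hM]] := cvs_bounded qfactP.
have [K [K0 hK]] := cvs_inv_bounded pol_pp_neq0 qfactP.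
pose F (N : nat) (n : int) := if (`|n| <= N)%N then qbin p (N + N) `|n + N%:Z| * gterm p (- x) n else 0.
have Fb N n : nm (F N n) <= (M * (K * K)) * nm (gterm p (- x) n).
  rewrite /F; case: ifP => nN; last first.
    by rewrite nm0 !mulr_ge0 ?nm_ge0// ltW.
  rewrite nmM ler_wpM2r ?nm_ge0// qbin_div; last lia.
  by rewrite !nmM !ler_pM ?mulr_ge0 ?nm_ge0.
have sF : summ (fun n => (M * (K * K)) * nm (gterm p (- x) n)).
  by apply: summZ; [rewrite !mulr_ge0// ltW|exact: summ_gterm].
have FG n : cvs (F^~ n) ((pol p p)^-1 * gterm p (- x) n).
  apply: (@cvs_ext_near _ (fun N => (qfact p (N + N) * ((qfact p `|n + N%:Z|)^-1 *
    (qfact p (N + N - `|n + N%:Z|))^-1)) * gterm p (- x) n) _ _ `|n|).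
    move=> N nN; rewrite /F nN qbin_div//; lia.
  apply: cvsM; last exact: cvs_cst.
  (* The three q-factorials of the binomial have one and the same limit, one in the numerator and
     two in the denominator. *)
  have -> : (pol p p)^-1 = pol p p * ((pol p p)^-1 / pol p p).
    by field; rewrite pol_pp_neq0.
  have cv (k : nat -> nat) : (forall N, (`|n| <= N)%N -> (N - `|n| <= k N)%N) ->
      cvs (fun N => qfact p (k N)) (pol p p).
    move=> hk; apply: cvs_reindex qfactP => A; exists (A + `|n|)%N => N hN.
    by have := hk N; lia.
  apply: cvsM; first by apply: cv => N; lia.
  by apply: cvsM; apply: cvsV; rewrite ?pol_pp_neq0//; apply: cv => N; lia.
have HF N : has_sum (F N) (thetaN p x N).
  rewrite thetaN_sum//.
  pose A := [seq j%:Z - N%:Z | j <- iota 0 (N + N).+1].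
  have uA : uniq A by rewrite map_inj_uniq ?iota_uniq// => i j /addIr [].
  have := @has_sum_finite _ _ (F N) A uA.
  rewrite big_map -[iota _ _]/(index_iota 0 (N + N).+1) big_mkord.
  rewrite (eq_bigr (fun j : 'I_(N + N).+1 => qbin p (N + N) j * gterm p (- x) (j%:Z - N%:Z))).
    apply=> i iA; rewrite /F; case: ifP => // iN; case/mapP: iA.
    by exists (absz (i + N%:Z)); [rewrite mem_iota; lia|lia].
  move=> [i /= iN] _; rewrite /F ifT; last lia.
  by rewrite subrK.
have := tannery (fun n => mulr_ge0 (mulr_ge0 (ltW M0) (mulr_ge0 (ltW K0) (ltW K0)))
  (nm_ge0 (gterm p (- x) n))) sF Fb FG HF (has_sumZ _ (gsumP p1 xN0)).
move=> /(cvs_uniq (thetaP p1 x)) ->.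
by field; rewrite pol_pp_neq0.
Qed.

Let P := p ^+ 2.
Let P0 : P != 0. Proof. by rewrite expf_neq0. Qed.
Let P1 : nm P < 1.
Proof. by rewrite /P expr2 -{2}[p]expr1 nm_expr_lt1. Qed.

(** For e = 0 and e = 1 this runs bijectively through the pairs (m, n) with m + n even, respectively
    odd. *)
Definition parity_split (e : int) (ij : int * int) : int * int :=
  (ij.1 + ij.2 + e, ij.1 - ij.2).

Lemma parity_split_inj e : injective (parity_split e).
Proof.
move=> [a b] [c d] [] e1 e2.
have -> : a = c by lia.
by have -> : b = d by lia.
Qed.

Lemma odd_parity_split e ij :
  odd `|(parity_split e ij).1 + (parity_split e ij).2| = odd `|e|.
Proof. by rewrite /parity_split /=; lia. Qed.

Lemma parity_splitP (b : bool) (mn : int * int) : odd `|mn.1 + mn.2| = b ->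
  exists ij, mn = parity_split b%:Z ij.
Proof.
move: mn => [m n] /= pb; have [j hj] : exists j : int, m - n - b%:Z = 2 * j.
  by exists ((m - n - b%:Z) %/ 2)%Z; case: b pb => /= pb; lia.
exists (n + j, j); rewrite /parity_split /=; move: hj {pb}; move: (b%:Z) => e hj.
have -> : m = n + j + j + e by lia.
by rewrite addrK.
Qed.

(** [tht0] is the sum of p^(n^2) y^(2n) and [tht1] that of p^(n^2+n) y^(2n+1): Jacobi's theta_3 and,
    up to a factor p^(1/4), theta_2 in the nome p. They are b0 and b1 of the overview. *)
Definition tht0 (y : C) := gsum (p ^+ 2) (p * y ^+ 2).
Definition tht1 (y : C) := y * gsum (p ^+ 2) (p ^+ 2 * y ^+ 2).

(** In the double series x has exponent m + n and y has exponent m - n. On each parity class of m +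
    n these exponents vary independently, so the class sums to a product of a series in x and a
    series in y; the sign (-1)^(m+n) makes the result a determinant. *)
Lemma theta_rank2 x y : x != 0 -> y != 0 ->
  gsum p (- (x * y)) * gsum p (- (x / y)) = x * (tht1 x * tht0 y - tht0 x * tht1 y).
Proof.
move=> x0 y0.
have X1 : - (x * y) != 0 by rewrite oppr_eq0 mulf_neq0.
have X2 : - (x / y) != 0 by rewrite oppr_eq0 mulf_neq0 ?invr_eq0.
have H := has_sum_mul (summ_gterm p1 X1) (summ_gterm p1 X2) (gsumP p1 X1) (gsumP p1 X2).
pose pi (mn : int * int) : bool := odd `|mn.1 + mn.2|.
pose g (b : bool) := if b then - x * tht0 x * tht1 y else x * tht1 x * tht0 y.
have sx2 : x ^+ 2 != 0 by rewrite expf_neq0.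
have sy2 : y ^+ 2 != 0 by rewrite expf_neq0.
suff hg : forall b, has_sum (fun mn : int * int => if pi mn == b then gterm p (- (x * y)) mn.1 *
    gterm p (- (x / y)) mn.2 else 0) (g b).
  have h1 := has_sum_fiber H hg.
  have h2 := @has_sum_finite _ _ g [:: true; false] erefl.
  apply: has_sum_uniq h1 _.
  rewrite (_ : x * _ = \sum_(b <- [:: true; false]) g b); first by apply: h2 => b; case: b => /negP[]; rewrite !inE.
  rewrite !big_cons big_nil /g.
  by move: (tht1 x) (tht1 y) (tht0 x) (tht0 y) => a b c d; ring.
pose h := parity_split.
have T (m n : int) : gterm p (- (x * y)) m * gterm p (- (x / y)) n =
    (-1) ^ (m + n) * p ^ ((tri m)%:Z + (tri n)%:Z) * x ^ (m + n) * y ^ (m - n).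
  have u1 : (-1 : C) != 0 by rewrite oppr_eq0 oner_eq0.
  rewrite /gterm -(mulN1r (x * y)) -(mulN1r (x / y)) !exprzMl ?unitfE ?mulf_neq0 ?invr_eq0//.
  by rewrite !expfzDr// exprz_inv !exprnP -invr_expz; ring.
have G (A X : C) n : A != 0 -> X != 0 ->
    gterm P (A * X ^+ 2) n = p ^ (2 * (tri n)%:Z) * A ^ n * X ^ (2 * n).
  move=> A0 X0; rewrite /gterm exprzMl ?unitfE ?expf_neq0// /P -exprM.
  by rewrite !exprnP exprz_exp mulrA.
have s0 n : (-1 : C) ^ (2 * n) = 1 by rewrite -exprz_exp -exprnP sqrrN expr1n exp1rz.
have e0 (i j : int) : gterm p (- (x * y)) (i + j + 0) * gterm p (- (x / y)) (i - j) =
    gterm P (x ^+ 2) i * gterm P (p * y ^+ 2) j.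
  have := G 1 x i (oner_neq0 _) x0; rewrite mul1r => ->.
  rewrite (G p y j)// T exp1rz mulr1.
  rewrite (_ : i + j + 0 + (i - j) = 2 * i); last ring.
  rewrite (_ : i + j + 0 - (i - j) = 2 * j); last ring.
  rewrite s0 (_ : (tri (i + j + 0))%:Z + (tri (i - j))%:Z = 2 * (tri i)%:Z + 2 * (tri j)%:Z + j).
    by rewrite !expfzDr//; ring.
  by rewrite addr0 tri_parity_even.
have e1 (i j : int) : gterm p (- (x * y)) (i + j + 1) * gterm p (- (x / y)) (i - j) =
    - x * (gterm P (p * x ^+ 2) i * (y * gterm P (p ^+ 2 * y ^+ 2) j)).
  rewrite (G p x i)// (G (p ^+ 2) y j)// T.
  rewrite (_ : i + j + 1 + (i - j) = 2 * i + 1); last ring.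
  rewrite (_ : i + j + 1 - (i - j) = 2 * j + 1); last ring.
  rewrite (_ : (tri (i + j + 1))%:Z + (tri (i - j))%:Z = 2 * (tri i)%:Z + i + 2 * (tri j)%:Z + 2 * j).
    by rewrite (exprnP p 2) exprz_exp !expfzDr// ?oppr_eq0 ?oner_eq0// s0 !expr1z; ring.
  exact: tri_parity_odd.
have px2 : p * x ^+ 2 != 0 by rewrite mulf_neq0.
have py2 : p * y ^+ 2 != 0 by rewrite mulf_neq0.
have ppx2 : p ^+ 2 * x ^+ 2 != 0 by rewrite mulf_neq0.
have ppy2 : p ^+ 2 * y ^+ 2 != 0 by rewrite mulf_neq0.
have hpi (e : int) ij : pi (h e ij) = odd `|e| by exact: odd_parity_split.
have hz (b : bool) (mn : int * int) : (forall ij, mn <> h b%:Z ij) -> (pi mn == b) = false.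
  by move=> hmn; apply/negP => /eqP /parity_splitP[ij /hmn].
have K (b : bool) : has_sum (fun ij : int * int => gterm p (- (x * y)) (h b%:Z ij).1 *
    gterm p (- (x / y)) (h b%:Z ij).2) (g b) ->
    has_sum (fun mn : int * int => if pi mn == b then gterm p (- (x * y)) mn.1 *
    gterm p (- (x / y)) mn.2 else 0) (g b).
  move=> hb; apply: (has_sum_zero_ext (@parity_split_inj b%:Z)) => [mn /hz ->//|].
  by apply: has_sum_ext hb => ij /=; rewrite hpi; case: (b); rewrite eqxx.
case; apply: K; rewrite /g.
  have := has_sumZ (- x) (has_sum_mul (summ_gterm P1 px2) _ (gsumP P1 px2) (has_sumZ y (gsumP P1 ppy2))).
  rewrite -mulrA => hh; apply: has_sum_ext (hh _) => [ij|]; first by rewrite -e1.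
  by apply: summ_le (summZ (nm_ge0 y) (summ_gterm P1 ppy2)) => n; rewrite nmM.
(* The even class yields the series at x^2; quasi-periodicity moves it to the argument p^2 x^2 used
   in [tht1]. *)
have -> : x * tht1 x = gsum P (x ^+ 2) by rewrite gsum_shift// /tht1 mulrA -expr2.
apply: has_sum_ext (has_sum_mul (summ_gterm P1 sx2) (summ_gterm P1 py2) (gsumP P1 sx2) (gsumP P1 py2)) => ij.
by rewrite -e0.
Qed.

Definition thetaF x y := theta p (x * y) * theta p (x / y) / x.

Lemma thetaF_plucker x y z w : x != 0 -> y != 0 -> z != 0 -> w != 0 ->
  thetaF x y * thetaF z w - thetaF x z * thetaF y w + thetaF x w * thetaF y z = 0.
Proof.
have E s t : s != 0 -> t != 0 ->
    thetaF s t = (pol p p) ^- 2 * (tht1 s * tht0 t - tht0 s * tht1 t).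
  move=> s0 t0; have := theta_rank2 s0 t0.
  rewrite -!jacobi_triple ?mulf_neq0 ?invr_eq0// /thetaF => h.
  move: pol_pp_neq0 h; move: (theta p (s * t)) (theta p (s / t)) (pol p p).
  move: (tht1 s) (tht1 t) (tht0 s) (tht0 t) => a b c d u v k k0 h.
  have -> : u * v / s = (u * k * (v * k)) / s / k ^+ 2 by field; rewrite s0 k0.
  by rewrite h; field; rewrite s0 k0.
move=> x0 y0 z0 w0; rewrite !E//.
move: (tht1 x) (tht1 y) (tht1 z) (tht1 w) (tht0 x) (tht0 y) (tht0 z) (tht0 w) (pol p p ^- 2).
by move=> a1 a2 a3 a4 b1 b2 b3 b4 c; ring.
Qed.
End ThetaRelation.

(** * The sum S as a limit of theta quotients *)

Section LambertSum.
Variable R : realType.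
Local Notation C := R[i].

Definition wfun (x : C) := x / (1 - x) ^+ 2.

Lemma wfunV x : wfun x^-1 = wfun x.
Proof.
rewrite /wfun; have [->|x0] := eqVneq x 0; first by rewrite invr0.
have [->|x1] := eqVneq x 1; first by rewrite invr1.
have h : 1 - x != 0 by rewrite subr_eq0 eq_sym.
have h' : x - 1 != 0 by rewrite subr_eq0.
by field; rewrite h h' x0.
Qed.

Variable p : C.
Hypotheses (p0 : p != 0) (p1 : nm p < 1).

Lemma summ_wfun x : (forall n, 1 - x * p ^+ n != 0) -> summ (fun n => nm (wfun (x * p ^+ n))).
Proof.
move=> h.
have hc : cvs (fun n => 1 - x * p ^+ n) 1.
  have := cvsB (cvs_cst 1) (cvsZ x (cvs_geom p1)); rewrite mulr0 subr0; exact.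
have [K [K0 hK]] := cvs_inv_bounded (oner_neq0 _) hc.
apply: summ_le (summZ (a := K ^+ 2 * nm x) _ (@summ_geom _ (nm p) _)) => [n||].
- rewrite /wfun nmM nmM nmXn mulrC -mulrA ler_wpM2r ?mulr_ge0 ?nm_ge0 ?exprn_ge0 ?nm_ge0//.
  by rewrite nmV nmXn -exprVn -nmV lerXn2r ?nnegrE ?nm_ge0// ltW.
- by rewrite mulr_ge0 ?nm_ge0// exprn_ge0// ltW.
- by rewrite nm_ge0.
Qed.

(** The powers of p are at once the zeros of theta and the poles of S. *)
Definition off_lattice x := x != 0 /\ forall k : int, x != p ^ k.

Lemma off_lattice_r x n : off_lattice x -> 1 - x * p ^+ n != 0.
Proof.
move=> [x0 h]; apply/eqP => /subr0_eq e; have /eqP[] := h (- n%:Z).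
by rewrite -exprnN; apply: (mulIf (expf_neq0 n p0)); rewrite -e mulVf ?expf_neq0.
Qed.

Lemma off_latticeV x : off_lattice x -> off_lattice (p / x).
Proof.
move=> [x0 h]; split=> [|k]; first by rewrite mulf_neq0 ?invr_eq0.
apply/eqP => e; have /eqP[] := h (1 - k).
by rewrite expfzDr// expr1z -invr_expz -e invf_div mulrC divfK.
Qed.

Lemma off_latticeM x k : off_lattice x -> off_lattice (p ^ k * x).
Proof.
move=> [x0 h]; split=> [|j]; first by rewrite mulf_neq0 ?expfz_neq0.
apply/eqP => e; have /eqP[] := h (j - k).
by rewrite expfzDr// -e -invr_expz; field; rewrite expfz_neq0.
Qed.

Definition ssum (x : C) := tsum (fun m : int => wfun (p ^ m * x)).

Lemma wfun_negz x n : x != 0 -> wfun (p ^ (Negz n) * x) = wfun (p / x * p ^+ n).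
Proof.
move=> x0; rewrite -wfunV; congr wfun.
by rewrite NegzE -exprnN exprS; field; rewrite x0 p0 expf_neq0.
Qed.

Lemma summ_ssum x : off_lattice x -> summ (fun m : int => nm (wfun (p ^ m * x))).
Proof.
move=> xl; apply: summ_int => [n|/=|]; first exact: nm_ge0.
  apply: summ_le (summ_wfun (fun n => off_lattice_r n xl)) => n.
  by rewrite -exprnP mulrC.
apply: summ_le (summ_wfun (fun n => off_lattice_r n (off_latticeV xl))) => n.
by rewrite wfun_negz//; case: xl.
Qed.

Lemma ssumP x : off_lattice x -> has_sum (fun m : int => wfun (p ^ m * x)) (ssum x).
Proof. by move=> /summ_ssum; exact: tsumP. Qed.

Lemma ssum_shift x k : off_lattice x -> ssum (p ^ k * x) = ssum x.
Proof.
move=> xl; apply: tsumE.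
have := has_sum_bij (h := fun n => n + k) (g := fun n => n - k) (addrK _) (subrK _) (ssumP xl).
by apply: has_sum_ext => n /=; rewrite expfzDr// mulrA.
Qed.

Lemma ssumV x : off_lattice x -> ssum x^-1 = ssum x.
Proof.
move=> xl; apply: tsumE.
have := has_sum_bij (h := fun n : int => - n) (g := fun n => - n) (@opprK _) (@opprK _) (ssumP xl).
by apply: has_sum_ext => n /=; rewrite -wfunV invfM invr_expz opprK.
Qed.

(** The half of S that belongs to the single factor [pol x p] of theta; the other factor contributes
    [hsum (p / x)]. *)
Definition hsum (x : C) := tsum (fun n : nat => wfun (x * p ^+ n)).

Lemma hsumP x : (forall n, 1 - x * p ^+ n != 0) -> has_sum (fun n : nat => wfun (x * p ^+ n)) (hsum x).
Proof. by move=> /summ_wfun; exact: tsumP. Qed.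

Lemma ssum_hsum x : off_lattice x -> ssum x = hsum x + hsum (p / x).
Proof.
move=> xl; have := has_sum_int_nat (ssumP xl) => h; apply: has_sum_uniq h _.
have := has_sumD (hsumP (fun n => off_lattice_r n xl)) (hsumP (fun n => off_lattice_r n (off_latticeV xl))).
by apply: has_sum_ext => n; rewrite wfun_negz; [rewrite -exprnP (mulrC x)|case: xl].
Qed.

(* A sequence tending to [1] along which [tnear n = z + 1/z - 2] is never zero. *)
Definition znear (n : nat) : C := n.+2%:R / n.+1%:R.
Definition tnear (n : nat) : C := (n.+1%:R * n.+2%:R)^-1.

Lemma znear_neq0 n : znear n != 0.
Proof. by rewrite mulf_neq0 ?invr_eq0 ?pnatr_eq0. Qed.

Lemma tnear_neq0 n : tnear n != 0.
Proof. by rewrite invr_eq0 mulf_neq0 ?pnatr_eq0. Qed.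

Lemma tnearE n : tnear n = znear n + (znear n)^-1 - 2.
Proof.
have a0 : n.+1%:R != 0 :> C by rewrite pnatr_eq0.
have : n.+1%:R + 1 != 0 :> C by rewrite natr1 pnatr_eq0.
rewrite /tnear /znear -[n.+2%:R]natr1; move: n.+1%:R a0 => a a0 a1.
by field; rewrite a0 a1.
Qed.

Lemma cvs_tnear : cvs tnear 0.
Proof.
apply: (@cvs0_squeeze _ _ (fun n => n.+1%:R^-1)); last first.
  move=> n; rewrite /tnear nmV nmM !nm_nat lef_pV2 ?posrE ?mulr_gt0 ?ltr0n//.
  by rewrite ler_peMr// ler1n.
exact: inv_nat_small.
Qed.

Definition ratio (x z : C) := pol (x * z) p * pol (x / z) p / pol x p ^+ 2.

(** With t = z + 1/z - 2 one has (1 - yz)(1 - y/z) = (1 - y)^2 - t y, so every factor of the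
    quotient is exactly 1 - t w(y). The second order bound for products is uniform in the number of
    factors and survives the limit. *)
Lemma ratio_expand x : (forall n, 1 - x * p ^+ n != 0) ->
  cvs (fun n => (ratio x (znear n) - 1) / tnear n) (- hsum x).
Proof.
move=> h; have sw := summ_wfun h; have [W0 hW0] := sw.
(* The maximum with 1 makes [W] invertible; 1/W is the threshold imposed on [tnear] below. *)
pose W := Num.max W0 1; have W1 : 1 <= W by rewrite le_max lexx orbT.
have hW B : uniq B -> \sum_(n <- B) nm (wfun (x * p ^+ n)) <= W.
  by move=> uB; rewrite le_max hW0.
have x0 : pol x p != 0 by exact: pol_neq0.
have key n : nm (tnear n) * W <= 1 ->
    nm (ratio x (znear n) - 1 + tnear n * hsum x) <= (nm (tnear n)) ^+ 2 * W ^+ 2.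
  set z := znear n; set t := tnear n => tW; have z0 : z != 0 := znear_neq0 n.
  pose A N := \prod_(k < N) (1 + - (t * wfun (x * p ^+ k))).
  have hA : cvs A (ratio x z).
    have := cvsM (cvsM (polP (x * z) p1) (polP (x / z) p1))
       (cvsV (expf_neq0 2 x0) (cvsM (polP x p1) (polP x p1))).
    rewrite -/(ratio x z); apply: cvs_ext => N.
    rewrite -!big_split -prodfV -big_split /A; apply: eq_bigr => k _ /=.
    by rewrite /t tnearE -/z /wfun; field; rewrite z0 h.
  apply: (@cvs_nm_le _ (fun N => A N - 1 + t * \sum_(k < N) wfun (x * p ^+ k))); last first.
    by apply: cvsD; [apply: cvsB => //; exact: cvs_cst|apply: cvsZ; exact: has_sum_nat_cvs (hsumP h)].
  move=> N; rewrite /A -(big_mkord predT (fun k => 1 + - (t * wfun (x * p ^+ k)))).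
  rewrite -(big_mkord predT (fun k => wfun (x * p ^+ k))).
  have hB : \sum_(k <- index_iota 0 N) nm (- (t * wfun (x * p ^+ k))) <= nm t * W.
    under eq_bigr do rewrite nmN nmM.
    by rewrite -mulr_sumr ler_wpM2l ?nm_ge0// hW ?iota_uniq.
  have := prod1D_second_order (le_trans hB tW); rewrite sumrN -mulr_sumr opprK => h2.
  apply: le_trans h2 _; rewrite -exprMn lerXn2r ?nnegrE ?mulr_ge0 ?nm_ge0//; last lra.
  by rewrite sumr_ge0// => k _; exact: nm_ge0.
suff : cvs (fun n => (ratio x (znear n) - 1) / tnear n + hsum x) 0.
  move=> /cvsD /(_ (cvs_cst (- hsum x))); rewrite add0r.
  by apply: cvs_ext => n; rewrite addrK.
move=> e e0; have W2 : 0 < W ^+ 2 by rewrite exprn_gt0//; lra.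
have [N hN] := cvs_tnear (e := Num.min (W^-1) (e / W ^+ 2)) ltac:(by rewrite lt_min invr_gt0 divr_gt0// andbT; lra).
exists N => n /hN; rewrite !subr0 le_min => /andP[h1 h2].
have t0 := tnear_neq0 n; have nt0 : 0 < nm (tnear n) by rewrite nm_gt0.
have h3 := key n ltac:(by rewrite -ler_pdivlMr ?mul1r//; lra).
rewrite (_ : _ + _ = (ratio x (znear n) - 1 + tnear n * hsum x) / tnear n); last by field.
rewrite nmM nmV ler_pdivrMr//; apply: le_trans h3 _.
rewrite expr2 -mulrA mulrC ler_wpM2r ?nm_ge0//.
by rewrite -ler_pdivlMr.
Qed.

Lemma ratio_cvs1 x : (forall n, 1 - x * p ^+ n != 0) -> cvs (fun n => ratio x (znear n)) 1.
Proof.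
move=> h; have := cvsD (cvsM cvs_tnear (ratio_expand h)) (cvs_cst 1).
rewrite mul0r add0r; apply: cvs_ext => n; field; exact: tnear_neq0.
Qed.

Lemma theta_V x : theta p (p / x) = theta p x.
Proof.
rewrite /theta mulrC; congr (pol _ p * _).
have [->|x0] := eqVneq x 0; first by rewrite invr0 mulr0 invr0 mulr0.
by field; rewrite p0 x0.
Qed.

Lemma polS a : pol a p = (1 - a) * pol (a * p) p.
Proof.
apply: cvs_uniq (polP a p1) _; apply/(cvs_shift _ _ 1).
apply: cvs_ext (cvsZ (1 - a) (polP (a * p) p1)) => n.
rewrite addn1 big_ord_recl expr0 mulr1; congr (_ * _).
by apply: eq_bigr => i _; rewrite -mulrA -exprS.
Qed.

(** Multiplicative form of the sigma quotient for a difference of Weierstrass p-values. In the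
    three-term relation with w = 1, divided by t, the quotients f(s,z)/f(s,1) contribute -S(s) as z
    tends to 1, while f(z,1)/t tends to the fourth power of (p; p)_oo. *)
Lemma ssum_sub x y : off_lattice x -> off_lattice y ->
  ssum y - ssum x = thetaF p x y / (thetaF p x 1 * thetaF p y 1) * pol p p ^+ 4.
Proof.
move=> xl yl; have [x0 hx] := xl; have [y0 hy] := yl.
have pp0 : pol p p != 0 := pol_pp_neq0 p1.
have F1 s : off_lattice s -> thetaF p s 1 != 0.
  by move=> [s0 hs]; rewrite /thetaF mulr1 divr1; have := theta_neq0 p0 p1 s0 hs;
    move: (theta p s) => u u0; rewrite !mulf_neq0 ?invr_eq0.
have hF s : off_lattice s ->
    cvs (fun n => (thetaF p s (znear n) / thetaF p s 1 - 1) / tnear n) (- ssum s).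
  move=> sl; have [s0 hs] := sl; rewrite ssum_hsum// opprD.
  have h1 n := off_lattice_r n sl.
  have h2 n := off_lattice_r n (off_latticeV sl).
  have := cvsD (cvsM (ratio_expand h1) (ratio_cvs1 h2)) (ratio_expand h2).
  rewrite mulr1; apply: cvs_ext => n.
  have z0 := znear_neq0 n.
  have -> : thetaF p s (znear n) / thetaF p s 1 = ratio s (znear n) * ratio (p / s) (znear n).
    rewrite /thetaF /ratio /theta mulr1 divr1.
    have -> : p / (s * znear n) = p / s / znear n by field; rewrite s0 z0.
    have -> : p / (s / znear n) = p / s * znear n by field; rewrite s0 z0.
    by field; rewrite s0 !pol_neq0.
  by field; exact: tnear_neq0.
have hz : cvs (fun n => thetaF p (znear n) 1 / tnear n) (pol p p ^+ 4).
  have h1 n : 1 - p * p ^+ n != 0 by rewrite one_sub_neq0// nm_expr_lt1.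
  have := cvsM (ratio_cvs1 h1) (ratio_cvs1 h1).
  move=> /(cvsZ (pol p p ^+ 4)); rewrite !mulr1; apply: cvs_ext => n.
  have z0 := znear_neq0 n; have t0 := tnear_neq0 n.
  rewrite /thetaF /ratio /theta mulr1 divr1 (polS (znear n)) (mulrC (znear n) p).
  (* The vanishing part of f(z,1) = theta(z)^2 / z is (1 - z)^2 / z, which is exactly t. *)
  have e : (1 - znear n) ^+ 2 = tnear n * znear n by rewrite tnearE; field.
  transitivity ((1 - znear n) ^+ 2 / znear n / tnear n *
     (pol (p * znear n) p * pol (p / znear n) p) ^+ 2); last by field; rewrite z0 t0.
  by rewrite e; field; rewrite z0 t0 pp0.
apply: (cvs_uniq _ (cvsZ (thetaF p x y / (thetaF p x 1 * thetaF p y 1)) hz)).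
have -> : ssum y - ssum x = - ssum x - - ssum y by rewrite opprK addrC.
apply: cvs_ext (cvsB (hF x xl) (hF y yl)) => n.
have z0 := znear_neq0 n; have t0 := tnear_neq0 n.
have := thetaF_plucker p0 p1 x0 y0 z0 (oner_neq0 _) => pl.
move: (F1 x xl) (F1 y yl) pl t0.
move: (thetaF p x y) (thetaF p (znear n) 1) (thetaF p x (znear n)) (thetaF p y 1).
move: (thetaF p x 1) (thetaF p y (znear n)) (tnear n).
move=> x1 yz t xy z1 xz y1 nx1 ny1 pl t0.
apply/eqP; rewrite -subr_eq0; apply/eqP.
transitivity (- (xy * z1 - xz * y1 + x1 * yz) / (x1 * y1 * t)); last by rewrite pl oppr0 mul0r.
by field; rewrite nx1 ny1 t0.
Qed.
End LambertSum.

(** * Power series and Laurent germs *)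

Section PowerSeries.
Variable R : realType.
Local Notation C := R[i].

Lemma summ_fiber (I K : eqType) (pi : I -> K) (L : K -> seq I) (b : I -> R) :
  (forall i, 0 <= b i) -> (forall k, uniq (L k)) ->
  (forall k i, i \in L k -> pi i = k) -> summ b -> summ (fun k => \sum_(i <- L k) b i).
Proof.
move=> b0 uL hL [M hM]; exists M => B uB.
have -> : \sum_(k <- B) \sum_(i <- L k) b i = \sum_(i <- flatten [seq L k | k <- B]) b i.
  by rewrite big_flatten big_map.
apply: hM; elim: B uB => [//|k B IH] /= /andP[kB uB].
rewrite cat_uniq uL IH// andbT; apply/hasPn => i /flattenP[_ /mapP[k' k'B ->] ik'].
by apply: contraNN kB => ik; rewrite -(hL k i ik) (hL k' i ik').
Qed.

Lemma has_sum_fiber_finite (I K : eqType) (pi : I -> K) (L : K -> seq I) (f : I -> C) l :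
  (forall k, uniq (L k)) -> (forall k i, (i \in L k) = (pi i == k)) ->
  has_sum f l -> has_sum (fun k => \sum_(i <- L k) f i) l.
Proof.
move=> uL hL hf; apply: (has_sum_fiber (pi := pi) hf) => k.
have := @has_sum_finite _ _ (fun i => if pi i == k then f i else 0) (L k) (uL k).
rewrite (eq_big_seq f) => [|i]; last by rewrite hL => ->.
by apply=> i; rewrite hL => /negPf ->.
Qed.

Definition antidiag (n : nat) : seq (nat * nat) := [seq (i, (n - i)%N) | i <- iota 0 n.+1].

Lemma antidiag_uniq n : uniq (antidiag n).
Proof. by rewrite map_inj_uniq ?iota_uniq// => i j []. Qed.

Lemma mem_antidiag n ij : (ij \in antidiag n) = ((ij.1 + ij.2)%N == n).
Proof.
case: ij => i j /=; apply/mapP/eqP => [[k] |<-].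
  by rewrite mem_iota => kn [-> ->]; lia.
by exists i; [rewrite mem_iota; lia|congr pair; lia].
Qed.

Lemma has_sum_cauchy (a b : nat -> C) l k : summ (fun n => nm (a n)) -> summ (fun n => nm (b n)) ->
  has_sum a l -> has_sum b k -> has_sum (fun n => \sum_(i < n.+1) a i * b (n - i)%N) (l * k).
Proof.
move=> sa sb ha hb; have := has_sum_mul sa sb ha hb.
move=> /(has_sum_fiber_finite antidiag_uniq mem_antidiag); apply: has_sum_ext => n.
by rewrite big_map -[iota _ _]/(index_iota 0 n.+1) big_mkord.
Qed.

Lemma has_sum_nat_drop (f : nat -> C) l k : has_sum f l ->
  has_sum (fun n => f (n + k)%N) (l - \sum_(i < k) f i).
Proof.
move=> hf; elim: k => [|k IH].
  by rewrite big_ord0 subr0; apply: has_sum_ext hf => n; rewrite addn0.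
have := has_sum_nat_behead IH; rewrite big_ord_recr /= opprD addrA add0n.
by apply: has_sum_ext => n /=; rewrite addnS addSn.
Qed.

(** Convergence is demanded on the whole open unit disc because the series are evaluated at e(t) and
    e(t/10) for all t in H. *)
Definition disc_series (f : C -> C) := exists c : nat -> C, forall z, nm z < 1 ->
  summ (fun n => nm (c n * z ^+ n)) /\ has_sum (fun n => c n * z ^+ n) (f z).

Lemma disc_seriesD f g : disc_series f -> disc_series g -> disc_series (fun z => f z + g z).
Proof.
move=> [a ha] [b hb]; exists (fun n => a n + b n) => z z1.
have [sa Ha] := ha z z1; have [sb Hb] := hb z z1; split.
  by apply: summ_le (summD sa sb) => n; rewrite mulrDl nmD.
by apply: has_sum_ext (has_sumD Ha Hb) => n; rewrite mulrDl.
Qed.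

Lemma disc_seriesZ k f : disc_series f -> disc_series (fun z => k * f z).
Proof.
move=> [a ha]; exists (fun n => k * a n) => z z1.
have [sa Ha] := ha z z1; split.
  by apply: summ_le (summZ (nm_ge0 k) sa) => n; rewrite -mulrA nmM.
by apply: has_sum_ext (has_sumZ k Ha) => n; rewrite mulrA.
Qed.

Lemma disc_seriesB f g : disc_series f -> disc_series g -> disc_series (fun z => f z - g z).
Proof.
move=> hf /(disc_seriesZ (-1)) hg; have [c hc] := disc_seriesD hf hg.
by exists c => z /hc; rewrite mulN1r.
Qed.

Lemma disc_series_cst k : disc_series (fun=> k).
Proof.
exists (fun n => if n == 0%N then k else 0) => z z1.
have h n : n \notin [:: 0%N] -> (if n == 0%N then k else 0) * z ^+ n = 0.
  by rewrite inE => /negPf ->; rewrite mul0r.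
split; last first.
  by have := has_sum_finite (A := [:: 0%N]) erefl h; rewrite big_seq1 expr0 mulr1.
apply: (@summ_nat _ _ (nm k)) => [n|N]; first exact: nm_ge0.
case: N => [|N]; first by rewrite big_ord0 nm_ge0.
by rewrite big_ord_recl /= expr0 mulr1 big1 ?addr0// => i _; rewrite mul0r nm0.
Qed.

(** Expanding w(u) as the sum of (j+1) u^(j+1) gives a double series, regrouped by the exponent (A +
    B m)(j + 1) of z. Each exponent occurs finitely often since A and B are positive. *)
Lemma disc_series_lambert (zeta xi : C) (A B : nat) : nm zeta = 1 -> nm xi = 1 ->
  (0 < A)%N -> (0 < B)%N ->
  exists f, disc_series f /\
    forall z, nm z < 1 -> has_sum (fun m => wfun (zeta * xi ^+ m * z ^+ (A + B * m))) (f z).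
Proof.
move=> z1 x1 A0 B0.
pose k (mk : nat * nat) : C := mk.2.+1%:R * (zeta * xi ^+ mk.1) ^+ mk.2.+1.
pose pi (mk : nat * nat) := ((A + B * mk.1) * mk.2.+1)%N.
pose L n := [seq mk <- [seq (m, j) | m <- iota 0 n.+1, j <- iota 0 n.+1] | pi mk == n].
have uL n : uniq (L n).
  rewrite filter_uniq// allpairs_uniq ?iota_uniq// => -[? ?] [? ?] //.
have hL n mk : (mk \in L n) = (pi mk == n).
  rewrite mem_filter andb_idr// => /eqP; case: mk => m j; rewrite /pi => h.
  apply/allpairsP; exists (m, j); move: h => /= h; rewrite -!topredE /=.
  by split=> //; rewrite [X in is_true X](mem_iota 0 n.+1); nia.
have hk mk : nm (k mk) = mk.2.+1%:R.
  by rewrite /k nmM nm_nat nmXn nmM nmXn z1 x1 expr1n mulr1 expr1n mulr1.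
have sF z : nm z < 1 -> summ (fun mk => nm (k mk * z ^+ pi mk)).
  move=> hz; have n0 := nm_ge0 z.
  have z01 : 0 <= nm z < 1 by rewrite n0.
  apply: summ_le (summ_prod (fun n => exprn_ge0 n n0) (fun n => mulr_ge0 (ler0n _ n.+1) (exprn_ge0 n n0))
     (summ_geom z01) (summ_ngeom z01)) => -[m j] /=.
  rewrite nmM hk nmXn /= mulrCA ler_wpM2l// -exprD.
  (* The exponent (A + B m)(j + 1) is at least m + j, so a product of two one-variable series is a
     majorant. *)
  apply: ler_wiXn2l => //; first exact: ltW.
  by rewrite /pi /=; nia.
exists (fun z => tsum (fun mk => k mk * z ^+ pi mk)); split.
  exists (fun n => \sum_(mk <- L n) k mk) => z hz.
  have e n : \sum_(mk <- L n) k mk * z ^+ pi mk = (\sum_(mk <- L n) k mk) * z ^+ n.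
    by rewrite mulr_suml; apply: eq_big_seq => mk; rewrite hL => /eqP ->.
  split.
    have := summ_fiber (fun mk => nm_ge0 (k mk * z ^+ pi mk)) uL (pi := pi) _ (sF z hz).
    move=> /(_ (fun n mk h => eqP (etrans (esym (hL n mk)) h))).
    by apply: summ_le => n; rewrite -e; exact: nm_sum.
  by apply: has_sum_ext (has_sum_fiber_finite uL hL (tsumP (sF z hz))) => n; rewrite e.
move=> z hz; apply: has_sum_rows (tsumP (sF z hz)) _ => m.
have um : nm (zeta * xi ^+ m * z ^+ (A + B * m)) < 1.
  rewrite !nmM !nmXn z1 x1 expr1n !mul1r exprn_ilt1 ?nm_ge0//; lia.
apply: has_sum_ext (has_sumZ _ (has_sum_ngeom um)) => j /=.
by rewrite /k /pi /= exprM exprMn exprS [X in _ = _ * X]exprS; ring.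
Qed.
End PowerSeries.

(** * Power series at 0 with exponentially bounded coefficients *)

Section Germs.
Variable R : realType.
Local Notation C := R[i].

(** The bound M K^n takes the place of a radius of convergence: for sums, products and inverses the
    new constants are computed from the old ones. *)
Definition germ_at (c : nat -> C) (M K : R) (f : C -> C) :=
  [/\ 0 < M, 0 < K, forall n, nm (c n) <= M * K ^+ n &
   forall z, K * nm z < 1 -> has_sum (fun n => c n * z ^+ n) (f z)].

Definition germ (f : C -> C) := exists c M K, germ_at c M K f.

Lemma germ_summ c M K f z : germ_at c M K f -> K * nm z < 1 ->
  summ (fun n => nm (c n * z ^+ n)).
Proof.
move=> [M0 K0 hc _] Kz.
apply: summ_le (summZ (ltW M0) (@summ_geom _ (K * nm z) _)) => [n|].
  by rewrite nmM nmXn exprMn mulrA ler_wpM2r ?exprn_ge0 ?nm_ge0.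
by rewrite Kz andbT mulr_ge0 ?nm_ge0// ltW.
Qed.

Lemma germ_weaken c M K f M' K' : M <= M' -> K <= K' -> germ_at c M K f -> germ_at c M' K' f.
Proof.
move=> MM KK [M0 K0 hc hf]; split=> [||n|z h].
- exact: lt_le_trans MM.
- exact: lt_le_trans KK.
- apply: le_trans (hc n) _; apply: ler_pM => //; first exact: ltW.
    by rewrite exprn_ge0// ltW.
  by rewrite lerXn2r ?nnegrE// ltW// (lt_le_trans K0).
- by apply: hf; apply: le_lt_trans h; rewrite ler_wpM2r ?nm_ge0.
Qed.

Lemma disc_series_germ f : disc_series f -> germ f.
Proof.
move=> [c hc].
(* Absolute summability at 1/2 bounds the coefficients by a multiple of 2^n. *)
have h2 : nm (2^-1 : C) < 1 by rewrite nmV nm_nat; lra.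
have [[M hM] _] := hc _ h2.
exists c, (Num.max M 1), 2; split=> // [|n|z hz].
- by rewrite lt_max ltr01 orbT.
- have := hM [:: n] erefl; rewrite big_seq1 nmM nmXn nmV nm_nat exprVn ler_pdivrMr ?exprn_gt0// => h.
  apply: le_trans h _; rewrite ler_wpM2r ?exprn_ge0// le_max lexx//.
- by have [] := hc z; first by have := nm_ge0 z; lra.
Qed.

Lemma natS_le_2X n : n.+1%:R <= 2 ^+ n :> R.
Proof. by rewrite -natrX ler_nat ltn_expl. Qed.

(** Doubling [K] absorbs the n + 1 equal bounds, as n + 1 <= 2^n. *)
Lemma conv_bound (a b : nat -> C) M M' K n : 0 < M -> 0 < M' -> 0 < K ->
  (forall n, nm (a n) <= M * K ^+ n) -> (forall n, nm (b n) <= M' * K ^+ n) ->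
  nm (\sum_(i < n.+1) a i * b (n - i)%N) <= M * M' * (2 * K) ^+ n.
Proof.
move=> M0 M'0 K0 ha hb; apply: le_trans (nm_sum _ _ _) _.
apply: (@le_trans _ _ (\sum_(i < n.+1) M * M' * K ^+ n)).
  apply: ler_sum => -[i /= ilt] _; rewrite nmM.
  have -> : M * M' * K ^+ n = (M * K ^+ i) * (M' * K ^+ (n - i)).
    have -> : K ^+ n = K ^+ i * K ^+ (n - i) by rewrite -exprD subnKC.
    by ring.
  by apply: ler_pM; rewrite ?nm_ge0.
rewrite sumr_const card_ord -[_ *+ _]mulr_natr exprMn -mulrA (mulrC (K ^+ n)).
rewrite ler_wpM2l ?mulr_ge0 ?(ltW M0) ?(ltW M'0)// ler_wpM2r ?natS_le_2X//.
by rewrite exprn_ge0// ltW.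
Qed.

Lemma germM f g : germ f -> germ g -> germ (fun z => f z * g z).
Proof.
move=> [a [M [K ha]]] [b [M' [K' hb]]].
pose L := Num.max K K'.
have {}ha : germ_at a M L f by apply: germ_weaken ha; rewrite // le_max lexx.
have {}hb : germ_at b M' L g by apply: germ_weaken hb; rewrite // le_max lexx orbT.
exists (fun n => \sum_(i < n.+1) a i * b (n - i)%N), (M * M'), (2 * L).
have [M0 L0 ca fa] := ha; have [M'0 _ cb fb] := hb.
split=> [||n|z hz]; [exact: mulr_gt0|exact: mulr_gt0|exact: conv_bound|].
have Lz : L * nm z < 1 by have := mulr_ge0 (ltW L0) (nm_ge0 z); lra.
have := has_sum_cauchy (germ_summ ha Lz) (germ_summ hb Lz) (fa z Lz) (fb z Lz).
apply: has_sum_ext => n; rewrite mulr_suml; apply: eq_bigr => -[i /= ilt] _.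
have -> : z ^+ n = z ^+ i * z ^+ (n - i) by rewrite -exprD subnKC.
by ring.
Qed.

Lemma germD f g : germ f -> germ g -> germ (fun z => f z + g z).
Proof.
move=> [a [M [K ha]]] [b [M' [K' hb]]].
pose L := Num.max K K'.
have {}ha : germ_at a M L f by apply: germ_weaken ha; rewrite // le_max lexx.
have {}hb : germ_at b M' L g by apply: germ_weaken hb; rewrite // le_max lexx orbT.
exists (fun n => a n + b n), (M + M'), L.
have [M0 L0 ca fa] := ha; have [M'0 _ cb fb] := hb.
split=> [||n|z hz] //; first exact: addr_gt0.
  by rewrite mulrDl (le_trans (nmD _ _))// lerD.
by apply: has_sum_ext (has_sumD (fa z hz) (fb z hz)) => n; rewrite mulrDl.
Qed.

Lemma germ_cst k : germ (fun=> k).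
Proof. exact/disc_series_germ/disc_series_cst. Qed.

(** Coefficients of 1/g. Each depends on all earlier ones; returning the whole list keeps the
    recursion structural. *)
Fixpoint inv_coefs (g : nat -> C) (n : nat) : seq C :=
  match n with
  | 0 => [:: (g 0%N)^-1]
  | m.+1 => rcons (inv_coefs g m)
      (- (g 0%N)^-1 * \sum_(i < m.+1) g (m.+1 - i)%N * nth 0 (inv_coefs g m) i)
  end.

Definition inv_coef g n := nth 0 (inv_coefs g n) n.

Lemma size_inv_coefs g n : size (inv_coefs g n) = n.+1.
Proof. by elim: n => [//|n IH]; rewrite /= size_rcons IH. Qed.

Lemma nth_inv_coefs g n i : (i <= n)%N -> nth 0 (inv_coefs g n) i = inv_coef g i.
Proof.
elim: n => [|n IH]; first by rewrite leqn0 => /eqP ->.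
rewrite leq_eqVlt => /orP[/eqP -> //|ilt] /=.
by rewrite nth_rcons size_inv_coefs ilt IH.
Qed.

Lemma inv_coef0 g : inv_coef g 0 = (g 0%N)^-1. Proof. by []. Qed.

Lemma inv_coefS g n : inv_coef g n.+1 =
  - (g 0%N)^-1 * \sum_(i < n.+1) g (n.+1 - i)%N * inv_coef g i.
Proof.
rewrite /inv_coef /= nth_rcons size_inv_coefs ltnn eqxx; congr (_ * _).
by apply: eq_bigr => -[i /= ilt] _; rewrite nth_inv_coefs.
Qed.

(** The ratio L of the bound is chosen with L - K = K u M, where u = 1/|g 0|. Then u M times the
    convolution of powers of K and L telescopes to L^(n+1) - K^(n+1), and the induction closes. *)
Lemma inv_coef_bound g M K : g 0%N != 0 -> 0 < M -> 0 < K ->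
  (forall n, nm (g n) <= M * K ^+ n) ->
  forall n, nm (inv_coef g n) <= nm (g 0%N)^-1 * (K * (1 + nm (g 0%N)^-1 * M)) ^+ n.
Proof.
move=> g0 M0 K0 hg; set u := nm _^-1; set L := K * _.
have u0 : 0 < u by rewrite nm_gt0 invr_eq0.
have uM : 0 < u * M by rewrite mulr_gt0.
have KL : K * (u * M) = L - K by rewrite /L; ring.
have L0 : 0 < L by rewrite /L mulr_gt0//; lra.
have geo n : u * M * \sum_(i < n.+1) K ^+ (n.+1 - i) * L ^+ i = L ^+ n.+1 - K ^+ n.+1.
  elim: n => [|n IH].
    by rewrite big_ord1 subn0 !expr1 expr0 mulr1 mulrC.
  rewrite big_ord_recr /= subSn// subnn expr1 mulrDr.
  rewrite (eq_bigr (fun i : 'I_n.+1 => K * (K ^+ (n.+1 - i) * L ^+ i))); last first.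
    by move=> -[i /= ilt] _; rewrite (@subSn i n.+1) ?(ltnW ilt)// exprS mulrA.
  rewrite -mulr_sumr mulrCA IH (mulrA _ K) (mulrC (u * M)) KL !exprS; ring.
elim/ltn_ind => -[_|n IH]; first by rewrite inv_coef0 expr0 mulr1.
rewrite inv_coefS nmM nmN -/u ler_wpM2l ?(ltW u0)//.
apply: le_trans (nm_sum _ _ _) _.
apply: (@le_trans _ _ (\sum_(i < n.+1) (u * M) * (K ^+ (n.+1 - i) * L ^+ i))).
  apply: ler_sum => -[i /= ilt] _; rewrite nmM.
  have -> : u * M * (K ^+ (n.+1 - i) * L ^+ i) = (M * K ^+ (n.+1 - i)) * (u * L ^+ i) by ring.
  by apply: ler_pM; rewrite ?nm_ge0// IH.
by rewrite -mulr_sumr geo lerBlDr lerDl exprn_ge0// ltW.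
Qed.

Lemma germV c M K f : germ_at c M K f -> c 0%N != 0 ->
  exists f' rho, [/\ germ f', 0 < rho & forall z, nm z < rho -> f z * f' z = 1].
Proof.
move=> hf c0; have [M0 K0 hc Hf] := hf.
have hb := inv_coef_bound c0 M0 K0 hc.
set u := nm _^-1 in hb; set L := K * _ in hb.
have u0 : 0 < u by rewrite nm_gt0 invr_eq0.
have KL : K <= L by rewrite /L ler_peMr ?ltW// ltrDl mulr_gt0.
have L0 : 0 < L := lt_le_trans K0 KL.
pose f' z := tsum (fun n => inv_coef c n * z ^+ n).
have hz z : L * nm z < 1 -> summ (fun n => nm (inv_coef c n * z ^+ n)).
  move=> Lz; apply: summ_le (summZ (ltW u0) (@summ_geom _ (L * nm z) _)) => [n|].
    by rewrite nmM nmXn exprMn mulrA ler_wpM2r ?exprn_ge0 ?nm_ge0.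
  by rewrite Lz andbT mulr_ge0 ?nm_ge0// ltW.
exists f', L^-1; split; first by exists (inv_coef c), u, L; split=> // z Lz; exact: tsumP (hz z Lz).
  by rewrite invr_gt0.
move=> z zL; have Lz : L * nm z < 1 by rewrite mulrC -ltr_pdivlMr// div1r.
have Kz : K * nm z < 1 by apply: le_lt_trans Lz; rewrite ler_wpM2r ?nm_ge0.
have := has_sum_cauchy (germ_summ hf Kz) (hz z Lz) (Hf z Kz) (tsumP (hz z Lz)).
move=> /has_sum_uniq; apply.
have h n : n \notin [:: 0%N] ->
   \sum_(i < n.+1) c i * z ^+ i * (inv_coef c (n - i) * z ^+ (n - i)) = 0.
  case: n => [//|n _].
  have -> : \sum_(i < n.+2) c i * z ^+ i * (inv_coef c (n.+1 - i) * z ^+ (n.+1 - i)) =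
      (\sum_(i < n.+2) c (n.+1 - i)%N * inv_coef c i) * z ^+ n.+1.
    rewrite (reindex_inj rev_ord_inj) /= mulr_suml; apply: eq_bigr => -[i /= ilt] _.
    have il : (i <= n.+1)%N by [].
    rewrite !subSS subKn//.
    have -> : z ^+ n.+1 = z ^+ (n.+1 - i) * z ^+ i by rewrite -exprD subnK.
    by ring.
  rewrite big_ord_recr /= subnn inv_coefS mulrA mulrN mulfV// mulN1r subrr mul0r//.
have := has_sum_finite (A := [:: 0%N]) erefl h.
by rewrite big_seq1 big_ord1 !expr0 !mulr1 inv_coef0 mulfV.
Qed.

(** Laurent expansion of f/g: m is the order of vanishing of g at 0, finite because g has nonzero
    values arbitrarily close to 0. *)
Lemma germ_quotient f g : germ f -> germ g ->
  (forall rho, 0 < rho -> exists z, nm z < rho /\ g z != 0) ->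
  exists (m : nat) (c : nat -> C) (rho : R), 0 < rho /\
    forall z, 0 < nm z < rho -> has_sum (fun n => c n * z ^+ n) (z ^+ m * (f z / g z)).
Proof.
move=> gf [d [M [K hg]]] hnz; have [M0 K0 hd Hg] := hg.
have [m [dm hm]] : exists m, d m != 0 /\ forall i, (i < m)%N -> d i = 0.
  have [ex|nex] := pselect (exists n, d n != 0); last first.
    exfalso; have [z [zK]] := hnz K^-1 ltac:(by rewrite invr_gt0).
    have Kz : K * nm z < 1 by rewrite mulrC -ltr_pdivlMr// div1r.
    apply/negP; rewrite negbK; apply/eqP; apply: has_sum_uniq (Hg z Kz) _.
    apply: has_sum_ext (@has_sum0 R _) => n; apply/esym.
    have -> : d n = 0 by apply/eqP; apply: contra_notT nex => h; exists n.
    by rewrite mul0r.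
  exists (ex_minn ex); case: ex_minnP => k dk mk; split=> // i ik.
  by apply/eqP; apply: contraTT ik => /mk; rewrite -leqNgt.
pose G z := tsum (fun n => d (n + m)%N * z ^+ n).
have hGs z : K * nm z < 1 -> summ (fun n => nm (d (n + m)%N * z ^+ n)).
  move=> Kz; apply: summ_le (summZ (mulr_ge0 (ltW M0) (exprn_ge0 m (ltW K0)))
     (@summ_geom _ (K * nm z) _)) => [n|].
    rewrite nmM nmXn exprMn mulrA ler_wpM2r ?exprn_ge0 ?nm_ge0//.
    by apply: le_trans (hd _) _; rewrite exprD (mulrC (K ^+ n)) mulrA.
  by rewrite Kz andbT mulr_ge0 ?nm_ge0// ltW.
have hG : germ_at (fun n => d (n + m)%N) (M * K ^+ m) K G.
  split=> // [|n|z Kz]; first by rewrite mulr_gt0// exprn_gt0.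
    by rewrite -mulrA -exprD addnC.
  exact: tsumP (hGs z Kz).
have gG z : K * nm z < 1 -> g z = z ^+ m * G z.
  move=> Kz; have := has_sum_nat_drop m (Hg z Kz).
  rewrite big1 ?subr0 => [h|[i /= im] _]; last by rewrite hm// mul0r.
  apply: has_sum_uniq h _; apply: has_sum_ext (has_sumZ (z ^+ m) (tsumP (hGs z Kz))) => n.
  by rewrite exprD; ring.
have [G' [rho [gG' rho0 hG']]] := germV hG dm.
have [c [L [N [L0 N0 hc hP]]]] := germM gf gG'.
exists m, c, (Num.min rho (Num.min K^-1 N^-1)); split.
  by rewrite !lt_min rho0 !invr_gt0 K0.
move=> z /andP[z0]; rewrite !lt_min => /andP[h1 /andP[h2 h3]].
have Kz : K * nm z < 1 by rewrite mulrC -ltr_pdivlMr// div1r.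
have Nz : N * nm z < 1 by rewrite mulrC -ltr_pdivlMr// div1r.
have := hP z Nz; rewrite gG//.
have zn0 : z != 0 by rewrite -nm_gt0.
have GG := hG' z h1.
have Gn0 : G z != 0 by apply/eqP => G0; move: GG; rewrite G0 mul0r => /esym/eqP; rewrite oner_eq0.
have -> : G' z = (G z)^-1 by apply: (mulfI Gn0); rewrite GG mulfV.
have zm0 : z ^+ m != 0 by rewrite expf_neq0.
move: (f z) (G z) (z ^+ m) Gn0 zm0 => F E y E0 y0.
by rewrite (_ : F * E^-1 = y * (F / (y * E))) //; field; rewrite y0 E0.
Qed.
End Germs.

(** * The Lipschitz formula *)

Section RealBounds.
Variable R : realType.
Implicit Types x y : R.

Lemma sin_mvt y : exists2 c, `|c| <= `|y| & sin y = cos c * y.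
Proof.
wlog y0 : y / 0 <= y => [H|].
  have [/H //|/ltW yle] := leP 0 y.
  have [|c c1 c2] := H (- y); first by rewrite oppr_ge0.
  by exists c; [rewrite -(normrN y)|rewrite -[LHS]opprK -sinN c2 mulrN opprK].
have [->|yn0] := eqVneq y 0; first by exists 0 => //; rewrite sin0 mulr0.
have yp : 0 < y by rewrite lt_def yn0.
have [|c] := @MVT R sin cos 0 y yp (fun x _ => is_derive_sin x).
  by apply: continuous_subspaceT => x; exact: continuous_sin.
rewrite in_itv /= sin0 !subr0 => /andP[c0 cy] h; exists c => //.
by rewrite !ger0_norm ?ltW.
Qed.

Lemma norm_sin_le y : `|sin y| <= `|y|.
Proof.
have [c _ ->] := sin_mvt y; rewrite normrM ler_piMl ?normr_ge0//; exact: cos_max.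
Qed.

Lemma cos_half y : cos y = 1 - 2 * sin (y / 2) ^+ 2.
Proof.
rewrite {1}(splitr y) -[X in cos X]mulr2n cos_mulr2n cos2sin2 mulr2n; ring.
Qed.

Lemma sqr_sin_le y : sin y ^+ 2 <= y ^+ 2.
Proof. by rewrite -(real_normK (num_real _)) -(real_normK (num_real y)) lerXn2r ?nnegrE// norm_sin_le. Qed.

Lemma one_sub_cos_le y : 0 <= 1 - cos y <= y ^+ 2 / 2.
Proof.
rewrite cos_half; have := sqr_sin_le (y / 2); have := sqr_ge0 (sin (y / 2)).
rewrite expr_div_n; lra.
Qed.

Lemma norm_sin_sub_le y : `|sin y - y| <= `|y| ^+ 3.
Proof.
have [c cy ->] := sin_mvt y.
rewrite (_ : _ - y = (cos c - 1) * y); last ring.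
rewrite normrM exprSr ler_wpM2r//.
have /andP[h1 h2] := one_sub_cos_le c.
rewrite distrC ger0_norm//; apply: le_trans h2 _.
have : c ^+ 2 <= `|y| ^+ 2 by rewrite -(real_normK (num_real c)) lerXn2r ?nnegrE.
have := sqr_ge0 c; lra.
Qed.

(** The range has to include pi/2, the extreme argument when |Re s| <= 1/2. The mean value form
    gives |sin x| >= |x|/2 for |x| <= 1, and the duplication formula doubles the range. *)
Lemma sqr_sin_ge y : `|y| <= 2 -> y ^+ 2 / 16 <= sin y ^+ 2.
Proof.
move=> y2.
have h1 x : `|x| <= 1 -> `|x| / 2 <= `|sin x|.
  move=> x1; have [c cx ->] := sin_mvt x.
  rewrite normrM mulrC ler_wpM2r//; have /andP[_ h] := one_sub_cos_le c.
  have : c ^+ 2 <= 1.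
    by rewrite -(real_normK (num_real c)) exprn_ile1// (le_trans cx).
  have := ler_norm (cos c); lra.
have h2 : `|y / 2| <= 1 by rewrite normrM normfV [`|2|]ger0_norm// ler_pdivrMr// mul1r.
have h3 := h1 _ h2.
have h4 : 1 / 2 <= cos (y / 2).
  have /andP[_] := one_sub_cos_le (y / 2).
  have : (y / 2) ^+ 2 <= 1 by rewrite -(real_normK (num_real _)) exprn_ile1.
  lra.
have -> : sin y = 2 * (cos (y / 2) * sin (y / 2)).
  by rewrite {1}(splitr y) -[X in sin X]mulr2n sin_mulr2n mulr2n; ring.
have h5 : (y / 2) ^+ 2 / 4 <= sin (y / 2) ^+ 2.
  have := lerXn2r 2 (x := `|y / 2| / 2) (y := `|sin (y / 2)|).
  rewrite !nnegrE => /(_ _ _ h3) h; rewrite -(real_normK (num_real (y / 2))) -(real_normK (num_real (sin (y / 2)))).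
  have := h ltac:(by rewrite divr_ge0) ltac:(by []); rewrite expr_div_n; lra.
have h6 : 1 / 4 <= cos (y / 2) ^+ 2 by nra.
rewrite !exprMn; rewrite expr_div_n in h5; have := sqr_ge0 y.
move: (cos (y / 2) ^+ 2) (sin (y / 2) ^+ 2) (y ^+ 2) h5 h6 => c s t h5 h6 t0.
nra.
Qed.

Lemma expR_quadratic x : `|x| <= 1 / 2 -> `|expR x - 1 - x| <= 2 * x ^+ 2.
Proof.
move=> xb; have /andP[xl xr] : - (1 / 2) <= x <= 1 / 2 by rewrite -ler_norml.
have h1 := expR_ge1Dx x; have h2 := expR_ge1Dx (- x).
have h3 : expR x * expR (- x) = 1 by rewrite expRxMexpNx_1.
have h4 := expR_gt0 x.
rewrite ger0_norm; last lra.
have : expR x * (1 - x) <= 1 by rewrite -[leRHS]h3 ler_wpM2l// ltW.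
move: (expR x) h1 h4 => E h1 h4 h5; nra.
Qed.

Lemma sqr_sinh_ge y : y ^+ 2 <= (expR y - expR (- y)) ^+ 2.
Proof.
wlog y0 : y / 0 <= y => [H|].
  have [/H //|/ltW yle] := leP 0 y.
  have := H (- y); rewrite oppr_ge0 sqrrN opprK -[X in _ -> _ <= X]sqrrN opprB; exact.
have h1 := expR_ge1Dx y; have h2 : expR (- y) <= 1 by rewrite expR_le1 oppr_le0.
by rewrite lerXn2r ?nnegrE//; lra.
Qed.
End RealBounds.

(** * The exponential e(t) and the duplication formula for w *)

Section Exponential.
Variable R : realType.
Local Notation C := R[i].
Local Notation e := (@e2pi R : C -> C).
Implicit Types s t z : C.

Definition tpi : C := (0 +i* (2 * pi))%C.

Lemma tpi_neq0 : tpi != 0.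
Proof. by rewrite eq_complex /= eqxx /= mulf_neq0// gt_eqF// pi_gt0. Qed.

Lemma e2piE t : e t = ((expR (- (2 * pi * complex.Im t)) * cos (2 * pi * complex.Re t)) +i*
  (expR (- (2 * pi * complex.Im t)) * sin (2 * pi * complex.Re t)))%C.
Proof. by rewrite /e2pi /reC /imC; apply/eqP; rewrite eq_complex /= !mul0r subr0 addr0 !eqxx. Qed.

Lemma e2piD s t : e (s + t) = e s * e t.
Proof.
case: s t => [a b] [c d]; rewrite !e2piE /=.
rewrite !mulrDr opprD expRD cosD sinD.
by apply/eqP; rewrite eq_complex /=; apply/andP; split; apply/eqP; ring.
Qed.

Lemma e2pi0 : e 0 = 1.
Proof. by rewrite e2piE /= !mulr0 oppr0 expR0 cos0 sin0 mulr1 mulr0. Qed.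

Lemma nm_e2pi t : nm (e t) = expR (- (2 * pi * complex.Im t)).
Proof.
rewrite e2piE /nm /= !exprMn -mulrDr cos2Dsin2 mulr1 sqrtr_sqr ger0_norm//.
Qed.

Lemma e2pi_neq0 t : e t != 0.
Proof. by rewrite -nm_gt0 nm_e2pi expR_gt0. Qed.

Lemma e2piN t : e (- t) = (e t)^-1.
Proof.
by apply: (mulfI (e2pi_neq0 t)); rewrite -e2piD subrr e2pi0 mulfV// e2pi_neq0.
Qed.

Lemma e2piXn t n : e (n%:R * t) = e t ^+ n.
Proof.
elim: n => [|n IH]; first by rewrite mul0r e2pi0 expr0.
by rewrite -natr1 mulrDl mul1r e2piD IH exprSr.
Qed.

Lemma e2piXz t (n : int) : e (n%:~R * t) = e t ^ n.
Proof.
case: n => n; first by rewrite -exprnP -e2piXn.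
by rewrite NegzE mulrNz mulNr e2piN -exprnN -e2piXn.
Qed.

Lemma e2pi1 : e 1 = 1.
Proof.
rewrite e2piE /= mulr0 oppr0 expR0 mulr1 !mul1r.
by rewrite mulr_natl cos2pi sin2pi.
Qed.

Lemma e2pi_int (n : int) : e n%:~R = 1.
Proof. by rewrite -[n%:~R]mulr1 e2piXz e2pi1 exp1rz. Qed.

Lemma nm_le_ReIm z : nm z <= `|complex.Re z| + `|complex.Im z|.
Proof.
case: z => a b; rewrite /nm /= -[leRHS]ger0_norm ?addr_ge0// -sqrtr_sqr ler_wsqrtr//.
rewrite sqrrD !real_normK ?num_real//.
have : 0 <= `|a| * `|b| by rewrite mulr_ge0.
by rewrite -mulr_natl; lra.
Qed.

(** An explicit remainder for e at 0, the source of both the differentiability of e and the inverse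
    squares in Lipschitz' formula. *)
Lemma e2pi_quadratic h : 2 * pi * nm h <= 1 / 2 ->
  nm (e h - 1 - tpi * h) <= 6 * (2 * pi * nm h) ^+ 2.
Proof.
move: (nm_Re h) (nm_Im h); move: (nm h) => n; rewrite e2piE => ra rb hh.
apply: le_trans (nm_le_ReIm _) _; move: ra rb; case: h => a b /= ra rb.
have pi2 : 0 <= 2 * pi :> R by rewrite mulr_ge0// pi_ge0.
set r := 2 * pi * n in hh *.
have xr : `|- (2 * pi * b)| <= r by rewrite normrN normrM ger0_norm// ler_wpM2l.
have yr : `|2 * pi * a| <= r by rewrite normrM ger0_norm// ler_wpM2l.
rewrite oppr0 addr0 !mul0r sub0r add0r.
move: (- (2 * pi * b)) (2 * pi * a) xr yr => x y xr yr.
have r0 : 0 <= r by apply: le_trans xr.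
have x2 : x ^+ 2 <= r ^+ 2 by rewrite -(real_normK (num_real x)) lerXn2r ?nnegrE.
have y2 : y ^+ 2 <= r ^+ 2 by rewrite -(real_normK (num_real y)) lerXn2r ?nnegrE.
have e1 := expR_quadratic (le_trans xr hh).
have e2 : `|expR x - 1| <= 2 * r.
  have := ler_normD (expR x - 1 - x) x; rewrite subrK; nra.
have /andP[c0 c1] := one_sub_cos_le y.
have s1 := norm_sin_sub_le y.
have s2 : `|y| ^+ 3 <= r ^+ 2 * (1 / 2).
  rewrite exprSr real_normK ?num_real// ler_pM ?sqr_ge0//.
  exact: le_trans yr hh.
have a1 : `|expR x * cos y - 1 - x| <= 3 * r ^+ 2.
  rewrite (_ : _ - x = (expR x - 1 - x) * cos y - (1 + x) * (1 - cos y)); last ring.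
  rewrite (le_trans (ler_normB _ _))// !normrM.
  have h1 : `|expR x - 1 - x| * `|cos y| <= 2 * r ^+ 2.
    by rewrite -[leRHS]mulr1 ler_pM ?cos_max//; lra.
  have h2 : `|1 + x| * `|1 - cos y| <= 2 * (r ^+ 2 / 2).
    rewrite ler_pM//; last by rewrite ger0_norm//; lra.
    by have := ler_normD 1 x; rewrite normr1; lra.
  lra.
have a2 : `|expR x * sin y - y| <= 5 / 2 * r ^+ 2.
  rewrite (_ : _ - y = (expR x - 1) * sin y + (sin y - y)); last ring.
  rewrite (le_trans (ler_normD _ _))// normrM.
  have h1 : `|expR x - 1| * `|sin y| <= 2 * r * r.
    by rewrite ler_pM// (le_trans (norm_sin_le y)).
  nra.
lra.
Qed.

Lemma nm_sqr z : nm z ^+ 2 = complex.Re z ^+ 2 + complex.Im z ^+ 2.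
Proof. by case: z => a b; rewrite /nm /= sqr_sqrtr// addr_ge0 ?sqr_ge0. Qed.

(** For s = a + ib, |1 - e(s)|^2 is |e(s)| times 4 sinh(pi b)^2 + 4 sin(pi a)^2, and the two squares
    are bounded below separately by b^2 and a^2. *)
Lemma e2pi_lower s : `|complex.Re s| <= 1 / 2 -> nm s ^+ 2 * nm (e s) <= nm (1 - e s) ^+ 2.
Proof.
move=> ha; rewrite nm_e2pi !nm_sqr e2piE; move: ha; case: s => a b /= ha.
rewrite sub0r (_ : 2 * pi * a = (pi * a) + (pi * a)); last ring.
rewrite (_ : - (2 * pi * b) = - (pi * b) + - (pi * b)); last ring.
have p2 : 2 <= pi :> R := pi_ge2 R.
have h1 : (pi * a) ^+ 2 / 16 <= sin (pi * a) ^+ 2.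
  apply: sqr_sin_ge; rewrite normrM (ger0_norm (pi_ge0 _)).
  have p4 : pi / 2 < 2 :> R := pihalf_lt2 R.
  have : pi * `|a| <= pi * (1 / 2) by rewrite ler_wpM2l// pi_ge0.
  lra.
have h2 := sqr_sinh_ge (- (pi * b)); rewrite opprK in h2.
have h3 : expR (- (pi * b)) * expR (pi * b) = 1.
  by have := expRxMexpNx_1 (- (pi * b)); rewrite opprK.
have h4 := cos2Dsin2 (pi * a).
rewrite expRD cosD sinD; move: (expR (- (pi * b))) (expR (pi * b)) h2 h3 => E F h2 h3.
move: (cos (pi * a)) (sin (pi * a)) h1 h4 => c d h1 h4.
have -> : (1 - E * E * (c * c - d * d)) ^+ 2 + (- (E * E * (d * c + c * d))) ^+ 2 =
    E * E * ((E - F) ^+ 2 + 4 * d ^+ 2).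
  transitivity (1 - 2 * E ^+ 2 * (c ^+ 2 - d ^+ 2) + E ^+ 4 * (c ^+ 2 + d ^+ 2) ^+ 2); first ring.
  transitivity (E ^+ 4 - 2 * E ^+ 2 * (E * F) + (E * F) ^+ 2 + 4 * E ^+ 2 * d ^+ 2); last ring.
  rewrite h4 h3; have -> : c ^+ 2 = 1 - d ^+ 2 by lra.
  by ring.
rewrite mulrC; apply: ler_wpM2l; first by rewrite -expr2 sqr_ge0.
have h5 : 4 * a ^+ 2 <= pi ^+ 2 * a ^+ 2 by rewrite ler_wpM2r ?sqr_ge0//; nra.
have h6 : 4 * b ^+ 2 <= pi ^+ 2 * b ^+ 2 by rewrite ler_wpM2r ?sqr_ge0//; nra.
rewrite sqrrN in h2; rewrite !exprMn in h1 h2; have := sqr_ge0 a; have := sqr_ge0 b; lra.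
Qed.

Lemma wfun_e2pi_le s : `|complex.Re s| <= 1 / 2 -> nm s ^+ 2 * nm (wfun (e s)) <= 1.
Proof.
move=> /e2pi_lower h; rewrite /wfun nmM nmV nmXn mulrA.
have [->|n0] := eqVneq (nm (1 - e s)) 0; first by rewrite expr0n invr0 mulr0.
by rewrite ler_pdivrMr ?mul1r// exprn_gt0// lt_def n0 nm_ge0.
Qed.

(** After an integer translation |Re| <= 1/2, and there [e2pi_lower] forces the argument to be 0. *)
Lemma e2pi_eq1 t : e t = 1 -> exists n : int, t = n%:~R.
Proof.
move=> et; pose n := Num.floor (complex.Re t + 1 / 2); exists n.
have es : e (t - n%:~R) = 1 by rewrite e2piD e2piN e2pi_int et invr1 mulr1.
have h : `|complex.Re (t - n%:~R)| <= 1 / 2.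
  rewrite raddfB /= -(rmorph_int (real_complex R)) /=.
  have /andP[] := floor_itv (complex.Re t + 1 / 2); rewrite -/n intrD => h1 h2.
  rewrite ler_norml; apply/andP; split; lra.
have := e2pi_lower h; rewrite es subrr nm0 nm1 mulr1 expr0n => h2.
apply/eqP; rewrite -subr_eq0 -nm_eq0 -sqrf_eq0 eq_le h2 sqr_ge0//.
Qed.

Lemma wfun_dup (u : C) : u ^+ 2 != 1 -> wfun (u ^+ 2) = (wfun u + wfun (- u)) / 4.
Proof.
move=> h; have h1 : 1 - u != 0.
  by apply: contraNneq h => /subr0_eq <-; rewrite expr1n.
have h2 : 1 - - u != 0.
  by apply: contraNneq h => /subr0_eq e1; rewrite -sqrrN -e1 expr1n.
have h3 : 1 - u ^+ 2 != 0 by rewrite subr_eq0 eq_sym.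
by rewrite /wfun; field; rewrite h1 h2 h3.
Qed.

Lemma e2pi_half : e 2^-1 = -1.
Proof.
have -> : 2^-1 = (2^-1 +i* 0)%C :> C.
  by rewrite -[X in X^-1](rmorph_nat (real_complex R)) -fmorphV.
rewrite e2piE /= mulr0 oppr0 expR0 !mul1r (_ : 2 * pi / 2 = pi); last by field.
by rewrite cospi sinpi; apply/eqP; rewrite eq_complex /= oppr0 !eqxx.
Qed.

(** Iterated duplication w(u^2) = (w(u) + w(-u))/4. The summands have arguments tending to 0 after
    centring, where w(e(s)) behaves like an inverse square; this is the finite form of Lipschitz'
    formula. *)
Lemma wfun_partition z k : e z != 1 ->
  wfun (e z) = 4 ^- k * \sum_(i < 2 ^ k) wfun (e ((z + i%:R) / 2 ^+ k)).
Proof.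
move=> ez; elim: k => [|k IH].
  by rewrite expn0 big_ord1 !expr0 !invr1 mul1r addr0 mulr1.
rewrite IH expnS mul2n -addnn big_split_ord /= -big_split /= exprS invfM [_^-1 / _]mulrC -mulrA.
congr (_ * _); rewrite mulr_sumr; apply: eq_bigr => i _.
set x := (z + i%:R) / 2 ^+ k.
have p2 : 2 ^+ k != 0 :> C by rewrite expf_neq0 ?pnatr_eq0.
have -> : (z + i%:R) / 2 ^+ k.+1 = x / 2 by rewrite /x exprS; field; rewrite p2.
have -> : (z + (2 ^ k + i)%:R) / 2 ^+ k.+1 = x / 2 + 2^-1.
  by rewrite /x natrD natrX exprS; field; rewrite p2.
rewrite e2piD e2pi_half mulrN1.
have ex : e x = e (x / 2) ^+ 2 by rewrite -e2piXn mulrC divfK// pnatr_eq0.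
rewrite [RHS]mulrC -wfun_dup -ex//; apply: contraNneq ez => ex1.
have : e x ^+ (2 ^ k) = 1 by rewrite ex1 expr1n.
rewrite -e2piXn natrX /x mulrC divfK// e2piD => <-.
by rewrite -[i%:R]/((i : int)%:~R) e2pi_int mulr1.
Qed.
End Exponential.

(** * From the finite partition formula to the sum over Z *)

Section Lipschitz.
Variable R : realType.
Local Notation C := R[i].
Local Notation e := (@e2pi R : C -> C).
Implicit Types s t z x : C.

Lemma cvs_inv_nat : cvs (fun n => n.+1%:R^-1 : C) 0.
Proof.
apply: (@cvs0_squeeze _ _ (fun n => n.+1%:R^-1)); last by move=> n; rewrite nmV nm_nat.
exact: inv_nat_small.
Qed.

Lemma summ_inv_sqr_nat (z : C) : (forall n : nat, z + n%:R != 0) ->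
  summ (fun n : nat => (nm (z + n%:R) ^+ 2)^-1).
Proof.
move=> hz; have n0 n : n.+1%:R != 0 :> C by rewrite pnatr_eq0.
have hc : cvs (fun n => (z + n%:R) / n.+1%:R) 1.
  have := cvsD (cvs_cst 1) (cvsZ (z - 1) cvs_inv_nat).
  rewrite mulr0 addr0; apply: cvs_ext => n.
  by have := n0 n; rewrite -natr1 => h; field; rewrite h.
have [K [K0 hK]] := cvs_inv_bounded (oner_neq0 _) hc.
apply: summ_le (summZ (a := K ^+ 2) _ (summ_pow32V R)) => [n|]; last by rewrite exprn_ge0// ltW.
apply: le_trans (_ : K ^+ 2 * (n.+1%:R ^+ 2)^-1 <= _); last first.
  by rewrite ler_wpM2l ?inv_sqr_le_pow32V// exprn_ge0// ltW.
have := hK n; rewrite nmV nmM nmV nm_nat invfM invrK => h.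
rewrite -!exprVn -exprMn lerXn2r ?nnegrE ?invr_ge0 ?nm_ge0 ?mulr_ge0 ?invr_ge0 ?(ltW K0)//.
by rewrite ler_pdivlMr ?ltr0n.
Qed.

Lemma summ_inv_sqr z : (forall j : int, z + j%:~R != 0) ->
  summ (fun j : int => (nm (z + j%:~R) ^+ 2)^-1).
Proof.
move=> hz; apply: summ_int => [n||]; first by rewrite invr_ge0 exprn_ge0// nm_ge0.
  by apply: summ_inv_sqr_nat => n; exact: (hz n).
apply: summ_le (@summ_inv_sqr_nat (1 - z) _) => [n|n].
  rewrite (_ : z + _ = - (1 - z + n%:R)) ?nmN// NegzE mulrNz -[n.+1%:~R]/(n.+1%:R) -natr1.
  by ring.
have := hz (- (n.+1)%:Z); rewrite -oppr_eq0 opprD mulrNz opprK -[n.+1%:~R]/(n.+1%:R) -natr1.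
by apply: contraNneq => <-; apply/eqP; ring.
Qed.

Lemma cvs_e2pi_scaled x : cvs (fun k => 2 ^+ k * (1 - e (x / 2 ^+ k))) (- (tpi R * x)).
Proof.
have pi2 : 0 <= 2 * pi :> R by rewrite mulr_ge0// pi_ge0.
have q0 : 0 <= 2 * pi * nm x by rewrite mulr_ge0// nm_ge0.
set q := 2 * pi * nm x in q0.
have half01 : 0 <= (2^-1 : R) < 1 by apply/andP; split; lra.
move=> d d0.
have [N1 hN1] := geom_small half01 (e := (1 / 2) / (q + 1)) ltac:(by rewrite divr_gt0//; lra).
have [N2 hN2] := geom_small half01 (e := d / (6 * q ^+ 2 + 1)) ltac:(by rewrite divr_gt0//; have := sqr_ge0 q; lra).
exists (maxn N1 N2) => k; rewrite geq_max => /andP[/hN1 h1 /hN2 h2].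
have p2 : 2 ^+ k != 0 :> C by rewrite expf_neq0 ?pnatr_eq0.
have k0 : 0 < (2^-1 : R) ^+ k by rewrite exprn_gt0// invr_gt0.
have nx : 2 * pi * nm (x / 2 ^+ k) = q * 2^-1 ^+ k.
  by rewrite nmM nmV nmXn nm_nat -exprVn /q; ring.
have h3 : 2 * pi * nm (x / 2 ^+ k) <= 1 / 2.
  rewrite nx; move: h1; rewrite ler_pdivlMr; last lra.
  by nra.
have := e2pi_quadratic h3; rewrite nx => h4.
rewrite (_ : _ - _ = - (2 ^+ k * (e (x / 2 ^+ k) - 1 - tpi R * (x / 2 ^+ k)))); last first.
  by field; rewrite p2.
rewrite nmN nmM nmXn nm_nat.
apply: le_trans (ler_wpM2l (exprn_ge0 _ (ler0n _ _)) h4) _.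
have -> : 2 ^+ k * (6 * (q * 2^-1 ^+ k) ^+ 2) = 6 * q ^+ 2 * 2^-1 ^+ k.
  by rewrite exprVn; field; rewrite expf_neq0.
move: h2; rewrite ler_pdivlMr; last by have := sqr_ge0 q; lra.
by nra.
Qed.

Lemma cvs_wfun_scaled x : x != 0 ->
  cvs (fun k => (4 ^+ k)^-1 * wfun (e (x / 2 ^+ k))) ((tpi R * x) ^- 2).
Proof.
move=> x0; have t0 : tpi R != 0 := tpi_neq0 R.
have tx0 : - (tpi R * x) != 0 by rewrite oppr_eq0 mulf_neq0.
have h1 := cvs_e2pi_scaled x.
have hh : cvs (fun k => (2^-1 : C) ^+ k) 0.
  by apply: cvs_geom; rewrite nmV nm_nat; lra.
have he : cvs (fun k => e (x / 2 ^+ k)) 1.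
  have := cvsB (cvs_cst 1) (cvsM h1 hh); rewrite mulr0 subr0; apply: cvs_ext => k.
  have p2 : 2 ^+ k != 0 :> C by rewrite expf_neq0 ?pnatr_eq0.
  by rewrite exprVn; field; rewrite p2.
have := cvsM he (cvsV (mulf_neq0 tx0 tx0) (cvsM h1 h1)).
rewrite mul1r (_ : - (tpi R * x) * _ = (tpi R * x) ^+ 2); last by ring.
apply: cvs_ext => k; rewrite /wfun (_ : 4 ^+ k = 2 ^+ k * 2 ^+ k); last first.
  by rewrite -exprMn -natrM.
by rewrite !invfM; ring.
Qed.

Lemma nm_rescale (x W P : C) : P != 0 -> x != 0 ->
  nm (x / P) ^+ 2 * nm W <= 1 -> nm ((P * P)^-1 * W) <= (nm x ^+ 2)^-1.
Proof.
rewrite -!nm_gt0 !nmM !nmV !nmM => P0 x0 h.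
rewrite -[leRHS]mul1r ler_pdivlMr ?exprn_gt0//; apply: le_trans h.
by rewrite le_eqVlt; apply/orP; left; apply/eqP; rewrite invfM; ring.
Qed.

(** Dominated convergence in the partition formula, centred by an integer translation. The centring
    and 0 <= Re z <= 1 keep all scaled arguments within real part 1/2, where [wfun_e2pi_le] supplies
    a majorant independent of k. *)
Lemma lipschitz_unit z : 0 <= complex.Re z <= 1 -> (forall j : int, z + j%:~R != 0) ->
  has_sum (fun j : int => (z + j%:~R) ^- 2) (tpi R ^+ 2 * wfun (e z)).
Proof.
move=> /andP[z0 z1] hz.
have t0 : tpi R != 0 := tpi_neq0 R.
have sz := summ_inv_sqr hz.
have ez1 (m : int) : e (z + m%:~R) != 1.
  apply/eqP => /e2pi_eq1[n hn]; have /eqP[] := hz (m - n).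
  by rewrite intrD mulrNz addrA hn subrr.
(* The window holds 2^(k+1) integers, hence the level k+1; extension by 0 makes [F k] a family over
   Z. *)
pose F (k : nat) (j : int) : C :=
  if (- (2 ^ k)%:Z <= j) && (j < (2 ^ k)%:Z) then
    4 ^- k.+1 * wfun (e ((z + j%:~R) / 2 ^+ k.+1)) else 0.
have hF k : has_sum (F k) (wfun (e z)).
  pose A := [seq j%:Z - (2 ^ k)%:Z | j <- iota 0 (2 ^ k.+1)].
  have uA : uniq A by rewrite map_inj_uniq ?iota_uniq// => i j /addIr [].
  have hA : wfun (e z) = \sum_(i <- A) F k i.
    rewrite big_map -[(2 ^ k.+1)%N]subn0 -[iota _ _]/(index_iota 0 (2 ^ k.+1)) big_mkord.
    have := @wfun_partition _ (z + (- (2 ^ k)%:Z)%:~R) k.+1 (ez1 _).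
    rewrite e2piD e2pi_int mulr1 => ->; rewrite mulr_sumr; apply: eq_bigr => -[i /= ik] _.
    rewrite /F ifT; last by rewrite expnS in ik; lia.
    by rewrite intrD -[i%:~R]/(i%:R) (addrC (i%:R)) addrA.
  rewrite hA; apply: has_sum_finite => // j jA; rewrite /F; case: ifP => // /andP[j1 j2].
  case/mapP: jA; exists (absz (j + (2 ^ k)%:Z)); last by lia.
  by rewrite mem_iota expnS; lia.
have hb k j : nm (F k j) <= (nm (z + j%:~R) ^+ 2)^-1.
  have nz : 0 < nm (z + j%:~R) ^+ 2 by rewrite exprn_gt0// nm_gt0.
  rewrite /F; case: ifP => [/andP[j1 j2]|_]; last by rewrite nm0 invr_ge0 ltW.
  have p2 : 0 < 2 ^+ k.+1 :> R by rewrite exprn_gt0.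
  have h : `|complex.Re ((z + j%:~R) / 2 ^+ k.+1)| <= 1 / 2.
    have -> : complex.Re ((z + j%:~R) / 2 ^+ k.+1) = (complex.Re z + j%:~R) / 2 ^+ k.+1.
      rewrite -[2 in LHS](rmorph_nat (real_complex R)) -rmorphXn -fmorphV /=.
      rewrite -(rmorph_int (real_complex R)) /=; case: z {z0 z1 hz sz ez1 F hF nz} => a b /=.
      by rewrite mulr0 subr0.
    rewrite normrM normfV (gtr0_norm p2) ler_pdivrMr// exprS mulrA mul1r mulVf// mul1r.
    have h1 : - 2 ^+ k <= j%:~R :> R.
      by rewrite -(@natrX R 2 k) -[X in - X]/((2 ^ k)%N%:~R) -mulrNz ler_int.
    have h2 : j%:~R + 1 <= 2 ^+ k :> R.
      rewrite -(@natrX R 2 k) -[(2 ^ k)%:R]/((2 ^ k)%N%:~R) -[1]/(1%:~R) -intrD ler_int; lia.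
    by rewrite ler_norml; apply/andP; split; lra.
  have -> : 4 ^+ k.+1 = 2 ^+ k.+1 * 2 ^+ k.+1 :> C by rewrite -exprMn -natrM.
  apply: nm_rescale (wfun_e2pi_le h); last exact: hz.
  by rewrite expf_neq0// pnatr_eq0.
have hG j : cvs (F^~ j) ((tpi R * (z + j%:~R)) ^- 2).
  have := (cvs_shift _ _ 1).2 (cvs_wfun_scaled (hz j)).
  apply: (@cvs_ext_near _ _ _ _ `|j|.+1) => k jk; rewrite addn1 /F ifT//.
  by have := ltn_expl k (isT : 1 < 2)%N; lia.
have [l hl] : exists l, has_sum (fun j : int => (z + j%:~R) ^- 2) l.
  by apply: summ_has_sum; apply: summ_le sz => j; rewrite nmV nmXn.
have hl2 : has_sum (fun j : int => (tpi R * (z + j%:~R)) ^- 2) (tpi R ^- 2 * l).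
  by apply: has_sum_ext (has_sumZ _ hl) => j; rewrite exprMn [RHS]invfM.
have b0 (j : int) : 0 <= (nm (z + j%:~R) ^+ 2)^-1 by rewrite invr_ge0 exprn_ge0// nm_ge0.
have h := cvs_uniq (cvs_cst _) (tannery b0 sz hb hG hF hl2).
by rewrite h mulrA mulfV ?mul1r// expf_neq0.
Qed.

Lemma lipschitz z : (forall j : int, z + j%:~R != 0) ->
  has_sum (fun j : int => (z + j%:~R) ^- 2) (tpi R ^+ 2 * wfun (e z)).
Proof.
move=> hz; pose m := Num.floor (complex.Re z).
have h : has_sum (fun j : int => (z - m%:~R + j%:~R) ^- 2) (tpi R ^+ 2 * wfun (e (z - m%:~R))).
  apply: lipschitz_unit => [|j]; last first.
    by rewrite -addrA -mulrNz -intrD; exact: hz.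
  rewrite raddfB /= -(rmorph_int (real_complex R)) /=.
  have /andP[] := floor_itv (complex.Re z); rewrite -/m intrD => h1 h2.
  by apply/andP; split; lra.
move: h; rewrite e2piD e2piN e2pi_int invr1 mulr1 => h.
have := has_sum_bij (h := fun n => n + m) (g := fun n => n - m) (addrK _) (subrK _) h.
apply: has_sum_ext => j /=; congr (_ ^- 2); rewrite intrD; ring.
Qed.
End Lipschitz.

(** * Complex differentiability *)

Section QuadraticDiff.
Variable R : realType.
Local Notation C := R[i].
Local Notation e := (@e2pi R : C -> C).

(** Complex differentiability with a quadratic remainder: composition becomes a direct estimate, and
    power series satisfy it by a Taylor bound. *)
Definition qdiff (F : C -> C) (w L : C) := exists M d : R, [/\ 0 <= M, 0 < d &
  forall h, nm h < d -> nm (F (w + h) - F w - L * h) <= M * nm h ^+ 2].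

Lemma qdiff_e2pi w : qdiff e w (tpi R * e w).
Proof.
have p0 : 0 < 2 * pi :> R by rewrite mulr_gt0// pi_gt0.
exists (nm (e w) * (6 * (2 * pi) ^+ 2)), (1 / 2 / (2 * pi)); split.
- by rewrite mulr_ge0 ?nm_ge0// mulr_ge0// sqr_ge0.
- by rewrite divr_gt0//; lra.
move=> h hd; have hh : 2 * pi * nm h <= 1 / 2.
  by move/ltW: hd; rewrite ler_pdivlMr// mulrC.
rewrite e2piD (_ : _ - _ = e w * (e h - 1 - tpi R * h)); last ring.
rewrite nmM -mulrA ler_wpM2l ?nm_ge0//.
by apply: le_trans (e2pi_quadratic hh) _; rewrite exprMn mulrA.
Qed.

Lemma qdiff_comp F G w L L' : qdiff F w L -> qdiff G (F w) L' -> qdiff (G \o F) w (L' * L).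
Proof.
move=> [M [d [M0 d0 hF]]] [M' [d' [M'0 d'0 hG]]].
pose K := nm L + M.
have K0 : 0 <= K by rewrite addr_ge0 ?nm_ge0.
exists (M' * K ^+ 2 + nm L' * M), (Num.min d (Num.min 1 (d' / (K + 1)))); split.
- by rewrite addr_ge0 ?mulr_ge0 ?nm_ge0 ?sqr_ge0.
- by rewrite !lt_min d0 ltr01 divr_gt0//; lra.
move=> h; rewrite !lt_min => /andP[hd /andP[h1 h2]].
have hn := nm_ge0 h; set k := F (w + h) - F w.
have e1 := hF h hd.
have k1 : nm k <= K * nm h.
  have := nmD (F (w + h) - F w - L * h) (L * h); rewrite subrK -/k nmM => h3.
  have : M * nm h ^+ 2 <= M * nm h by rewrite ler_wpM2l// expr2 ler_piMr// ltW.
  rewrite /K; lra.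
have k2 : nm k < d'.
  apply: le_lt_trans k1 _; move: h2; rewrite ltr_pdivlMr; last lra.
  by nra.
have fk : F w + k = F (w + h) by rewrite /k addrC subrK.
have := hG k k2; rewrite fk /= => h3.
rewrite (_ : G (F (w + h)) - G (F w) - L' * L * h =
  (G (F (w + h)) - G (F w) - L' * k) + L' * (k - L * h)); last ring.
apply: le_trans (nmD _ _) _; rewrite mulrDl; apply: lerD.
  apply: le_trans h3 _; rewrite -mulrA ler_wpM2l// -exprMn lerXn2r ?nnegrE ?nm_ge0 ?mulr_ge0//.
by rewrite nmM -mulrA ler_wpM2l ?nm_ge0.
Qed.

(** The factor r^2 on the left avoids the exponent n - 2, negative for small n. *)
Lemma pow_taylor (z w : C) (r : R) n : 0 < r -> nm z <= r -> nm w <= r ->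
  r ^+ 2 * nm (z ^+ n - w ^+ n - n%:R * w ^+ n.-1 * (z - w)) <=
  n%:R ^+ 2 * r ^+ n * nm (z - w) ^+ 2.
Proof.
move=> r0 hz hw; elim: n => [|n IH].
  by rewrite !expr0 !mul0r subrr subr0 nm0 expr0n !mul0r mulr0.
set D := nm (z - w) in IH *; set T := nm _ in IH.
have D0 : 0 <= D := nm_ge0 _; have T0 : 0 <= T := nm_ge0 _.
have key : nm (z ^+ n.+1 - w ^+ n.+1 - n.+1%:R * w ^+ n * (z - w)) <= r * T + n%:R * nm w ^+ n.-1 * D ^+ 2.
  rewrite (_ : _ - _ = z * (z ^+ n - w ^+ n - n%:R * w ^+ n.-1 * (z - w)) +
     n%:R * w ^+ n.-1 * (z - w) ^+ 2).
    apply: le_trans (nmD _ _) _; rewrite (nmM z) (nmM _ ((z - w) ^+ 2)) (nmM n%:R) nm_nat !nmXn.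
    by apply: lerD => //; rewrite ler_wpM2r.
  rewrite -[n.+1%:R]natr1 !exprS; case: n {IH T T0} => [|n].
    by rewrite !expr0 !mul0r; ring.
  by rewrite /= !exprS; ring.
rewrite [n.+1.-1]/=; have := ler_wpM2l (sqr_ge0 r) key => h; apply: le_trans h _.
have h1 : r ^+ 2 * (r * T) <= n%:R ^+ 2 * r ^+ n.+1 * D ^+ 2.
  by have := ler_wpM2l (ltW r0) IH; rewrite (exprS r n); lra.
have h2 : r ^+ 2 * (n%:R * nm w ^+ n.-1 * D ^+ 2) <= n%:R * r ^+ n.+1 * D ^+ 2.
  rewrite mulrA ler_wpM2r ?sqr_ge0// mulrCA.
  case: n {IH T T0 key h1} => [|n]; first by rewrite !mul0r.
  have -> : r ^+ n.+2 = r ^+ 2 * r ^+ n by rewrite -exprD.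
  rewrite ler_wpM2l// ler_wpM2l ?sqr_ge0//.
  by rewrite lerXn2r ?nnegrE ?nm_ge0// ltW.
have h3 : 0 <= (n%:R + 1) * r ^+ n.+1 * D ^+ 2.
  by rewrite !mulr_ge0 ?exprn_ge0 ?addr_ge0// ltW.
rewrite -[n.+1%:R]natr1; lra.
Qed.

Lemma sqr_geom_bound (s : R) : 0 <= s < 1 ->
  exists2 K : R, 0 <= K & forall n : nat, n%:R ^+ 2 * s ^+ n <= K.
Proof.
move=> /andP[s0 s1]; have q0 := sqrtr_ge0 s.
have q1 : Num.sqrt s < 1 by rewrite -sqrtr1 ltr_sqrt.
have [|M hM] := @summ_ngeom R (Num.sqrt s); first by rewrite q0.
exists (M ^+ 2) => [|n]; first exact: sqr_ge0.
(* With half of the decay given to each factor n, the summable series of (n+1) sqrt(s)^n bounds the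
   base of the square. *)
have -> : n%:R ^+ 2 * s ^+ n = (n%:R * Num.sqrt s ^+ n) ^+ 2.
  by rewrite exprMn -exprM mulnC exprM sqr_sqrtr.
have := hM [:: n] erefl; rewrite big_seq1 => h.
have h2 : n%:R * Num.sqrt s ^+ n <= M.
  by apply: le_trans h; rewrite ler_wpM2r ?exprn_ge0// ler_nat.
have h0 : 0 <= n%:R * Num.sqrt s ^+ n by rewrite mulr_ge0// exprn_ge0.
by rewrite lerXn2r ?nnegrE//; apply: le_trans h2.
Qed.

Lemma disc_series_qdiff f w : disc_series f -> nm w < 1 -> exists L, qdiff f w L.
Proof.
move=> [c hc] w1; have w0 := nm_ge0 w.
(* [r] bounds |w + h| for small h; the gap between [r] and [r2] < 1 absorbs the factor n^2 of the
   Taylor remainder. *)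
pose r := (1 + nm w) / 2; pose r2 := (1 + r) / 2.
have r0 : 0 < r by rewrite /r; lra.
have rw : nm w < r by rewrite /r; lra.
have rr2 : r < r2 by rewrite /r2 /r; lra.
have r21 : r2 < 1 by rewrite /r2 /r; lra.
have r20 : 0 < r2 by lra.
have nr2 : nm (r2%:C%C : C) = r2 by rewrite nm_real gtr0_norm.
have [sr2 _] := hc (r2%:C)%C ltac:(by rewrite nr2).
have s01 : 0 <= r / r2 < 1 by rewrite divr_ge0 ?ltW//= ltr_pdivrMr// mul1r.
have [K K0 hK] := sqr_geom_bound s01.
have sB : summ (fun n => nm (c n) * (n%:R ^+ 2 * r ^+ n)).
  apply: summ_le (summZ K0 sr2) => n; rewrite nmM nmXn nr2 [leRHS]mulrCA ler_wpM2l ?nm_ge0//.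
  have -> : n%:R ^+ 2 * r ^+ n = n%:R ^+ 2 * (r / r2) ^+ n * r2 ^+ n.
    by rewrite -mulrA -exprMn divfK// gt_eqF.
  by rewrite ler_wpM2r// exprn_ge0// ltW.
have sD : summ (fun n => nm (c n * (n%:R * w ^+ n.-1))).
  apply: summ_le (summZ (a := r^-1) _ sB) => [n|]; last by rewrite invr_ge0 ltW.
  rewrite !nmM nm_nat nmXn [leRHS]mulrCA ler_wpM2l ?nm_ge0//.
  case: n => [|n]; first by rewrite mul0r expr0n !mul0r mulr0.
  have -> : r^-1 * (n.+1%:R ^+ 2 * r ^+ n.+1) = n.+1%:R ^+ 2 * r ^+ n.
    by rewrite (exprS r n); field; rewrite gt_eqF.
  apply: ler_pM; rewrite ?exprn_ge0//=; last by rewrite lerXn2r ?nnegrE// ltW.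
  by rewrite expr2 ler_peMr// ler1n.
have [MB hMB] := sB.
have MB0 : 0 <= MB by have := hMB [::] erefl; rewrite big_nil.
exists (tsum (fun n => c n * (n%:R * w ^+ n.-1))), (MB / r ^+ 2), (r - nm w); split.
- by rewrite divr_ge0// sqr_ge0.
- by rewrite subr_gt0.
move=> h hd; have zr : nm (w + h) <= r by have := nmD w h; lra.
have [_ Hz] := hc (w + h) ltac:(by lra).
have [_ Hw] := hc w w1.
have := has_sumB (has_sumB Hz Hw) (has_sumZ h (tsumP sD)); rewrite [h * _]mulrC => H.
apply: has_sum_nm_le H => B uB.
have r2p : 0 < r ^+ 2 by rewrite exprn_gt0.
rewrite mulrAC ler_pdivlMr// mulr_suml.
apply: le_trans (ler_wpM2r (sqr_ge0 (nm h)) (hMB B uB)).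
rewrite mulr_suml; apply: ler_sum => n _.
have := pow_taylor n r0 zr (ltW rw); rewrite [w + h - w]addrC addKr => pt.
rewrite (_ : c n * (w + h) ^+ n - c n * w ^+ n - h * (c n * (n%:R * w ^+ n.-1)) =
   c n * ((w + h) ^+ n - w ^+ n - n%:R * w ^+ n.-1 * h)); last ring.
rewrite (nmM (c n)) -[leRHS]mulrA -[leLHS]mulrA ler_wpM2l ?nm_ge0// [leLHS]mulrC.
exact: pt.
Qed.

Lemma qdiff_derivable (F : C -> C) w L : qdiff F w L -> derivable (F : CC R -> CC R) (w : CC R) 1.
Proof.
move=> [M [d [M0 d0 hF]]]; apply/cvg_ex; exists (L : CC R).
apply/cvgrPdist_le => /= eps eps0.
have [r r0 er] : exists2 r : R, 0 < r & eps = (r%:C)%C.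
  by case: eps eps0 => a b; rewrite ltcE /= => /andP[/eqP -> a0]; exists a.
pose d' := Num.min (d / 2) (r / (M + 1)).
have d'0 : 0 < d' by rewrite lt_min divr_gt0//= divr_gt0//; lra.
near=> h.
have h0 : (h : CC R) != 0 by near: h; exact: (@nbhs_dnbhs_neq (CC R) 0).
have hd : `|h| <= ((d'%:C)%C : CC R).
  by near: h; apply: (@dnbhs0_le (CC R) (CC R)); rewrite ltcR.
have nhd : nm h <= d' by move: hd; rewrite nmE lecR.
have hn0 : 0 < nm h by rewrite nm_gt0.
have hN : nm (L - h^-1 * (F (w + h) - F w)) <= r.
  have aux (x y : C) : x != 0 -> L - x^-1 * y = - (x^-1 * (y - L * x)).
    by move=> x0; field.
  rewrite aux//.
  rewrite nmN nmM nmV mulrC ler_pdivrMr//.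
  have hd2 : nm h < d by apply: le_lt_trans nhd _; rewrite gt_min; apply/orP; left; lra.
  apply: le_trans (hF h hd2) _; rewrite expr2 mulrA ler_wpM2r ?nm_ge0//.
  have : nm h <= r / (M + 1) by apply: le_trans nhd _; rewrite ge_min lexx orbT.
  rewrite ler_pdivlMr; last lra.
  have := nm_ge0 h; nra.
rewrite er; have -> : h%:A = h by rewrite /GRing.scale /= mulr1.
rewrite [h + w]addrC -[`|_|]/((nm (L - h^-1 * (F (w + h) - F w)))%:C)%C.
by rewrite lecR.
Unshelve. all: by end_near.
Qed.

Lemma cvs_cvg (u : nat -> C) (l : C) : cvs u l -> ((u : nat -> CC R) @ \oo --> (l : CC R))%classic.
Proof.
move=> hu; apply/cvgrPdist_le => /= eps eps0.
have [r r0 er] : exists2 r : R, 0 < r & eps = (r%:C)%C.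
  by case: eps eps0 => a b; rewrite ltcE /= => /andP[/eqP -> a0]; exists a.
have [N hN] := hu r r0; exists N => // n /= Nn.
by rewrite er nmE lecR nmB hN.
Qed.

Lemma pochinf_pol (a b : C) : nm b < 1 -> pochinf (a : CC R) b = pol a b.
Proof.
move=> b1; apply/cvg_lim => //.
exact: cvs_cvg (polP a b1).
Qed.
End QuadraticDiff.

(** * Lattice sums under a change of basis *)

Section Lattice.
Variable R : realType.
Local Notation C := R[i].
Local Notation e := (@e2pi R : C -> C).
Implicit Types s t z x u v T : C.

Lemma Re_real_mul (r : R) z : complex.Re (r%:C%C * z) = r * complex.Re z.
Proof. by case: z => a b /=; rewrite mul0r subr0. Qed.

Lemma Im_real_mul (r : R) z : complex.Im (r%:C%C * z) = r * complex.Im z.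
Proof. by case: z => a b /=; rewrite mul0r addr0. Qed.

Lemma Im_int_mul (n : int) z : complex.Im (n%:~R * z) = n%:~R * complex.Im z.
Proof. by rewrite -(rmorph_int (real_complex R)) Im_real_mul. Qed.

Lemma Im_intr (n : int) : complex.Im (n%:~R : C) = 0.
Proof. by rewrite -(rmorph_int (real_complex R)). Qed.

Lemma Re_intr (n : int) : complex.Re (n%:~R : C) = n%:~R.
Proof. by rewrite -(rmorph_int (real_complex R)). Qed.

Lemma nm_e2pi_lt1 T : 0 < complex.Im T -> nm (e T) < 1.
Proof. by move=> h; rewrite nm_e2pi expR_lt1 oppr_lt0 !mulr_gt0// pi_gt0. Qed.

Definition lterm T u (mn : int * int) : C := u + mn.1%:~R * T + mn.2%:~R.

(** As 0 < a < 1, the coordinate m + a is at least d (|m| + 1) in modulus. The imaginary part of the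
    term controls m + a, and the triangle inequality then controls n. The size |m| + 1 + |n| is the
    one in [inv_cube_le_pow32V]. *)
Lemma lterm_lower T (a : R) : 0 < complex.Im T -> 0 < a < 1 ->
  exists k : R, 0 < k /\ forall mn, k * (`|mn.1|.+1 + `|mn.2|)%:R <= nm (lterm T (a%:C%C * T) mn).
Proof.
move=> T0 /andP[a0 a1]; set y := complex.Im T in T0.
pose d := Num.min a (1 - a) / 2.
have d0 : 0 < d by rewrite divr_gt0// lt_min a0 subr_gt0.
have da : 2 * d <= a by rewrite /d mulrC divfK// ge_min lexx.
have da' : 2 * d <= 1 - a by rewrite /d mulrC divfK// ge_min lexx orbT.
(* For a term of modulus L, |m + a| <= L / y and |n| <= L + |m + a| |T|; these add up to at most L
   K. *)
pose K := y^-1 + 1 + nm T / y.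
have K0 : 0 < K.
  have : 0 < y^-1 by rewrite invr_gt0.
  have : 0 <= nm T / y by rewrite divr_ge0 ?nm_ge0// ltW.
  by rewrite /K; lra.
exists (d / K); split=> [|[m n]]; first by rewrite divr_gt0.
rewrite /lterm /=; set L := nm _.
have hX : d * (`|m|.+1)%:R <= `|m%:~R + a|.
  case: m {L} => [m|m] /=.
    rewrite -[m%:~R]/(m%:R) ger0_norm ?addr_ge0// ?ltW// -natr1.
    have : 0 <= m%:R :> R by []. by nra.
  rewrite NegzE mulrNz -[m.+1%:~R]/(m.+1%:R) ler0_norm ?opprB; last first.
    by have : 0 <= m%:R :> R by []; rewrite -natr1; lra.
  rewrite -[m.+2%:R]natr1 -natr1; have : 0 <= m%:R :> R by []; by nra.
have hz : a%:C%C * T + m%:~R * T + n%:~R = (m%:~R + a)%:C%C * T + n%:~R.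
  by rewrite rmorphD rmorph_int /=; ring.
have h1 : `|m%:~R + a| * y <= L.
  have := nm_Im (a%:C%C * T + m%:~R * T + n%:~R); rewrite -/L hz raddfD /= Im_intr addr0.
  by rewrite Im_real_mul normrM (gtr0_norm T0).
have h2 : `|n|%:R <= L + `|m%:~R + a| * nm T.
  have : nm (n%:~R : C) <= L + nm ((m%:~R + a)%:C%C * T).
    rewrite /L hz; apply: le_trans (nm_leD _ _).
    by rewrite addrAC subrr add0r.
  by rewrite nm_int nmM nm_real -abszE.
have n0 := nm_ge0 T.
have h3 : `|m%:~R + a| <= L / y by rewrite ler_pdivlMr.
have h4 : `|m%:~R + a| + `|n|%:R <= L * K.
  have -> : L * K = L / y + L + L / y * nm T by rewrite /K; ring.
  have := ler_wpM2r n0 h3; lra.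
rewrite mulrAC ler_pdivrMr// natrD mulrDr; apply: le_trans h4.
apply: lerD => //; rewrite ler_piMl//; lra.
Qed.

(** For two lattice terms with the same indices B - A is constant, so three inverse factors remain:
    the gain that makes the lattice sum of differences absolutely convergent. *)
Lemma inv_sqr_sub (A B : C) : A != 0 -> B != 0 ->
  nm (A ^- 2 - B ^- 2) <= nm (B - A) * ((nm A)^-1 * (nm B)^-1 ^+ 2 + (nm A)^-1 ^+ 2 * (nm B)^-1).
Proof.
move=> A0 B0.
have -> : A ^- 2 - B ^- 2 = (B - A) * (A^-1 * B^-1 ^+ 2 + A^-1 ^+ 2 * B^-1).
  by field; rewrite A0 B0.
rewrite nmM ler_wpM2l ?nm_ge0//; apply: le_trans (nmD _ _) _.
rewrite (nmM A^-1) (nmM (A^-1 ^+ 2)) !nmXn !nmV; exact: lexx.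
Qed.

Lemma lattice_summ T (a b : R) : 0 < complex.Im T -> 0 < a < 1 -> 0 < b < 1 ->
  summ (fun mn => nm (lterm T (a%:C%C * T) mn ^- 2 - lterm T (b%:C%C * T) mn ^- 2)).
Proof.
move=> T0 ha hb.
have [k [k0 hk]] := lterm_lower T0 ha; have [l [l0 hl]] := lterm_lower T0 hb.
pose M := nm ((b - a)%:C%C * T) * (k^-1 * l^-1 ^+ 2 + k^-1 ^+ 2 * l^-1).
have M0 : 0 <= M.
  by rewrite mulr_ge0 ?nm_ge0// addr_ge0// mulr_ge0 ?exprn_ge0 ?invr_ge0// ltW.
apply: summ_le (summZ M0 (summ_prod (fun i => pow32V_ge0 R `|i|) (fun i => pow32V_ge0 R `|i|)
  (summ_pow32V_int R) (summ_pow32V_int R))) => mn.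
have := hk mn; have := hl mn; move: (lterm_lower).
set N : R := (_ + _)%:R => _ hlN hkN.
have N0 : 0 < N by rewrite ltr0n addSn.
have kN : 0 < k * N by rewrite mulr_gt0.
have lN : 0 < l * N by rewrite mulr_gt0.
have A0 : lterm T (a%:C%C * T) mn != 0 by rewrite -nm_gt0 (lt_le_trans kN).
have B0 : lterm T (b%:C%C * T) mn != 0 by rewrite -nm_gt0 (lt_le_trans lN).
apply: le_trans (inv_sqr_sub A0 B0) _.
have -> : lterm T (b%:C%C * T) mn - lterm T (a%:C%C * T) mn = (b - a)%:C%C * T.
  by rewrite /lterm rmorphB; ring.
rewrite /M -mulrA ler_wpM2l ?nm_ge0//.
apply: le_trans (_ : (k^-1 * l^-1 ^+ 2 + k^-1 ^+ 2 * l^-1) * (N ^+ 3)^-1 <= _); last first.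
  rewrite ler_wpM2l ?inv_cube_le_pow32V// addr_ge0// mulr_ge0 ?exprn_ge0 ?invr_ge0// ltW//.
have hA : (nm (lterm T (a%:C%C * T) mn))^-1 <= (k * N)^-1.
  by rewrite lef_pV2 ?posrE ?nm_gt0.
have hB : (nm (lterm T (b%:C%C * T) mn))^-1 <= (l * N)^-1.
  by rewrite lef_pV2 ?posrE ?nm_gt0.
apply: le_trans (_ : (k * N)^-1 * (l * N)^-1 ^+ 2 + (k * N)^-1 ^+ 2 * (l * N)^-1 <= _).
  by apply: lerD; apply: ler_pM; rewrite ?lerXn2r ?nnegrE ?exprn_ge0 ?invr_ge0 ?nm_ge0 ?(ltW kN) ?(ltW lN)//.
rewrite le_eqVlt; apply/orP; left; apply/eqP.
by field; rewrite !gt_eqF.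
Qed.

Lemma lterm_off_lattice T w : (forall mn, lterm T w mn != 0) -> off_lattice (e T) (e w).
Proof.
move=> hw; split=> [|k]; first exact: e2pi_neq0.
apply/eqP; rewrite -e2piXz => h.
have : e (w - k%:~R * T) = 1 by rewrite e2piD h -e2piD subrr e2pi0.
move=> /e2pi_eq1[n hn]; have /eqP[] := hw (- k, - n).
by rewrite /lterm /= !mulrNz mulNr hn subrr.
Qed.

Lemma lattice_sum T u v : 0 < complex.Im T ->
  (forall mn, lterm T u mn != 0) -> (forall mn, lterm T v mn != 0) ->
  summ (fun mn => nm (lterm T u mn ^- 2 - lterm T v mn ^- 2)) ->
  has_sum (fun mn => lterm T u mn ^- 2 - lterm T v mn ^- 2)
     (tpi R ^+ 2 * (ssum (e T) (e u) - ssum (e T) (e v))).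
Proof.
move=> T0 hu hv hs; have p1 := nm_e2pi_lt1 T0; have p0 := e2pi_neq0 T.
have [l hl] := summ_has_sum hs.
have hrow w m : (forall mn, lterm T w mn != 0) ->
    has_sum (fun n : int => lterm T w (m, n) ^- 2) (tpi R ^+ 2 * wfun (e T ^ m * e w)).
  by move=> hw; have := @lipschitz R (w + m%:~R * T) (fun n => hw (m, n)); rewrite e2piD e2piXz (mulrC (e w)).
have := has_sum_rows hl (fun m => has_sumB (hrow u m hu) (hrow v m hv)) => h1.
have := has_sumZ (tpi R ^+ 2)
  (has_sumB (ssumP p0 p1 (lterm_off_lattice hu)) (ssumP p0 p1 (lterm_off_lattice hv))) => h2.
rewrite (_ : _ * _ = l) //.
by apply: has_sum_uniq h2 _; apply: has_sum_ext h1 => m; rewrite mulrBr.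
Qed.
End Lattice.

(** * The action of SL2(Z) on differences of S *)

Section Modular.
Variable R : realType.
Local Notation C := R[i].
Local Notation e := (@e2pi R : C -> C).
Implicit Types t z u v T : C.

(** Hermite normal form: the lattice spanned by 10(a t + b) and c t + d has the basis g t + B, D
    with g = gcd(10 a, c), the unimodular matrix being made of Bezout coefficients and cofactors.
    Determinants give g D = 10. *)
Lemma cusp_basis (a b c d : int) : a * d - b * c = 1 ->
  exists g D B x1 x2 x3 x4 : int, [/\ 0 < g, 0 < D, g * D = 10 & x1 * x4 - x2 * x3 = 1] /\
   [/\ x1 * (10 * a) + x2 * c = g, x1 * (10 * b) + x2 * d = B,
       x3 * (10 * a) + x4 * c = 0, x3 * (10 * b) + x4 * d = D & (10 %| c)%Z -> g = 10].
Proof.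
move=> h; have [u [v huv]] := Bezoutz (10 * a) c.
set g := gcdz (10 * a) c in huv *.
have g0 : 0 < g.
  rewrite lt_def; apply/andP; split=> //; rewrite gcdz_eq0; apply/negP => /andP[/eqP a0 /eqP c0].
  move: h; rewrite c0 mulr0 subr0; have -> : a = 0 by lia.
  by rewrite mul0r.
have /dvdzP[A hA] : (g %| 10 * a)%Z := dvdz_gcdl _ _.
have /dvdzP[G hG] : (g %| c)%Z := dvdz_gcdr _ _.
have gn0 : g != 0 by rewrite gt_eqF.
have hD : g * (- G * (10 * b) + A * d) = 10.
  have e1 : g * A * d - g * G * (10 * b) = 10.
    by rewrite (mulrC g A) (mulrC g G) -hA -hG; lia.
  by rewrite -[RHS]e1; ring.
have D0 : 0 < - G * (10 * b) + A * d by rewrite -(pmulr_rgt0 _ g0) hD.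
exists g, (- G * (10 * b) + A * d), (u * (10 * b) + v * d), u, v, (- G), A; do 2! split => //.
- apply: (mulfI gn0); rewrite mulr1.
  rewrite (_ : g * _ = u * (A * g) + v * (G * g)); last ring.
  by rewrite -hA -hG.
- by rewrite hA hG; ring.
- move=> c10; have : (10 %| g)%Z by rewrite dvdz_gcd c10 andbT dvdz_mulr.
  move=> /dvdzP[m hm]; move: hD D0 g0; rewrite hm; move: (- G * (10 * b) + A * d) => D hD D0 g0.
  have m0 : 0 < m by lia.
  have : m <= m * D by rewrite ler_peMr// ltW.
  by lia.
Qed.

Lemma denom_neq0 (a b c d : int) t : a * d - b * c = 1 -> 0 < complex.Im t ->
  c%:~R * t + d%:~R != 0.
Proof.
move=> h t0; apply/eqP => h0.
have : complex.Im (c%:~R * t + d%:~R) = 0 by rewrite h0.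
rewrite raddfD /= Im_intr addr0 Im_int_mul => /eqP; rewrite mulf_eq0 (gt_eqF t0) orbF intr_eq0.
move=> /eqP c0; move: h0 h; rewrite c0 mul0r add0r mulr0 subr0 => /eqP.
by rewrite intr_eq0 => /eqP ->; rewrite mulr0.
Qed.

Lemma Im_mobius_gt0 (a b c d : int) t : a * d - b * c = 1 -> 0 < complex.Im t ->
  0 < complex.Im (mobius a b c d t : C).
Proof.
move=> h t0; have den0 := denom_neq0 h t0.
have : mobius a b c d t * (c%:~R * t + d%:~R) = a%:~R * t + b%:~R :> C.
  by rewrite /mobius divfK.
move: den0; move: (mobius a b c d t : C) => z; rewrite -nm_gt0 => den0.
have : 0 < nm (c%:~R * t + d%:~R) ^+ 2 by rewrite exprn_gt0.
rewrite nm_sqr !raddfD /= !Im_intr !Re_intr !addr0 !Im_int_mul.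
rewrite -!(rmorph_int (real_complex R)) !Re_real_mul.
case: t t0 {den0} => x y /= y0; case: z => X Y /= den [] h1 h2.
have hr : a%:~R * d%:~R - b%:~R * c%:~R = 1 :> R by rewrite -!intrM -intrB h.
rewrite -(pmulr_lgt0 _ den); move: h1 h2; rewrite ?mul0r ?subr0 ?addr0 => h1 h2.
have -> : Y * ((c%:~R * x + d%:~R) ^+ 2 + (c%:~R * y) ^+ 2) =
    (X * (c%:~R * y) + Y * (c%:~R * x + d%:~R)) * (c%:~R * x + d%:~R) -
    (X * (c%:~R * x + d%:~R) - Y * (c%:~R * y)) * (c%:~R * y) by ring.
rewrite h1 h2 (_ : _ - _ = y * (a%:~R * d%:~R - b%:~R * c%:~R)); last ring.
by rewrite hr mulr1.
Qed.

Definition sdiff T u v : C := ssum (e T) (e u) - ssum (e T) (e v).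

Lemma tenth_lt1 (k : nat) : (0 < k < 10)%N -> 0 < (k%:R / 10 : R) < 1.
Proof.
move=> /andP[k0 k1]; rewrite divr_gt0 ?ltr0n//= ltr_pdivrMr ?mul1r ?ltr_nat//.
Qed.

Lemma tenth_mul (k : nat) z : ((k%:R / 10 : R))%:C%C * (10 * z) = k%:R * z.
Proof.
by rewrite fmorph_div !rmorph_nat mulrA divfK// pnatr_eq0.
Qed.

Lemma lterm_tenth_neq0 (k : nat) z mn : (0 < k < 10)%N -> 0 < complex.Im z ->
  lterm (10 * z) (k%:R * z) mn != 0.
Proof.
move=> /tenth_lt1 hk z0.
have T0 : 0 < complex.Im (10 * z) by rewrite (Im_int_mul 10) mulr_gt0.
have [K [K0 hK]] := lterm_lower T0 hk.
rewrite -nm_gt0; apply: lt_le_trans (_ : K * (`|mn.1|.+1 + `|mn.2|)%:R <= _).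
  by rewrite mulr_gt0// ltr0n addSn.
by rewrite -[k%:R * z]tenth_mul; exact: hK.
Qed.

(** Let z be the image of t and w = c t + d. Scaling by w/D carries Z + 10 z Z onto Z + T Z and k z
    to k u. The sum of inverse squares has degree -2, hence the factor (w/D)^2, the same for all k
    and l. *)
Lemma sdiff_modular (a b c d g D B x1 x2 x3 x4 : int) (k l : nat) t :
  a * d - b * c = 1 -> 0 < g -> 0 < D -> x1 * x4 - x2 * x3 = 1 ->
  x1 * (10 * a) + x2 * c = g -> x1 * (10 * b) + x2 * d = B ->
  x3 * (10 * a) + x4 * c = 0 -> x3 * (10 * b) + x4 * d = D ->
  0 < complex.Im t -> (0 < k < 10)%N -> (0 < l < 10)%N ->
  let T := (g%:~R * t + B%:~R) / D%:~R in let u := (a%:~R * t + b%:~R) / D%:~R in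
  [/\ off_lattice (e T) (e (k%:R * u)), off_lattice (e T) (e (l%:R * u)) &
   sdiff (10 * mobius a b c d t) (k%:R * mobius a b c d t) (l%:R * mobius a b c d t) =
   ((c%:~R * t + d%:~R) / D%:~R) ^+ 2 * sdiff T (k%:R * u) (l%:R * u)].
Proof.
move=> h g0 D0 hx e1 e2 e3 e4 t0 hk hl T' u0.
have z0 := Im_mobius_gt0 h t0; have den0 := denom_neq0 h t0.
have num : mobius a b c d t * (c%:~R * t + d%:~R) = a%:~R * t + b%:~R :> C.
  by rewrite /mobius divfK.
move: z0 num; move: (mobius a b c d t : C) => z z0 num.
have Dn0 : D%:~R != 0 :> C by rewrite intr_eq0 gt_eqF.
set w := c%:~R * t + d%:~R in num den0 *.
have T'0 : 0 < complex.Im T'.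
  have : D%:~R * T' = g%:~R * t + B%:~R by rewrite mulrC divfK.
  move=> /(congr1 (@complex.Im R)); rewrite raddfD /= !Im_int_mul Im_intr addr0 => hI.
  by rewrite -(pmulr_rgt0 _ (_ : 0 < D%:~R)) ?ltr0z// hI mulr_gt0// ltr0z.
have T0 : 0 < complex.Im (10 * z) by rewrite (Im_int_mul 10) mulr_gt0.
(* The change of basis on coordinates; determinant 1 makes [H'] its inverse. *)
pose H (mn : int * int) := (mn.1 * x1 + mn.2 * x3, mn.1 * x2 + mn.2 * x4).
pose H' (mn : int * int) := (mn.1 * x4 - mn.2 * x3, mn.2 * x1 - mn.1 * x2).
have HK : cancel H H'.
  move=> [m n]; rewrite /H /H' /=; congr pair.
    by rewrite -[RHS]mulr1 -hx; ring.
  by rewrite -[RHS]mulr1 -hx; ring.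
have KH : cancel H' H.
  move=> [m n]; rewrite /H /H' /=; congr pair.
    by rewrite -[RHS]mulr1 -hx; ring.
  by rewrite -[RHS]mulr1 -hx; ring.
have hT (j : nat) mn : lterm (10 * z) (j%:R * z) (H mn) = (D%:~R / w) * lterm T' (j%:R * u0) mn.
  case: mn => m n; rewrite /lterm /H /=.
  have zE : z = (a%:~R * t + b%:~R) / w by rewrite -num mulfK.
  have E1 : g%:~R = x1%:~R * (10 * a%:~R) + x2%:~R * c%:~R :> C by rewrite -e1 !(intrD, intrM).
  have E2 : B%:~R = x1%:~R * (10 * b%:~R) + x2%:~R * d%:~R :> C by rewrite -e2 !(intrD, intrM).
  have E3 : x3%:~R * (10 * a%:~R) + x4%:~R * c%:~R = 0 :> C.
    by rewrite -[RHS]/(0%:~R) -e3 !(intrD, intrM).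
  have E4 : D%:~R = x3%:~R * (10 * b%:~R) + x4%:~R * d%:~R :> C by rewrite -e4 !(intrD, intrM).
  apply: (mulIf den0).
  have -> : D%:~R / w * (j%:R * u0 + m%:~R * T' + n%:~R) * w =
     j%:R * (a%:~R * t + b%:~R) + m%:~R * (g%:~R * t + B%:~R) + n%:~R * D%:~R.
    by rewrite /u0 /T'; field; rewrite den0 Dn0.
  have -> : (j%:R * z + (m * x1 + n * x3)%:~R * (10 * z) + (m * x2 + n * x4)%:~R) * w =
     j%:R * (z * w) + (m * x1 + n * x3)%:~R * (10 * (z * w)) + (m * x2 + n * x4)%:~R * w by ring.
  rewrite num E1 E2 E4 /w !(intrD, intrM).
  transitivity (j%:R * (a%:~R * t + b%:~R) + m%:~R * ((x1%:~R * (10 * a%:~R) + x2%:~R * c%:~R) * t +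
    (x1%:~R * (10 * b%:~R) + x2%:~R * d%:~R)) + n%:~R * (x3%:~R * (10 * b%:~R) + x4%:~R * d%:~R) +
    n%:~R * (x3%:~R * (10 * a%:~R) + x4%:~R * c%:~R) * t); first by ring.
  by rewrite E3; ring.
have hS := lattice_summ T0 (tenth_lt1 hk) (tenth_lt1 hl); rewrite !tenth_mul in hS.
have nz1 (j : nat) mn : (0 < j < 10)%N -> lterm (10 * z) (j%:R * z) mn != 0.
  by move=> hj; apply: lterm_tenth_neq0.
have nz2 (j : nat) mn : (0 < j < 10)%N -> lterm T' (j%:R * u0) mn != 0.
  by move=> hj; have := nz1 j (H mn) hj; rewrite hT mulf_eq0 negb_or => /andP[].
have L1 := lattice_sum T0 (fun mn => nz1 k mn hk) (fun mn => nz1 l mn hl) hS.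
have q0 : D%:~R / w != 0 by rewrite mulf_neq0 ?invr_eq0.
have hE mn : lterm T' (k%:R * u0) mn ^- 2 - lterm T' (l%:R * u0) mn ^- 2 =
   (D%:~R / w) ^+ 2 * (lterm (10 * z) (k%:R * z) (H mn) ^- 2 - lterm (10 * z) (l%:R * z) (H mn) ^- 2).
  rewrite !hT; move: (nz2 k mn hk) (nz2 l mn hl) q0.
  move: (lterm T' (k%:R * u0) mn) (lterm T' (l%:R * u0) mn) (D%:~R / w) => A E q A0 E0 q0.
  by field; rewrite A0 E0 q0.
have hS' : summ (fun mn => nm (lterm T' (k%:R * u0) mn ^- 2 - lterm T' (l%:R * u0) mn ^- 2)).
  apply: summ_le (summZ (nm_ge0 ((D%:~R / w) ^+ 2)) (summ_inj (can_inj HK) hS)) => mn.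
  by rewrite hE nmM.
have L2 := lattice_sum T'0 (fun mn => nz2 k mn hk) (fun mn => nz2 l mn hl) hS'.
have L3 := has_sumZ ((D%:~R / w) ^+ 2) (has_sum_bij HK KH L1).
split; [exact: lterm_off_lattice (fun mn => nz2 k mn hk)|exact: lterm_off_lattice (fun mn => nz2 l mn hl)|].
have := has_sum_uniq (has_sum_ext (fun mn => hE mn) L2) L3.
rewrite -/(sdiff _ _ _) -/(sdiff (10 * z) _ _).
move: (sdiff _ _ _) (sdiff _ _ _) (tpi_neq0 R) => S1 S2; move: (tpi R) => p p0 hp.
move: p0 den0 Dn0 hp; clear; move: w (D%:~R : C) => w' D' p0 w0 D'0 hp.
transitivity ((w' / D') ^+ 2 * (p ^- 2 * ((D' / w') ^+ 2 * (p ^+ 2 * S1)))).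
  by field; rewrite w0 D'0 p0.
by rewrite -hp; field; rewrite ?w0 ?D'0 ?p0.
Qed.
End Modular.

(** * Level 10 *)

Section LevelTen.
Variable R : realType.
Local Notation C := R[i].

Lemma theta_inv (p x : C) : nm p < 1 -> x != 0 -> theta p x^-1 = - x^-1 * theta p x.
Proof.
move=> p1 x0; rewrite /theta (polS p1 x) (polS p1 x^-1) invrK (mulrC x p) (mulrC x^-1 p).
by move: (pol _ _) (pol _ _) => a b; field.
Qed.

Variables (r : C).
Hypotheses (r0 : r != 0) (r1 : nm r < 1).
Let q := r ^+ 2.
Let p := q ^+ 10.

Let q0 : q != 0. Proof. by rewrite expf_neq0. Qed.
Let p0 : p != 0. Proof. by rewrite !expf_neq0. Qed.
Let nm_expS (a : C) n : nm a < 1 -> nm (a ^+ n.+1) < 1.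
Proof. by move=> a1; rewrite exprS nm_expr_lt1. Qed.
Let q1 : nm q < 1. Proof. exact: nm_expS. Qed.
Let p1 : nm p < 1. Proof. exact: nm_expS. Qed.

(** The bracket [k] of the overview; r is a square root of q, so that the three-term relation can be
    used at half-integer powers of q. *)
Definition theta10 (k : nat) : C := theta ((r ^+ 2) ^+ 10) ((r ^+ 2) ^+ k).
Local Notation th := theta10.

Lemma theta10_sym k : (k <= 10)%N -> th (10 - k) = th k.
Proof.
move=> k10; rewrite -[RHS](theta_V p0); congr (theta _ _).
have -> : p = q ^+ (10 - k) * q ^+ k by rewrite -exprD subnK.
by rewrite mulfK// expf_neq0.
Qed.

Let th6 : th 6 = th 4. Proof. exact: (@theta10_sym 4). Qed.
Let th7 : th 7 = th 3. Proof. exact: (@theta10_sym 3). Qed.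
Let th8 : th 8 = th 2. Proof. exact: (@theta10_sym 2). Qed.
Let th9 : th 9 = th 1. Proof. exact: (@theta10_sym 1). Qed.

Lemma theta10_opp k : theta p (q ^- k) = - q ^- k * th k.
Proof. by rewrite theta_inv// expf_neq0. Qed.

Lemma off_lattice10 k : (0 < k < 10)%N -> off_lattice p (q ^+ k).
Proof.
move=> /andP[k0 k1]; split=> [|j]; first by rewrite expf_neq0.
apply/eqP => h.
have : nm q ^ (10 * j - k%:Z) = 1.
  rewrite -nmXz expfzDr// -exprnN h /p exprnP exprz_exp mulfV ?nm1//.
  by rewrite expfz_neq0.
have nq0 : 0 < nm q by rewrite nm_gt0.
have [n hn] : exists n : int, n = 10 * j - k%:Z by eexists.
rewrite -hn.
have lt1 m : nm q ^+ m.+1 < 1 by rewrite -nmXn nm_expS.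
case: n hn => [[|n]|n] hn.
- by move: hn k0 k1; lia.
- by rewrite -exprnP => e; have := lt1 n; rewrite e ltxx.
- by rewrite NegzE -exprnN => /(congr1 GRing.inv); rewrite invrK invr1 => e; have := lt1 n; rewrite e ltxx.
Qed.

Lemma theta10_neq0 k : (0 < k < 10)%N -> th k != 0.
Proof. by move=> /off_lattice10[h1 h2]; apply: theta_neq0. Qed.

Lemma thetaF_le i j : (j <= i)%N -> thetaF p (r ^+ i) (r ^+ j) =
  theta p (r ^+ (i + j)) * theta p (r ^+ (i - j)) / r ^+ i.
Proof.
move=> ij; rewrite /thetaF exprD; congr (_ * theta _ _ / _).
by rewrite -{1}(subnK ij) exprD mulfK// expf_neq0.
Qed.

Lemma thetaF_ge i j : (i <= j)%N -> thetaF p (r ^+ i) (r ^+ j) =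
  theta p (r ^+ (i + j)) * theta p (r ^- (j - i)) / r ^+ i.
Proof.
move=> ij; rewrite /thetaF exprD; congr (_ * theta _ _ / _).
by rewrite -{1}(subnK ij) exprD; field; rewrite !expf_neq0.
Qed.

(** The points are q^(7/2), q^(1/2), q^(11/2), q^(3/2); sums and differences of these exponents are
    integers. Divided by q [1][2][3][4], the relation says 1/W - W = [5]^2 / (q [1][3]). *)
Lemma theta10_rel1 :
  th 3 ^+ 2 * th 4 ^+ 2 - q ^+ 2 * th 1 ^+ 2 * th 2 ^+ 2 = th 2 * th 4 * th 5 ^+ 2.
Proof.
have rn0 n : r ^+ n != 0 by rewrite expf_neq0.
have := thetaF_plucker p0 p1 (rn0 7%N) (rn0 1%N) (rn0 11%N) (rn0 3%N).
rewrite (thetaF_le (i := 7) (j := 1))// (thetaF_le (i := 11) (j := 3))//.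
rewrite (thetaF_ge (i := 7) (j := 11))// (thetaF_ge (i := 1) (j := 3))//.
rewrite (thetaF_le (i := 7) (j := 3))// (thetaF_ge (i := 1) (j := 11))//.
rewrite -[(7 + 1)%N]/(2 * 4)%N -[(7 - 1)%N]/(2 * 3)%N -[(11 + 3)%N]/(2 * 7)%N -[(11 - 3)%N]/(2 * 4)%N.
rewrite -[(7 + 11)%N]/(2 * 9)%N -[(11 - 7)%N]/(2 * 2)%N -[(1 + 3)%N]/(2 * 2)%N -[(3 - 1)%N]/(2 * 1)%N.
rewrite -[(7 + 3)%N]/(2 * 5)%N -[(7 - 3)%N]/(2 * 2)%N -[(1 + 11)%N]/(2 * 6)%N -[(11 - 1)%N]/(2 * 5)%N.
rewrite !(exprM r 2) -/q !theta10_opp -!/(th _) th7 th9 th6.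
rewrite /q; move: (th 1) (th 2) (th 3) (th 4) (th 5) => a b c d e h.
apply/eqP; rewrite -subr_eq0; apply/eqP.
(* The power 18 = 7 + 11 clears the divisor x z of the leading product f(x,y) f(z,w). *)
rewrite -[RHS](mulr0 (r ^+ 18)) -h; field; exact: r0.
Qed.

(** The points are q^3, q, q^6, q^2. Divided by q [1]^2 [3]^2, the relation gives 1/V - 1 the same
    value [5]^2 / (q [1][3]). *)
Lemma theta10_rel2 :
  th 2 ^+ 2 * th 4 ^+ 2 = th 1 * th 3 * th 5 ^+ 2 + q * th 1 ^+ 2 * th 3 ^+ 2.
Proof.
have rn0 n : r ^+ n != 0 by rewrite expf_neq0.
have := thetaF_plucker p0 p1 (rn0 6%N) (rn0 2%N) (rn0 12%N) (rn0 4%N).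
rewrite (thetaF_le (i := 6) (j := 2))// (thetaF_le (i := 12) (j := 4))//.
rewrite (thetaF_ge (i := 6) (j := 12))// (thetaF_ge (i := 2) (j := 4))//.
rewrite (thetaF_le (i := 6) (j := 4))// (thetaF_ge (i := 2) (j := 12))//.
rewrite -[(6 + 2)%N]/(2 * 4)%N -[(6 - 2)%N]/(2 * 2)%N -[(12 + 4)%N]/(2 * 8)%N -[(12 - 4)%N]/(2 * 4)%N.
rewrite -[(6 + 12)%N]/(2 * 9)%N -[(12 - 6)%N]/(2 * 3)%N -[(2 + 4)%N]/(2 * 3)%N -[(4 - 2)%N]/(2 * 1)%N.
rewrite -[(6 + 4)%N]/(2 * 5)%N -[(6 - 4)%N]/(2 * 1)%N -[(2 + 12)%N]/(2 * 7)%N -[(12 - 2)%N]/(2 * 5)%N.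
rewrite !(exprM r 2) -/q !theta10_opp -!/(th _) th8 th9 th7.
rewrite /q; move: (th 1) (th 2) (th 3) (th 4) (th 5) => a b c d e h.
apply/eqP; rewrite -subr_eq0; apply/eqP.
rewrite -[RHS](mulr0 (r ^+ 18)) -h; field; exact: r0.
Qed.

Lemma thetaF10 i j : (j <= i)%N -> thetaF p (q ^+ i) (q ^+ j) =
  th (i + j) * th (i - j) / q ^+ i.
Proof.
move=> ij; rewrite /thetaF -exprD -{2}(subnK ij) (exprD _ (i - j)) mulfK ?expf_neq0//.
Qed.

(** By [ssum_sub] each difference is a quotient of nonvanishing theta values, so V has neither zeros
    nor poles on H. *)
Lemma ssum_ratio :
  [/\ ssum p q - ssum p (q ^+ 3) != 0, ssum p (q ^+ 2) - ssum p (q ^+ 4) != 0 &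
   (ssum p (q ^+ 2) - ssum p (q ^+ 4)) / (ssum p q - ssum p (q ^+ 3)) =
    q * th 1 ^+ 2 * th 3 ^+ 2 / (th 2 ^+ 2 * th 4 ^+ 2)].
Proof.
have F1 k : thetaF p (q ^+ k) 1 = th k ^+ 2 / q ^+ k.
  by rewrite /thetaF mulr1 divr1 -expr2.
have K0 : pol p p ^+ 4 != 0 by rewrite expf_neq0// pol_pp_neq0.
have o k := @off_lattice10 k.
have t k := @theta10_neq0 k.
have E1 : ssum p (q ^+ 1) - ssum p (q ^+ 3) =
    th 4 * th 2 * q / (th 3 ^+ 2 * th 1 ^+ 2) * pol p p ^+ 4.
  rewrite (ssum_sub p0 p1 (o 3%N isT) (o 1%N isT)) !F1.
  rewrite thetaF10// -[(3 + 1)%N]/4%N -[(3 - 1)%N]/2%N.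
  move: (t 1%N isT) (t 2%N isT) (t 3%N isT) (t 4%N isT) q0; move: (th 1) (th 2) (th 3) (th 4) (pol p p) => a b c d f.
  by move: q => q' a0 b0 c0 d0 q'0; field; rewrite a0 c0 q'0.
have E2 : ssum p (q ^+ 2) - ssum p (q ^+ 4) = q ^+ 2 / (th 2 * th 4) * pol p p ^+ 4.
  rewrite (ssum_sub p0 p1 (o 4%N isT) (o 2%N isT)) !F1.
  rewrite thetaF10// -[(4 + 2)%N]/6%N -[(4 - 2)%N]/2%N th6.
  move: (t 1%N isT) (t 2%N isT) (t 3%N isT) (t 4%N isT) q0; move: (th 1) (th 2) (th 3) (th 4) (pol p p) => a b c d f.
  by move: q => q' a0 b0 c0 d0 q'0; field; rewrite b0 d0 q'0.
rewrite expr1 in E1; rewrite E1 E2.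
move: (t 1%N isT) (t 2%N isT) (t 3%N isT) (t 4%N isT) q0 K0.
move: (th 1) (th 2) (th 3) (th 4) (pol p p) => a b c d f a0 b0 c0 d0 q'0 f0.
have f0' : f != 0 by apply: contraNneq f0 => ->; rewrite expr0n.
split.
- by rewrite !mulf_neq0 ?invr_eq0 ?mulf_neq0 ?expf_neq0.
- by rewrite !mulf_neq0 ?invr_eq0 ?mulf_neq0 ?expf_neq0.
by move: q q'0 => q' q'0; field; rewrite a0 b0 c0 d0 q'0 f0'.
Qed.
End LevelTen.

(** * The function V on H: both identities and invariance under Gamma0(10) *)

Section Hauptmodul.
Variable R : realType.
Local Notation C := R[i].
Local Notation e := (@e2pi R : C -> C).
Implicit Types t z : C.

(** [haupt] is V in the form on which SL2(Z) acts; [hauptE] identifies it with the theta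
    quotient. *)
Definition haupt_den t := sdiff (10 * t) (1%:R * t) (3%:R * t).
Definition haupt_num t := sdiff (10 * t) (2%:R * t) (4%:R * t).
Definition haupt t := haupt_num t / haupt_den t.

Lemma hauptE t : 0 < complex.Im t ->
  let r := e (t / 2) in let th := theta10 r in
  [/\ haupt_den t != 0, haupt_num t != 0 &
  haupt t = e t * th 1%N ^+ 2 * th 3%N ^+ 2 / (th 2%N ^+ 2 * th 4%N ^+ 2)].
Proof.
move=> t0 r th.
have r0 : r != 0 := e2pi_neq0 _.
have r1 : nm r < 1.
  apply: nm_e2pi_lt1; have -> : t / 2 = ((2^-1 : R)%:C)%C * t.
    by rewrite fmorphV rmorph_nat mulrC.
  by rewrite Im_real_mul mulr_gt0.
have r2 : r ^+ 2 = e t by rewrite -e2piXn mulrC divfK// pnatr_eq0.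
have := ssum_ratio r0 r1; rewrite -/th r2.
by rewrite /haupt /haupt_den /haupt_num /sdiff !e2piXn expr1.
Qed.

(** The algebra behind both identities, with Y for q^(1/4) and a, b, c, d, f for [1] to [5]. *)
Lemma rogers_identities (Y a b c d f : C) : Y != 0 -> a != 0 -> b != 0 -> c != 0 -> d != 0 ->
  c ^+ 2 * d ^+ 2 - (Y ^+ 4) ^+ 2 * a ^+ 2 * b ^+ 2 = b * d * f ^+ 2 ->
  b ^+ 2 * d ^+ 2 = a * c * f ^+ 2 + Y ^+ 4 * a ^+ 2 * c ^+ 2 ->
  let I := Y ^+ 3 * a / d in let J := Y * b / c in
  let V := Y ^+ 4 * a ^+ 2 * c ^+ 2 / (b ^+ 2 * d ^+ 2) in
  [/\ (I / J) ^+ 2 = V, I ^+ 4 + (J ^+ 4)^-1 = V^-1 - 2 + 3 * V &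
      J ^+ 4 + (I ^+ 4)^-1 = V ^- 3 - 2 * V ^- 2 + 3 * V^-1].
Proof.
move=> Y0 a0 b0 c0 d0 h1 h2 I J V.
pose W := Y ^+ 4 * a * b / (c * d).
have V0 : V != 0 by rewrite !mulf_neq0 ?invr_eq0 ?mulf_neq0 ?expf_neq0.
have W0 : W != 0 by rewrite !mulf_neq0 ?invr_eq0 ?mulf_neq0 ?expf_neq0.
have hWV : W^-1 - W = V^-1 - 1.
  have -> : W^-1 - W = (c ^+ 2 * d ^+ 2 - (Y ^+ 4) ^+ 2 * a ^+ 2 * b ^+ 2) / (Y ^+ 4 * a * b * c * d).
    by rewrite /W; field; rewrite a0 b0 c0 d0 Y0.
  have -> : V^-1 - 1 = (b ^+ 2 * d ^+ 2 - Y ^+ 4 * a ^+ 2 * c ^+ 2) / (Y ^+ 4 * a ^+ 2 * c ^+ 2).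
    by rewrite /V; field; rewrite a0 b0 c0 d0 Y0.
  by rewrite h1 h2; field; rewrite a0 b0 c0 d0 Y0.
have hI : I ^+ 4 = W ^+ 2 * V by rewrite /I /W /V; field; rewrite b0 c0 d0.
have hJ : J ^+ 4 = W ^+ 2 / V by rewrite /J /W /V; field; rewrite a0 b0 c0 d0 Y0.
have hS : W ^+ 2 + W ^- 2 = (V^-1 - 1) ^+ 2 + 2.
  by rewrite -hWV; field; rewrite W0.
split.
- by rewrite /I /J /V; field; rewrite b0 c0 d0 Y0.
- have -> : I ^+ 4 + (J ^+ 4)^-1 = V * (W ^+ 2 + W ^- 2).
    by rewrite hI hJ; move: (V) (W) V0 W0 => v w v0 w0; field; rewrite v0 w0.
  by rewrite hS; move: (V) V0 => v v0; field; rewrite v0.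
have -> : J ^+ 4 + (I ^+ 4)^-1 = (W ^+ 2 + W ^- 2) / V.
  by rewrite hI hJ; move: (V) (W) V0 W0 => v w v0 w0; field; rewrite v0 w0.
by rewrite hS; move: (V) V0 => v v0; field; rewrite v0.
Qed.

Lemma IJ_haupt t : 0 < complex.Im t ->
  [/\ ((Ifun t : C) / Jfun t) ^+ 2 = haupt t,
   (Ifun t : C) ^+ 4 + ((Jfun t : C) ^+ 4)^-1 = (haupt t)^-1 - 2 + 3 * haupt t &
   (Jfun t : C) ^+ 4 + ((Ifun t : C) ^+ 4)^-1 = (haupt t) ^- 3 - 2 * (haupt t) ^- 2 + 3 * (haupt t)^-1].
Proof.
move=> t0; have [_ _ ->] := hauptE t0.
set r := e (t / 2); set th := theta10 r.
have r0 : r != 0 := e2pi_neq0 _.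
have r1 : nm r < 1.
  apply: nm_e2pi_lt1; have -> : t / 2 = ((2^-1 : R)%:C)%C * t.
    by rewrite fmorphV rmorph_nat mulrC.
  by rewrite Im_real_mul mulr_gt0.
have r2 : r ^+ 2 = e t by rewrite -e2piXn mulrC divfK// pnatr_eq0.
pose Y : C := e (t / 4).
have Y4 : Y ^+ 4 = e t by rewrite -e2piXn mulrC divfK// pnatr_eq0.
have q1 : nm (e t ^+ 10) < 1 by rewrite -e2piXn; apply: nm_e2pi_lt1; rewrite (Im_int_mul 10) mulr_gt0.
have thE (k : nat) : (k <= 10)%N ->
    (pochinf (e t ^+ k : CC R) (e t ^+ 10) * pochinf (e t ^+ (10 - k) : CC R) (e t ^+ 10) : C) = th k.
  move=> k10; rewrite (pochinf_pol (e t ^+ k) q1) (pochinf_pol (e t ^+ (10 - k)) q1).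
  have -> : e t ^+ (10 - k) = e t ^+ 10 / e t ^+ k.
    by rewrite -{2}(subnK k10) exprD mulfK// expf_neq0// e2pi_neq0.
  by rewrite /th /theta10 /theta r2.
have q14 : qpow (1%:Q / 4%:Q) (t : CC R) = Y.
  rewrite /qpow /Y; congr e2pi; rewrite fmorph_div /= !ratr_int.
  by rewrite mulrC mul1r.
have q34 : qpow (3%:Q / 4%:Q) (t : CC R) = Y ^+ 3.
  rewrite /qpow /Y -e2piXn; congr e2pi; rewrite fmorph_div /= !ratr_int.
  by rewrite mulrAC mulrA.
have IE : (Ifun t : C) = Y ^+ 3 * th 1%N / th 4%N.
  rewrite /Ifun q34 -(thE 1%N); last by [].
  rewrite -(thE 4%N); last by [].
  by rewrite expr1.
have JE : (Jfun t : C) = Y * th 2%N / th 3%N.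
  rewrite /Jfun q14 -(thE 2%N); last by [].
  rewrite -(thE 3%N); last by [].
  reflexivity.
have Y0 : Y != 0 := e2pi_neq0 _.
have t1 := theta10_neq0 r0 r1 (isT : (0 < 1 < 10)%N).
have t2 := theta10_neq0 r0 r1 (isT : (0 < 2 < 10)%N).
have t3 := theta10_neq0 r0 r1 (isT : (0 < 3 < 10)%N).
have t4 := theta10_neq0 r0 r1 (isT : (0 < 4 < 10)%N).
have R1 := theta10_rel1 r0 r1; have R2 := theta10_rel2 r0 r1.
rewrite -/th in t1 t2 t3 t4 R1 R2.
rewrite IE JE -Y4; rewrite [r ^+ 2]r2 -Y4 in R1 R2.
move: Y0 t1 t2 t3 t4 R1 R2; clear.
move: Y (th 1) (th 2) (th 3) (th 4) (th 5) => Y' a b c d f Y0 a0 b0 c0 d0 R1 R2.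
exact: rogers_identities Y0 a0 b0 c0 d0 R1 R2.
Qed.
Lemma ssum_tenth (t : C) (n j : int) (m : nat) : 0 < complex.Im t -> (0 < m < 10)%N ->
  n = 10 * j + m%:Z -> ssum (e (10 * t)) (e (n%:~R * t)) = ssum (e (10 * t)) (e (m%:R * t)).
Proof.
move=> t0 hm ->; have z0 mn := lterm_tenth_neq0 mn hm t0.
have T0 : 0 < complex.Im (10 * t) by rewrite (Im_int_mul 10) mulr_gt0.
have -> : e ((10 * j + m%:Z)%:~R * t) = e (10 * t) ^ j * e (m%:R * t).
  rewrite -e2piXz -e2piD; congr e2pi.
  by rewrite (intrD _ (10 * j) m) (intrM _ 10 j); ring.
rewrite ssum_shift//; [exact: e2pi_neq0|exact: nm_e2pi_lt1|exact: lterm_off_lattice].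
Qed.

Lemma ssum_tenth_opp (t : C) (m k : nat) : 0 < complex.Im t -> (0 < m < 10)%N -> (m + k = 10)%N ->
  ssum (e (10 * t)) (e (m%:R * t)) = ssum (e (10 * t)) (e (k%:R * t)).
Proof.
move=> t0 hm mk; have z0 mn := lterm_tenth_neq0 mn hm t0.
have T0 : 0 < complex.Im (10 * t) by rewrite (Im_int_mul 10) mulr_gt0.
have hk : (0 < k < 10)%N by lia.
rewrite -(ssum_tenth (n := - m%:Z) (j := -1) t0 hk); last by lia.
rewrite mulrNz mulNr e2piN ssumV//; [exact: e2pi_neq0|exact: nm_e2pi_lt1|exact: lterm_off_lattice].
Qed.

(** Here g = 10 and D = 1, so the new lattice is Z + 10 t Z itself and k z goes to k a t up to an
    integer; periodicity and evenness of S reduce k a modulo 10 and modulo sign. *)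
Lemma haupt_Gamma0 (a b c d : int) t : a * d - b * c = 1 -> (10 %| c)%Z -> 0 < complex.Im t ->
  haupt (mobius a b c d t : C) = haupt t.
Proof.
move=> h c10 t0.
have [g [D [B [x1 [x2 [x3 [x4 [[g0 D0 gD hx] [e1 e2 e3 e4 /(_ c10) g10]]]]]]]]] := cusp_basis h.
have D1 : D = 1 by lia.
have den0 := denom_neq0 h t0.
have [_ _ k24] := sdiff_modular h g0 D0 hx e1 e2 e3 e4 t0 (isT : (0 < 2 < 10)%N) (isT : (0 < 4 < 10)%N).
have [_ _ k13] := sdiff_modular h g0 D0 hx e1 e2 e3 e4 t0 (isT : (0 < 1 < 10)%N) (isT : (0 < 3 < 10)%N).
rewrite /haupt /haupt_num /haupt_den.
rewrite k24 k13 g10 D1 !divr1.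
set w := c%:~R * t + d%:~R in den0 *.
have S k l : sdiff (10%:~R * t + B%:~R) (k%:R * (a%:~R * t + b%:~R)) (l%:R * (a%:~R * t + b%:~R)) =
    ssum (e (10 * t)) (e ((k%:Z * a)%:~R * t)) - ssum (e (10 * t)) (e ((l%:Z * a)%:~R * t)).
  have E (j : nat) : e (j%:R * (a%:~R * t + b%:~R)) = e ((j%:Z * a)%:~R * t).
    rewrite mulrDr e2piD -[j%:R * b%:~R]/((j%:Z)%:~R * b%:~R) -intrM e2pi_int mulr1.
    by congr e2pi; rewrite intrM mulrA.
  by rewrite /sdiff !E e2piD e2pi_int mulr1.
rewrite !S /sdiff.
(* a d is congruent to 1 modulo 10, so the residue of a is a unit. *)
have ar : exists (j : int) (m : nat), (m \in [:: 1; 3; 7; 9]%N) /\ a = 10 * j + m%:Z.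
  exists (a %/ 10)%Z, (absz (a %% 10)%Z).
  move: c10 h => /dvdzP[c' ->] h; split; last by lia.
  have hr : a * d - b * c' * 10 = 1 by rewrite -mulrA.
  have [r1 r2] : 0 <= (a %% 10)%Z /\ (a %% 10)%Z < 10 by lia.
  have ha : a = (a %/ 10)%Z * 10 + (a %% 10)%Z by lia.
  move: hr; rewrite {1}ha; move: (a %/ 10)%Z (a %% 10)%Z r1 r2 => j r r1 r2.
  have -> : (j * 10 + r) * d - b * c' * 10 = 10 * (j * d - b * c') + r * d by ring.
  move: (j * d - b * c') => X.
  by case: r r1 r2 => // -[|[|[|[|[|[|[|[|[|[|r]]]]]]]]]] // _ _; rewrite ?inE //=; lia.
have sc (k : nat) (m : nat) (m' : nat) (j : int) : (0 < m' < 10)%N -> (k * m = 10 * ((k * m) %/ 10) + m')%N ->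
   a = 10 * j + m%:Z ->
   ssum (e (10 * t)) (e ((k%:Z * a)%:~R * t)) = ssum (e (10 * t)) (e (m'%:R * t)).
  move=> hm' hk ha; apply: (@ssum_tenth t (k%:Z * a) (k%:Z * j + ((k * m) %/ 10)%N%:Z) m') => //.
  have : (k%:Z * m%:Z) = 10 * ((k * m) %/ 10)%N%:Z + m'%:Z by rewrite -PoszM {1}hk PoszD PoszM.
  by rewrite ha; lia.
have w2 : w ^+ 2 != 0 by rewrite expf_neq0.
have [j [m [hm ha]]] := ar.
have op (m1 m2 : nat) := fun h1 h2 => @ssum_tenth_opp t m1 m2 t0 h1 h2.
have cancelw (x y : C) : w ^+ 2 * x / (w ^+ 2 * y) = x / y by rewrite -mulf_div divff// mul1r.
have swap (x y x' y' : C) : (x - y) / (x' - y') = (y - x) / (y' - x').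
  by rewrite -(opprB y x) -(opprB y' x') invrN mulrNN.
rewrite cancelw; move: sc op hm ha swap; clear.
pose F (n : int) := ssum (e (10 * t)) (e (n%:~R * t)).
pose G (k : nat) := ssum (e (10 * t)) (e (k%:R * t)).
move=> sc op hm ha swap.
change ((F (2%:Z * a) - F (4%:Z * a)) / (F (1%:Z * a) - F (3%:Z * a)) =
  (G 2%N - G 4%N) / (G 1%N - G 3%N)).
have {}sc (k n n' : nat) (i : int) : (0 < n' < 10)%N -> (k * n = 10 * ((k * n) %/ 10) + n')%N ->
   a = 10 * i + n%:Z -> F (k%:Z * a) = G n' by exact: sc.
have {}op (m1 m2 : nat) : (0 < m1 < 10)%N -> (m1 + m2 = 10)%N -> G m1 = G m2 by exact: op.
move: F G sc op hm ha => F G sc op; rewrite !inE => /or4P[] /eqP -> ha.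
- by rewrite (sc 2%N _ 2%N _ _ _ ha)// (sc 4%N _ 4%N _ _ _ ha)// (sc 1%N _ 1%N _ _ _ ha)// (sc 3%N _ 3%N _ _ _ ha).
(* Residue 3: since 6 is equivalent to 4 and 9 to 1, both differences are reversed and the signs
   cancel. Residue 7 behaves in the same way. *)
- rewrite (sc 2%N _ 6%N _ _ _ ha)// (sc 4%N _ 2%N _ _ _ ha)// (sc 1%N _ 3%N _ _ _ ha)// (sc 3%N _ 9%N _ _ _ ha)//.
  by rewrite (op 6%N 4%N)// (op 9%N 1%N)// swap.
- rewrite (sc 2%N _ 4%N _ _ _ ha)// (sc 4%N _ 8%N _ _ _ ha)// (sc 1%N _ 7%N _ _ _ ha)// (sc 3%N _ 1%N _ _ _ ha)//.
  by rewrite (op 8%N 2%N)// (op 7%N 3%N)// swap.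
rewrite (sc 2%N _ 8%N _ _ _ ha)// (sc 4%N _ 6%N _ _ _ ha)// (sc 1%N _ 9%N _ _ _ ha)// (sc 3%N _ 7%N _ _ _ ha)//.
by rewrite (op 8%N 2%N)// (op 6%N 4%N)// (op 9%N 1%N)// (op 7%N 3%N).
Qed.
End Hauptmodul.

(** * Expansions of V at the cusps *)

Section Cusps.
Variable R : realType.
Local Notation C := R[i].
Local Notation e := (@e2pi R : C -> C).
Implicit Types t z Q : C.

Lemma wfun_lambert_disc (zeta xi : C) (A B : nat) : nm zeta = 1 -> nm xi = 1 ->
  (0 < A)%N -> (0 < B)%N -> exists f, disc_series f /\
  forall Q l, nm Q < 1 ->
    has_sum (fun n => wfun (zeta * Q ^+ A * (xi * Q ^+ B) ^+ n)) l -> f Q = l.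
Proof.
move=> z1 x1 A0 B0; have [f [hf hl]] := disc_series_lambert z1 x1 A0 B0.
exists f; split=> // Q l Q1 h; apply: has_sum_uniq (hl Q Q1) _; apply: has_sum_ext h => n.
by congr wfun; rewrite exprMn -exprM exprD; ring.
Qed.

(** Periodicity of S replaces n by its residue a modulo beta, at the price of a unimodular factor in
    [zeta']. The two half sums are then Lambert series with starting exponents a and beta - a. *)
Lemma ssum_disc_series (zeta xi : C) (n : int) (beta : nat) : nm zeta = 1 -> nm xi = 1 ->
  (0 < beta)%N -> exists f, disc_series f /\ forall Q, 0 < nm Q < 1 ->
  off_lattice (xi * Q ^+ beta) (zeta * Q ^ n) ->
  f Q = ssum (xi * Q ^+ beta) (zeta * Q ^ n).
Proof.
move=> z1 x1 b0; have xi0 : xi != 0 by rewrite -nm_gt0 x1.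
have zeta0 : zeta != 0 by rewrite -nm_gt0 z1.
have [j [a [ab nE]]] : exists (j : int) (a : nat), (a < beta)%N /\ n = beta%:Z * j + a%:Z.
  by exists (n %/ beta)%Z, (absz (n %% beta)%Z);
    have := divz_eq n beta; have := ltz_pmod n (b0 : 0 < beta%:Z);
    have := modz_ge0 n (lt0r_neq0 (b0 : 0 < beta%:Z)); lia.
pose zeta' := zeta * xi ^ (- j).
have z1' : nm zeta' = 1 by rewrite nmM nmXz z1 x1 exp1rz mulr1.
have zeta'0 : zeta' != 0 by rewrite -nm_gt0 z1'.
have main f : (forall Q, 0 < nm Q < 1 -> off_lattice (xi * Q ^+ beta) (zeta' * Q ^+ a) ->
      f Q = ssum (xi * Q ^+ beta) (zeta' * Q ^+ a)) ->
    forall Q, 0 < nm Q < 1 -> off_lattice (xi * Q ^+ beta) (zeta * Q ^ n) ->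
      f Q = ssum (xi * Q ^+ beta) (zeta * Q ^ n).
  move=> hf Q /andP[Q0 Q1] hoff; have Qn0 : Q != 0 by rewrite -nm_gt0.
  have p0 : xi * Q ^+ beta != 0 by rewrite mulf_neq0 ?expf_neq0.
  have p1 : nm (xi * Q ^+ beta) < 1 by rewrite nmM x1 mul1r nmXn exprn_ilt1 ?nm_ge0// -lt0n.
  have E : zeta' * Q ^+ a = (xi * Q ^+ beta) ^ (- j) * (zeta * Q ^ n).
    rewrite nE expfzDr// -exprnP /zeta' exprzMl ?unitfE ?expf_neq0// (exprnP Q beta) exprz_exp.
    have : Q ^ (beta%:Z * - j) * Q ^ (beta%:Z * j) = 1.
      by rewrite -expfzDr// mulrN addNr expr0z.
    move: (Q ^ (beta%:Z * - j)) (Q ^ (beta%:Z * j)) => u v uv.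
    by transitivity (zeta * xi ^ (- j) * (u * v) * Q ^+ a); [rewrite uv mulr1|ring].
  rewrite hf; [by rewrite E ssum_shift|by rewrite Q0|rewrite E; exact: off_latticeM].
have [f2 [df2 hf2]] : exists f, disc_series f /\ forall Q l, nm Q < 1 ->
    has_sum (fun n => wfun (zeta'^-1 * xi * Q ^+ (beta - a) * (xi * Q ^+ beta) ^+ n)) l -> f Q = l.
  apply: wfun_lambert_disc; rewrite ?nmM ?nmV ?z1' ?x1 ?invr1 ?mulr1// subn_gt0//.
have px2 Q : Q != 0 -> xi * Q ^+ beta / (zeta' * Q ^+ a) = zeta'^-1 * xi * Q ^+ (beta - a).
  move=> Q0; have -> : Q ^+ beta = Q ^+ (beta - a) * Q ^+ a by rewrite -exprD subnK// ltnW.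
  by field; rewrite zeta'0 expf_neq0.
(* A Lambert series needs a positive starting exponent. For a = 0 the first term does not depend on
   Q and is split off as the constant [wfun zeta']. *)
have [a0|a0] := posnP a.
  have [f1 [df1 hf1]] :=
    wfun_lambert_disc (etrans (nmM zeta' xi) (etrans (congr1 _ x1) (etrans (mulr1 _) z1'))) x1 b0 b0.
  exists (fun Q => wfun zeta' + f1 Q + f2 Q); split.
    by apply: disc_seriesD df2; apply: disc_seriesD df1; exact: disc_series_cst.
  apply: main => Q /andP[Q0 Q1] hoff; have Qn0 : Q != 0 by rewrite -nm_gt0.
  have p0 : xi * Q ^+ beta != 0 by rewrite mulf_neq0 ?expf_neq0.
  have p1 : nm (xi * Q ^+ beta) < 1 by rewrite nmM x1 mul1r nmXn exprn_ilt1 ?nm_ge0// -lt0n.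
  have h1 := hsumP p1 (fun n => off_lattice_r p0 n hoff).
  have h2 := hsumP p1 (fun n => off_lattice_r p0 n (off_latticeV p0 hoff)).
  rewrite ssum_hsum// (px2 Q Qn0) in h2 *.
  rewrite (hf2 Q _ Q1 h2); congr (_ + _).
  rewrite (hf1 Q _ Q1 (has_sum_ext _ (has_sum_nat_behead h1))) => [|m /=].
    by rewrite a0 !expr0 !mulr1 addrC subrK.
  by congr wfun; rewrite a0 expr0 mulr1 exprS; ring.
have [f1 [df1 hf1]] := wfun_lambert_disc z1' x1 a0 b0.
exists (fun Q => f1 Q + f2 Q); split; first exact: disc_seriesD.
apply: main => Q /andP[Q0 Q1] hoff; have Qn0 : Q != 0 by rewrite -nm_gt0.
have p0 : xi * Q ^+ beta != 0 by rewrite mulf_neq0 ?expf_neq0.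
have p1 : nm (xi * Q ^+ beta) < 1 by rewrite nmM x1 mul1r nmXn exprn_ilt1 ?nm_ge0// -lt0n.
have h1 := hsumP p1 (fun n => off_lattice_r p0 n hoff).
have h2 := hsumP p1 (fun n => off_lattice_r p0 n (off_latticeV p0 hoff)).
rewrite ssum_hsum// (px2 Q Qn0) in h2 *.
by rewrite (hf2 Q _ Q1 h2) (hf1 Q _ Q1 h1).
Qed.

Lemma nm_e2pi_ratio (b d : int) : nm (e (b%:~R / d%:~R)) = 1.
Proof.
rewrite nm_e2pi -!(rmorph_int (real_complex R)) -fmorphV -rmorphM /=.
by rewrite mulr0 oppr0 expR0.
Qed.

Lemma nm_e2pi_tenth t : 0 < complex.Im t -> 0 < nm (e (t / 10)) < 1.
Proof.
move=> t0; rewrite nm_gt0 e2pi_neq0 nm_e2pi_lt1//.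
have -> : t / 10 = ((10^-1 : R)%:C)%C * t by rewrite fmorphV rmorph_nat mulrC.
by rewrite Im_real_mul mulr_gt0.
Qed.

(** As T = (g t + B)/D and g D = 10, e(T) is a root of unity times e(t/10)^(g^2), and e(k u) is one
    times e(t/10)^(k a g). Hence e(t/10) serves at every cusp, whatever its width. *)
Lemma haupt_cusp (a b c d : int) : a * d - b * c = 1 ->
  exists N D : C -> C, [/\ disc_series N, disc_series D &
   forall t, 0 < complex.Im t ->
    [/\ N (e (t / 10)) != 0, D (e (t / 10)) != 0 &
     haupt (mobius a b c d t : C) = N (e (t / 10)) / D (e (t / 10))]].
Proof.
move=> h.
have [g [D [B [x1 [x2 [x3 [x4 [[g0 D0 gD hx] [e1 e2 e3 e4 _]]]]]]]]] := cusp_basis h.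
have Dn0 : D%:~R != 0 :> C by rewrite intr_eq0 gt_eqF.
have gDC : g%:~R * D%:~R = 10 :> C by rewrite -intrM gD.
pose G := absz g; have GE : g = G%:Z by rewrite /G; lia.
have TE t : e ((g%:~R * t + B%:~R) / D%:~R) = e (B%:~R / D%:~R) * e (t / 10) ^+ (G * G).
  rewrite -e2piXn -e2piD; congr e2pi.
  have -> : (G * G)%:R = g%:~R * g%:~R :> C by rewrite natrM GE.
  by rewrite -gDC; field; rewrite Dn0 intr_eq0 gt_eqF.
have UE (k : nat) t : e (k%:R * ((a%:~R * t + b%:~R) / D%:~R)) =
    e ((k%:Z * b)%:~R / D%:~R) * e (t / 10) ^ (k%:Z * a * g).
  rewrite -e2piXz -e2piD; congr e2pi.
  rewrite !intrM -gDC; field; rewrite Dn0 intr_eq0 gt_eqF//.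
have GG : (0 < G * G)%N by rewrite muln_gt0 /G; lia.
have F (k : nat) := @ssum_disc_series (e ((k%:Z * b)%:~R / D%:~R)) (e (B%:~R / D%:~R))
   (k%:Z * a * g) (G * G) (nm_e2pi_ratio _ _) (nm_e2pi_ratio _ _) GG.
have [f1 [d1 h1]] := F 1%N; have [f2 [d2 h2]] := F 2%N.
have [f3 [d3 h3]] := F 3%N; have [f4 [d4 h4]] := F 4%N.
exists (fun Q => f2 Q - f4 Q), (fun Q => f1 Q - f3 Q); split; try exact: disc_seriesB.
move=> t t0; have Q01 := nm_e2pi_tenth t0.
have [off2 off4 k24] := sdiff_modular h g0 D0 hx e1 e2 e3 e4 t0 (isT : (0 < 2 < 10)%N) (isT : (0 < 4 < 10)%N).
have [off1 off3 k13] := sdiff_modular h g0 D0 hx e1 e2 e3 e4 t0 (isT : (0 < 1 < 10)%N) (isT : (0 < 3 < 10)%N).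
rewrite TE (UE 1%N) in off1; rewrite TE (UE 2%N) in off2.
rewrite TE (UE 3%N) in off3; rewrite TE (UE 4%N) in off4.
have [nd nn _] := hauptE (Im_mobius_gt0 h t0).
move: nd nn; rewrite /haupt /haupt_den /haupt_num k24 k13 /sdiff !TE !UE.
rewrite -(h1 _ Q01 off1) -(h2 _ Q01 off2) -(h3 _ Q01 off3) -(h4 _ Q01 off4).
move: (((c%:~R * t + d%:~R) / D%:~R) ^+ 2) (f2 (e (t / 10)) - f4 (e (t / 10)))
  (f1 (e (t / 10)) - f3 (e (t / 10))) => w x y.
rewrite !mulf_eq0 !negb_or => /andP[w0 y0] /andP[_ x0]; split=> //.
by rewrite -mulf_div divff// mul1r.
Qed.

(** A global expression of V through e(t), from which its complex differentiability on H is read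
    off. *)
Lemma haupt_disc : exists N D : C -> C, [/\ disc_series N, disc_series D &
   forall t, 0 < complex.Im t ->
    [/\ N (e t) != 0, D (e t) != 0 & haupt t = N (e t) / D (e t)]].
Proof.
have F (k : nat) := @ssum_disc_series 1 1 k%:Z 10 (nm1 R) (nm1 R) isT.
have [f1 [d1 h1]] := F 1%N; have [f2 [d2 h2]] := F 2%N.
have [f3 [d3 h3]] := F 3%N; have [f4 [d4 h4]] := F 4%N.
exists (fun Q => f2 Q - f4 Q), (fun Q => f1 Q - f3 Q); split; try exact: disc_seriesB.
move=> t t0.
have Q01 : 0 < nm (e t) < 1 by rewrite nm_gt0 e2pi_neq0 nm_e2pi_lt1.
have E (k : nat) f : (0 < k < 10)%N -> (forall Q, 0 < nm Q < 1 ->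
    off_lattice (1 * Q ^+ 10) (1 * Q ^ k%:Z) -> f Q = ssum (1 * Q ^+ 10) (1 * Q ^ k%:Z)) ->
    f (e t) = ssum (e (10 * t)) (e (k%:R * t)).
  move=> hk hf; have := lterm_off_lattice (fun mn => lterm_tenth_neq0 mn hk t0).
  by rewrite !e2piXn => o; rewrite hf ?mul1r.
rewrite (E _ _ _ h1)// (E _ _ _ h2)// (E _ _ _ h3)// (E _ _ _ h4)//.
by have [nd nn _] := hauptE t0; split.
Qed.

Lemma e2pi_tenth_small (rho : R) : 0 < rho -> exists y0 : R, 0 < y0 /\
  forall t, y0 < complex.Im t -> nm (e (t / 10)) < rho.
Proof.
(* Im t > 10/rho makes X = 2 pi Im t / 10 exceed 1/rho, and exp(X) >= 1 + X. *)
move=> rho0; exists (10 / rho); split=> [|t ty]; first by rewrite divr_gt0.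
have t0 : 0 < complex.Im t by apply: lt_trans ty; rewrite divr_gt0.
have -> : t / 10 = ((10^-1 : R)%:C)%C * t by rewrite fmorphV rmorph_nat mulrC.
rewrite nm_e2pi Im_real_mul expRN.
set X := 2 * pi * _.
have hX : rho^-1 < X.
  have p2 : 2 <= pi :> R := pi_ge2 R.
  have h : rho^-1 < 10^-1 * complex.Im t.
    by rewrite mulrC ltr_pdivlMr// mulrC.
  have i0 : 0 < rho^-1 by rewrite invr_gt0.
  apply: lt_le_trans h _; rewrite /X.
  have : 0 <= 10^-1 * complex.Im t by rewrite mulr_ge0// ltW.
  by move: (10^-1 * complex.Im t) => Z Z0; nra.
rewrite -[ltRHS]invrK ltf_pV2 ?posrE ?expR_gt0 ?invr_gt0//.
by apply: lt_le_trans hX _; have := expR_ge1Dx X; lra.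
Qed.
End Cusps.

(** * Modularity of rational expressions in V *)

Section ModularFunctions.
Variable R : realType.
Local Notation C := R[i].
Local Notation e := (@e2pi R : C -> C).
Implicit Types t z Q : C.

Lemma disc_series_e2pi_derivable (N : C -> C) t : disc_series N -> 0 < complex.Im t ->
  derivable (N \o e : CC R -> CC R) (t : CC R) 1.
Proof.
move=> hN t0; have [L hL] := disc_series_qdiff hN (nm_e2pi_lt1 t0).
exact: qdiff_derivable (qdiff_comp (qdiff_e2pi t) hL).
Qed.

(** Stated for f = phi(V) to serve both functions. [A] and [B] are numerator and denominator of
    phi(n/d) with divisions cleared: at a cusp both n and d may vanish, yet A and B stay power
    series, so f is a quotient of germs. *)
Lemma haupt_modular (f phi : C -> C) (A B : C -> C -> C) :
  (forall t, 0 < complex.Im t -> f t = phi (haupt t)) ->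
  (forall (g : CC R -> CC R) z, derivable g z 1 -> g z != 0 ->
     derivable (phi \o g : CC R -> CC R) z 1) ->
  (forall N D, germ N -> germ D -> germ (fun z => A (N z) (D z)) /\ germ (fun z => B (N z) (D z))) ->
  (forall n d, n != 0 -> d != 0 -> B n d != 0 /\ phi (n / d) = A n d / B n d) ->
  modular_function_Gamma0 10 (f : CC R -> CC R).
Proof.
move=> hf hder hgerm hAB; split.
- have [N [D [dN dD hND]]] := haupt_disc R.
  (* No pole has to be cleared on H, hence order 0; the disc of radius Im z0 around z0 lies in H. *)
  move=> z0 z00; exists 0%N, (complex.Im z0), (phi \o (fun t => N (e t) / D (e t))).
  have HIm (z : CC R) : `|z - z0| < ((complex.Im z0)%:C)%C -> 0 < complex.Im z.
    rewrite -[`|_|]/((nm (z - z0))%:C)%C ltcR => hz.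
    have := le_lt_trans (nm_Im _) hz; rewrite raddfB /= ltr_norml => /andP[h1 _].
    by move: h1; lra.
  split; [exact: z00|split=> z hz].
    have t0 := HIm z hz; have [n0 d0 _] := hND z t0.
    apply: hder; last by rewrite mulf_neq0 ?invr_eq0.
    apply: (derivableM (disc_series_e2pi_derivable dN t0)).
    exact: (derivableV d0 (disc_series_e2pi_derivable dD t0)).
  move: hz => /andP[_ hz]; have t0 := HIm z hz; have [n0 d0 hh] := hND z t0.
  by rewrite expr0 mul1r hf//= hh.
- move=> a b c d h c10 t t0.
  by rewrite (hf t t0) -(haupt_Gamma0 h c10 t0); apply: hf; exact: Im_mobius_gt0.
move=> a b c d h; have [N [D [dN dD hND]]] := haupt_cusp R h.
have [gA gB] := hgerm _ _ (disc_series_germ dN) (disc_series_germ dD).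
have iy (y : R) : complex.Im ((0 +i* y)%C : C) = y by [].
(* Points t = iy with y large give arguments e(t/10) close to 0 where the denominator is nonzero. *)
have small (rho : R) : 0 < rho -> exists z, nm z < rho /\ B (N z) (D z) != 0.
  move=> /e2pi_tenth_small[y0 [y00 hy]]; exists (e ((0 +i* (y0 + 1))%C / 10)).
  have [n0 d0 _] := hND (0 +i* (y0 + 1))%C ltac:(by rewrite iy; lra).
  by split; [apply: hy; rewrite iy; lra|have [] := hAB _ _ n0 d0].
have [m [cf [rho [rho0 hcf]]]] := germ_quotient gA gB small.
have [y0 [y00 hy]] := e2pi_tenth_small rho0.
exists 10%N, m, (cf : nat -> CC R), y0; split=> // t ty.
have t0 : 0 < complex.Im t := lt_trans y00 ty.
have [n0 d0 hh] := hND t t0; have [_ hphi] := hAB _ _ n0 d0.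
have Q0 : 0 < nm (e (t / 10)) by rewrite nm_gt0 e2pi_neq0.
have := hcf (e (t / 10)); rewrite Q0 hy// => /(_ isT)/has_sum_nat_cvs/cvs_cvg.
rewrite -hphi -hh -hf; last exact: Im_mobius_gt0.
exact.
Qed.

Lemma derivable_laurent (g : CC R -> CC R) z : derivable g z 1 -> g z != 0 ->
  derivable ((fun v : C => v^-1 - 2 + 3 * v) \o g : CC R -> CC R) z 1.
Proof.
move=> dg g0; have dV := derivableV g0 dg.
apply: (derivableD (f := fun y => (g y)^-1 - 2) (g := fun y => 3 * g y)).
  apply: (derivableB (f := fun y => (g y)^-1) (g := fun=> 2)); [exact: dV|exact: derivable_cst].
apply: (derivableM (f := fun=> 3)); [exact: derivable_cst|exact: dg].
Qed.
End ModularFunctions.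

Theorem theorem3p6 (R : realType) :
  [/\ modular_function_Gamma0 10
        (fun tau : CC R => Ifun tau ^+ 4 + (Jfun tau ^+ 4)^-1),
      modular_function_Gamma0 10
        (fun tau : CC R => Jfun tau ^+ 4 + (Ifun tau ^+ 4)^-1)
    & forall tau : CC R, inH tau ->
        let U := Ifun tau / Jfun tau in
        Ifun tau ^+ 4 + (Jfun tau ^+ 4)^-1 = U ^- 2 - 2 + 3 * U ^+ 2 /\
        Jfun tau ^+ 4 + (Ifun tau ^+ 4)^-1 = U ^- 6 - 2 * U ^- 4 + 3 * U ^- 2].
Proof.
split.
(* With v = n/d the common denominator is n d. *)
- apply: (@haupt_modular R _ (fun v => v^-1 - 2 + 3 * v)
    (fun n d => d * d - 2 * (n * d) + 3 * (n * n)) (fun n d => n * d)).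
  + by move=> t /IJ_haupt[].
  + by move=> g z dg g0; exact: derivable_laurent.
  + move=> N D gN gD; split; last exact: germM.
    apply: germD; first apply: germD.
    * exact: germM.
    * have := germM (germ_cst (-2)) (germM gN gD); congr germ; apply/funext => z; ring.
    * exact: germM (germ_cst 3) (germM gN gN).
  + move=> n d n0 d0; split; first by rewrite mulf_neq0.
    by field; rewrite n0 d0.
(* The second function is V^-2 times the first, so [derivable_laurent] can be reused; the common
   denominator becomes n^3. *)
- apply: (@haupt_modular R _ (fun v => v^-1 * v^-1 * (v^-1 - 2 + 3 * v))
    (fun n d => d * d * d - 2 * (n * d * d) + 3 * (n * n * d)) (fun n d => n * n * n)).
  + move=> t t0; have [_ _ ->] := IJ_haupt t0.
    have [d0 n0 _] := hauptE t0.
    have : haupt t != 0 := mulf_neq0 n0 (invr_neq0 d0).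
    by move: (haupt t) => v v0; field.
  + move=> g z dg g0.
    have dV := derivableV g0 dg.
    exact: (derivableM (derivableM dV dV) (derivable_laurent dg g0)).
  + move=> N D gN gD; split; last by apply: germM => //; exact: germM.
    apply: germD; first apply: germD.
    * by apply: germM => //; exact: germM.
    * have := germM (germ_cst (-2)) (germM (germM gN gD) gD); congr germ; apply/funext => z; ring.
    * exact: germM (germ_cst 3) (germM (germM gN gN) gD).
  + move=> n d n0 d0; split; first by rewrite !mulf_neq0.
    by field; rewrite n0 d0.
move=> t t0 U; have [hU h1 h2] := IJ_haupt t0.
rewrite -/U in hU; rewrite -hU in h1 h2.
split; first exact: h1.
by move: h2; rewrite -!exprM; exact.
Qed.
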